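(* Let $p>2$ be a prime, $q=p^n$, $\psi$ a nontrivial additive character of $\mathbb{F}_p$, and let $d$ range over natural numbers with $(d,p)=1$. Let $V$ be a Schwartz function on $\mathbb{R}^2$ whose Fourier transform $\hat V(\eta,\xi)=\frac{1}{4\pi^2}\int\int V(t,u)e^{-i\eta t-i\xi u}\,dt\,du$ is supported on the set $\{|\eta|+|\xi|\le 1\}$. Put $v_{d-1}(t,u)=\sum_{m,n=-\infty}^\infty V((d-1)(t+2\pi m),(d-1)(u+2\pi n))$. For $f\in\mathcal{F}_d$ with normalised zeroes $\rho_j=e^{i\theta_j}$ ($1\le j\le d-1$) of $L_{f,\psi}$ and a real number $\theta$, let $$S^2_\theta(f,\psi)=\sum_{1\le j,k\le d-1,\ j\neq k}v_{d-1}(\theta_j-\theta,\theta_k-\theta).$$ Then for every $\theta$, the average of $S^2_\theta(f,\psi)$ over $f\in\mathcal{F}_d$ (uniform) equals $$\frac{1}{4\pi^2}\int_{-\infty}^\infty\int_{-\infty}^\infty V(t,u)\left(1-\left(\frac{\sin((t-u)/2)}{(t-u)/2}\right)^2\right)dt\,du+o(1)$$ as $d\to\infty$.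
   Context: $\mathcal{F}_d$ denotes the set of polynomials $f=\sum_{i=0}^d a_ix^i\in\mathbb{F}_q[x]$ with $a_d\neq 0$ and $a_i=0$ for every $i\ge 0$ divisible by $p$. For $f\in\mathcal{F}_d$, $L_{f,\psi}(z)=\exp\left(\sum_{r\ge1}\sum_{\alpha\in\mathbb{F}_{q^r}}\psi(\mathrm{Tr}_{\mathbb{F}_{q^r}/\mathbb{F}_p}f(\alpha))z^r/r\right)$ is a polynomial of degree $d-1$ factoring as $\prod_{i=1}^{d-1}(1-q^{1/2}\rho_iz)$ with $|\rho_i|=1$; the $\rho_i$ are its normalised zeroes. *)

(* Defs.v *)
From HB Require Import structures.
From mathcomp Require Import all_boot all_order all_algebra.
From mathcomp Require Import all_classical all_reals all_analysis.
From mathcomp Require Import complex.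
Import numFieldNormedType.Exports.
Set Implicit Arguments. Unset Strict Implicit. Unset Printing Implicit Defensive.
Import Order.TTheory GRing.Theory Num.Theory.
Local Open Scope ring_scope.
Local Open Scope complex_scope.

Section Defs.
Variable R : realType.

Definition Rec (z : R[i]) : R := let: Complex a _ := z in a.
Definition Imc (z : R[i]) : R := let: Complex _ b := z in b.

Definition expi (x : R) : R[i] := Complex (cos x) (sin x).

Definition sinc (x : R) : R := if x == 0 then 1 else sin x / x.

Definition int2 (g : R -> R -> R) : R :=
  Rintegral ((@lebesgue_measure R) \x (@lebesgue_measure R))%E setT
    (fun x => g x.1 x.2).

Definition cint2 (g : R -> R -> R[i]) : R[i] :=
  Complex (int2 (fun t u => Rec (g t u))) (int2 (fun t u => Imc (g t u))).

Definition dt (g : R -> R -> R) : R -> R -> R :=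
  fun t u => derive1 (fun s => g s u) t.
Definition du (g : R -> R -> R) : R -> R -> R :=
  fun t u => derive1 (g t) u.
Definition pd (a b : nat) (g : R -> R -> R) : R -> R -> R :=
  iter a dt (iter b du g).

Definition smooth2 (g : R -> R -> R) : Prop :=
  forall a b : nat,
    continuous (fun x : R * R => pd a b g x.1 x.2) /\
    (forall t u, derivable (fun s => pd a b g s u) t 1 /\
                 derivable (pd a b g t) u 1).

Definition schwartz2 (g : R -> R -> R) : Prop :=
  smooth2 g /\
  forall a b k l : nat, exists M : R, forall t u : R,
    `|t| ^+ k * `|u| ^+ l * `|pd a b g t u| <= M.

Definition schwartzC (V : R -> R -> R[i]) : Prop :=
  schwartz2 (fun t u => Rec (V t u)) /\ schwartz2 (fun t u => Imc (V t u)).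

Definition fourier2 (V : R -> R -> R[i]) (eta xi : R) : R[i] :=
  ((4 * pi ^+ 2)^-1)%:C * cint2 (fun t u => V t u * expi (- (eta * t + xi * u))).

(* symmetric partial sums of  sum_{m,n} g (c (t + 2 pi m), c (u + 2 pi n)) *)
Definition psum (g : R -> R -> R) (c t u : R) (N : nat) : R :=
  \sum_(i < N.*2.+1) \sum_(j < N.*2.+1)
     g (c * (t + 2 * pi * (((i : nat) : int) - (N : int))%:~R))
       (c * (u + 2 * pi * (((j : nat) : int) - (N : int))%:~R)).

Definition vper (V : R -> R -> R[i]) (c t u : R) : R[i] :=
  Complex (limn (psum (fun t u => Rec (V t u)) c t u))
          (limn (psum (fun t u => Imc (V t u)) c t u)).

Definition S2 (V : R -> R -> R[i]) (c : R) (ths : seq R) (th : R) : R[i] :=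
  \sum_(j < size ths) \sum_(k < size ths | j != k)
     vper V c (ths`_j - th) (ths`_k - th).

Definition mainterm (V : R -> R -> R[i]) : R[i] :=
  ((4 * pi ^+ 2)^-1)%:C *
  cint2 (fun t u => V t u * (1 - sinc ((t - u) / 2) ^+ 2)%:C).

Definition add_char (p : nat) (psi : 'F_p -> R[i]) : Prop :=
  (forall x y, psi (x + y) = psi x * psi y) /\ (forall x, psi x != 0).

End Defs.

Definition abstr (K : finFieldType) (p : nat) (x : K) : K :=
  \sum_(i < logn p #|K|) x ^+ (p ^ i).

(* the element of F_p corresponding to the (prime-field valued) trace *)
Definition trFp (K : finFieldType) (p : nat) (x : K) : 'F_p :=
  odflt 0 (omap (fun k : 'I_p => ((k : nat)%:R : 'F_p))
                [pick k : 'I_p | ((k : nat)%:R : K) == abstr p x]).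

(* the exponential sum  sum_{alpha in F_{q^r}} psi(Tr f(alpha)),
   where K is a field of size q^r containing F via the embedding iota *)
Definition Ssum (R : realType) (F K : finFieldType) (iota : {rmorphism F -> K})
  (p : nat) (psi : 'F_p -> R[i]) (f : {poly F}) : R[i] :=
  \sum_(x : K) psi (trFp p (map_poly iota f).[x]).

(* ths are (arguments of) the normalised zeroes of L_{f,psi}: taking the
   logarithm of  exp(sum_r S_r z^r / r) = prod_j (1 - q^{1/2} rho_j z),
   S_r = - sum_j (q^{1/2} rho_j)^r for all r >= 1, rho_j = e^{i theta_j}. *)
Definition normalised_zeros (R : realType) (F : finFieldType) (p : nat)
  (psi : 'F_p -> R[i]) (f : {poly F}) (ths : seq R) : Prop :=
  forall r : nat, (0 < r)%N ->
  forall (K : finFieldType) (iota : {rmorphism F -> K}),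
    #|K| = (#|F| ^ r)%N ->
    Ssum iota psi f =
      - \sum_(th <- ths) (((Num.sqrt (#|F|%:R : R))%:C * expi th) ^+ r)%R.

(* F_d, encoded by coefficient vectors (a_0, ..., a_d) *)
Definition Fd (F : finFieldType) (p d : nat) : {set {ffun 'I_d.+1 -> F}} :=
  [set a : {ffun 'I_d.+1 -> F} | (a ord_max != 0) && [forall i : 'I_d.+1, (p %| i)%N ==> (a i == 0)]].

Definition poly_of (F : finFieldType) (d : nat) (a : {ffun 'I_d.+1 -> F}) : {poly F} :=
  \poly_(i < d.+1) a (inord i).

(* Main.v *)
Require Import Defs.
From HB Require Import structures.
From mathcomp Require Import all_boot all_order all_algebra.
From mathcomp Require Import all_classical all_reals all_analysis.
From mathcomp Require Import complex.
From mathcomp Require Import all_field measurable_realfun ring lra zify.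
Import numFieldNormedType.Exports.
Import Order.TTheory GRing.Theory Num.Theory.
Local Open Scope ring_scope.
Local Open Scope complex_scope.
Set Implicit Arguments.
Unset Strict Implicit.
Unset Printing Implicit Defensive.

(* Since the Fourier transform of V is supported in |eta| + |xi| <= 1, Poisson
   summation (proved here by Fejer summation of the two periodic variables) turns
   S^2_theta into the finite sum, over integers |k| + |l| <= N = d - 1, of
   Fourier coefficients of V at frequencies (k/N, l/N) against
   e^(-i(k+l)theta) (T_k T_l - T_(k+l)), where T_k = sum_j rho_j^k.
   By the definition of the zeroes, q^(|k|/2) T_k is, up to sign, the sum of
   psi(+-Tr f(a)) over a in the extension of degree |k|. Averaging over f, the
   pair (a, b) contributes 0 unless the characters attached to a and b cancel:
   a coefficient shift of f shows that nonconjugate a, b contribute only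
   when both are 0 or generate a subfield of index divisible by p in their
   extension; as p > 2 there are at most q^(k/3) such a in degree k. Conjugate pairs give |k|
   when k + l = 0. Hence
   <T_k T_l> - <T_(k+l)> equals
     N^2 [k = l = 0] - (N - |k|) [k + l = 0]
   up to errors O(rho^|k+l| + N rho^(|k|+|l|)) with rho < 1, whose total is O(N)
   against the normalisation N^-2. The diagonal term sums to N times the Fejer
   kernel at (t - u)/N, which tends to the squared sinc by dominated convergence. *)

(** The bound [|k| + |l| <= d - 1] is what the averaging lives on. To isolate a point x of degree at
    most |k| from a point y of degree at most |l|, [f] is shifted by [X * Q * h], with [Q] the
    minimal polynomial of y and [h] of degree below that of x. This shift has degree below [d], so
    it never touches the leading coefficient. It may involve exponents divisible by [p], where the
    coefficients of [f] are forced to be 0; there Tr((b x^j)^p) = Tr(b x^j) moves the question down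
    to the exponent j.

    The count q^(k/3) has to beat the square-root normalisation q^(k/2); for p = 2 the exceptional
    points could number q^(k/2), and no decay would be left.

    As [vper] is a limit of partial sums over squares, that convergence itself must be proved at
    every point. The Fejer kernel is nonnegative with a fixed mass on each period, so tails are
    bounded uniformly in its order, and the limits in the order and in the size of the square can be
    interchanged. Band limitation then makes every Fejer mean a finite sum. *)

(** * Measurability and product integrals on the plane *)

Section PlaneIntegral.
Variable R : realType.
Local Open Scope classical_set_scope.
Local Notation mu := (@lebesgue_measure R).
Local Notation mu2 := ((@lebesgue_measure R) \x (@lebesgue_measure R))%E.
Local Notation RR := (measurableTypeR R * measurableTypeR R)%type.

(** The plane has a countable base of rational squares, which are measurable for the product
    structure. This is what makes continuous integrands measurable for the product measure. *)
Lemma measurable_open_plane (U : set (R * R)) : open U ->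
  measurable (U : set RR).
Proof.
move=> oU.
pose sq (a b e : R) : set RR :=
  [set x | `|x - a| < e] `*` [set y | `|y - b| < e].
have mball (a e : R) : measurable ([set x | `|x - a| < e] : set (measurableTypeR R)).
  have -> : [set x | `|x - a| < e] = ball a e.
    by apply/seteqP; split=> x; rewrite /ball /= distrC.
  exact: measurable_ball.
have msq a b e : measurable (sq a b e) by exact: measurableX.
have -> : U = \bigcup_(q : rat * rat * rat)
    (if `[< sq (ratr q.1.1) (ratr q.1.2) (ratr q.2) `<=` U >]
     then sq (ratr q.1.1) (ratr q.1.2) (ratr q.2) else set0).
  apply/seteqP; split=> [[x y] Uxy|[x y] [q _]]; last first.
    by case: asboolP => // sub; apply: sub.
  have /nbhs_ballP[e /= e0 sub] : nbhs (x, y) U by exact: open_nbhs_nbhs.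
  (* A rational radius below [e / 2] and a rational centre within that radius of [(x, y)] give a
     square that contains the point and stays in its [e]-ball. *)
  have e20 : 0 < e / 2 by lra.
  have [q] := rat_in_itvoo e20; rewrite in_itv /= => /andP[q0 qe].
  have approx (z : R) : exists r : rat, `|z - ratr r| < ratr q.
    have zq : z - ratr q < z + ratr q by lra.
    have [r] := rat_in_itvoo zq.
    rewrite in_itv /= => rr; exists r.
    by rewrite ltr_norml; lra.
  have [a xa] := approx x.
  have [b yb] := approx y.
  exists (a, b, q); first by [].
  rewrite /= asboolT // => z [/= h1 h2]; case: z h1 h2 => x' y' /= h1 h2.
  apply: sub; split => /=.
    rewrite /ball /= (le_lt_trans (ler_distD (ratr a) _ _))//.
    by rewrite (distrC _ x'); lra.
  rewrite /ball /= (le_lt_trans (ler_distD (ratr b) _ _))//.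
  by rewrite (distrC _ y'); lra.
apply: (@countable_bigcupT_measurable _ _ (rat * rat * rat)%type) => [|q].
  exact: countableP.
by case: asboolP.
Qed.

Lemma continuous_measurable_plane (g : R * R -> R) : continuous g ->
  measurable_fun [set: RR] (g : RR -> R).
Proof.
move=> cg; apply: (measurability _ (RGenOpens.measurableE R)).
move=> _ [_ [a [b ->]] <-]; rewrite setTI.
apply: measurable_open_plane.
by apply: open_comp => // x _; exact: cg.
Qed.

Lemma ge0_integral_prod (a b : R -> \bar R) :
  measurable_fun setT a -> measurable_fun setT b ->
  (forall x, 0 <= a x)%E -> (forall x, 0 <= b x)%E ->
  (\int[mu2]_z (a z.1 * b z.2) = \int[mu]_x a x * \int[mu]_y b y)%E.
Proof.
move=> ma mb a0 b0.
transitivity (\int[mu]_x fubini_F mu (fun z : RR => a z.1 * b z.2) x)%E.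
  apply: (@fubini_tonelli1 _ _ _ _ _ mu mu (fun z : RR => a z.1 * b z.2)%E).
    apply: emeasurable_funM.
    + exact: (measurableT_comp ma measurable_fst).
    + exact: (measurableT_comp mb measurable_snd).
  by move=> x; apply: mule_ge0.
rewrite /fubini_F /=.
under eq_integral => x _ do rewrite ge0_integralZl//.
by rewrite ge0_integralZr// integral_ge0.
Qed.

End PlaneIntegral.

Lemma cvg_bigsum (T : Type) (F : set_system T) {FF : Filter F} (R : realType)
    (I : Type) (s : seq I) (f : I -> T -> R) (l : I -> R) :
  (forall i, (f i x @[x --> F] --> l i)%classic) ->
  ((\sum_(i <- s) f i x) @[x --> F] --> \sum_(i <- s) l i)%classic.
Proof.
move=> fl; elim: s => [|i s IH].
  by rewrite big_nil; under eq_fun do rewrite big_nil; exact: cvg_cst.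
by rewrite big_cons; under eq_fun do rewrite big_cons; exact: cvgD.
Qed.

Lemma continuous_bigsum (T : topologicalType) (R : realType) (I : Type)
    (s : seq I) (f : I -> T -> R) :
  (forall i, continuous (f i)) -> continuous (fun x => \sum_(i <- s) f i x).
Proof. by move=> cf x; apply: cvg_bigsum => i; exact: cf. Qed.

(** * Fejer kernels *)

Section Fejer.
Variable R : realType.
Implicit Types (x t c : R) (M : nat).

(** For M > 0 this is the sum over |m| < M of (1 - |m|/M) cos (m x), with mean 1 over a period. Left
    as a double sum, it is |sum_(k < M) e^(ikx)|^2 / M, hence nonnegative. *)
Definition fejer M x : R :=
  M%:R^-1 * \sum_(k < M) \sum_(l < M) cos ((k%:R - l%:R) * x).

Lemma fejerE M x : fejer M x =
  M%:R^-1 * ((\sum_(k < M) cos (k%:R * x)) ^+ 2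
             + (\sum_(k < M) sin (k%:R * x)) ^+ 2).
Proof.
rewrite /fejer; congr (_ * _).
rewrite !expr2 !big_distrlr /= -big_split /=.
apply: eq_bigr => k _; rewrite -big_split /=; apply: eq_bigr => l _.
by rewrite mulrBl cosB.
Qed.

Lemma fejer_ge0 M x : 0 <= fejer M x.
Proof.
by rewrite fejerE mulr_ge0 ?invr_ge0 ?ler0n// addr_ge0 ?sqr_ge0.
Qed.

Lemma fejer1 x : fejer 1 x = 1.
Proof. by rewrite /fejer !big_ord1 subrr mul0r cos0 invr1 mulr1. Qed.

(* [|1 - e^(ix)|^2 |sum_(k < M) e^(ikx)|^2 = |1 - e^(iMx)|^2] in real form. *)
Lemma fejer_geometric M x :
  fejer M x * (2 - 2 * cos x) = (2 - 2 * cos (M%:R * x)) / M%:R.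
Proof.
rewrite fejerE; set C := \sum_(k < M) cos _; set S := \sum_(k < M) sin _.
have /andP[/eqP UE /eqP VE] :
    (C * (1 - cos x) + S * sin x == 1 - cos (M%:R * x)) &&
    (S * (1 - cos x) - C * sin x == - sin (M%:R * x)).
  rewrite {}/C {}/S; elim: M => [|M /andP[/eqP UE /eqP VE]].
    by rewrite !big_ord0 !mul0r cos0 sin0; apply/andP; split; apply/eqP; ring.
  rewrite !big_ord_recr /= (_ : M.+1%:R * x = M%:R * x + x); last first.
    by rewrite -natr1 mulrDl mul1r.
  rewrite cosD sinD.
  set C := \sum_(k < M) cos _ in UE VE *; set S := \sum_(k < M) sin _ in UE VE *.
  apply/andP; split; apply/eqP.
    transitivity ((C * (1 - cos x) + S * sin x) + cos (M%:R * x) * (1 - cos x)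
      + sin (M%:R * x) * sin x); [ring|rewrite UE; ring].
  transitivity ((S * (1 - cos x) - C * sin x) + sin (M%:R * x) * (1 - cos x)
      - cos (M%:R * x) * sin x); [ring|rewrite VE; ring].
have c1 := cos2Dsin2 x; have c2 := cos2Dsin2 (M%:R * x).
have -> : 2 - 2 * cos (M%:R * x) =
    (1 - cos (M%:R * x)) ^+ 2 + (- sin (M%:R * x)) ^+ 2.
  have -> : (1 - cos (M%:R * x)) ^+ 2 + (- sin (M%:R * x)) ^+ 2 =
    1 - 2 * cos (M%:R * x) + (cos (M%:R * x) ^+ 2 + sin (M%:R * x) ^+ 2) by ring.
  by rewrite c2; ring.
rewrite -UE -VE.
have -> : (C * (1 - cos x) + S * sin x) ^+ 2 + (S * (1 - cos x) - C * sin x) ^+ 2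
   = (C ^+ 2 + S ^+ 2) * (1 - 2 * cos x + (cos x ^+ 2 + sin x ^+ 2)) by ring.
by rewrite c1; ring.
Qed.

(** Concentration: the kernel is O(1/M) wherever [2 - 2 * cos x] is bounded below. The product form
    needs no division at the peaks. *)
Lemma fejer_cos_le M x : fejer M x * (2 - 2 * cos x) <= 4 / M%:R.
Proof.
rewrite fejer_geometric ler_wpM2r ?invr_ge0 ?ler0n//.
by have := cos_geN1 (M%:R * x); lra.
Qed.

Lemma cos_intD (m : int) x : cos (x + m%:~R * (2 * pi)) = cos x.
Proof.
have pos (n : nat) (y : R) : cos (y + n%:R * (2 * pi)) = cos y.
  rewrite (mulr_natl (2 * pi) n) (mulr_natl pi 2).
  exact: (periodicn (@cosD2pi R) n y).
case: m => n; first exact: pos.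
by rewrite NegzE mulrNz mulNr -[LHS](pos n.+1) -addrA addNr addr0.
Qed.

Lemma sin_intD (m : int) x : sin (x + m%:~R * (2 * pi)) = sin x.
Proof. by rewrite -!cosBpihalf addrAC cos_intD. Qed.

Lemma continuous_fejer M : continuous (@fejer M).
Proof.
have cc (u : R) : continuous (fun x => cos (u * x)).
  move=> x; apply: (@continuous_comp _ _ _ (fun x => u * x) cos).
    exact: mulrl_continuous.
  exact: continuous_cos.
move=> x; apply: cvgM; first exact: cvg_cst.
by apply: continuous_bigsum => k; apply: continuous_bigsum => l; exact: cc.
Qed.

End Fejer.

(** * Nonnegative majorants of bounded mass *)

Section Bounds.
Local Open Scope classical_set_scope.
Context d (T : measurableType d) (R : realType) (mu : {measure set T -> \bar R}).
Implicit Types (f g h : T -> R) (A B : R).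

(** Measurability, sign and mass travel together, so a majorant is assembled by sums, scalings and
    products without side conditions; [nnbound_dominated] then yields integrability and a bound for
    the signed function below it. *)
Definition nnbound f A := [/\ measurable_fun setT f, (forall x, 0 <= f x) &
  (\int[mu]_x (f x)%:E <= A%:E)%E].

Lemma nnboundD f g A B : nnbound f A -> nnbound g B ->
  nnbound (fun x => f x + g x) (A + B).
Proof.
move=> [mf f0 fA] [mg g0 gB]; split.
- exact: measurable_funD.
- by move=> x; rewrite addr_ge0.
- under eq_integral do rewrite EFinD.
  rewrite ge0_integralD//; try by move=> x _; rewrite lee_fin.
  + by rewrite EFinD leeD.
  + exact/measurable_EFinP.
  + exact/measurable_EFinP.
Qed.

Lemma nnboundZ f A k : 0 <= k -> nnbound f A ->
  nnbound (fun x => k * f x) (k * A).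
Proof.
move=> k0 [mf f0 fA]; split.
- exact: measurable_funM.
- by move=> x; rewrite mulr_ge0.
- under eq_integral do rewrite EFinM.
  rewrite ge0_integralZl//; try by move=> x _; rewrite lee_fin.
  + by rewrite EFinM lee_pmul// ?lee_fin// integral_ge0// => x _; rewrite lee_fin.
  + exact/measurable_EFinP.
Qed.

Lemma nnbound_le f g A : measurable_fun setT f -> (forall x, 0 <= f x <= g x) ->
  nnbound g A -> nnbound f A.
Proof.
move=> mf fg [mg g0 gA]; split => //; first by move=> x; case/andP: (fg x).
apply: le_trans gA; apply: ge0_le_integral => //.
- by move=> x _; rewrite lee_fin; case/andP: (fg x).
- exact/measurable_EFinP.
- exact/measurable_EFinP.
- by move=> x _; rewrite lee_fin; case/andP: (fg x).
Qed.

Lemma nnbound_dominated h f A : measurable_fun setT h ->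
  (forall x, `|h x| <= f x) -> nnbound f A ->
  mu.-integrable setT (EFin \o h) /\ `|\int[mu]_x h x| <= A.
Proof.
move=> mh hf nf.
have [mn _ nA] : nnbound (fun x => `|h x|) A.
  by apply: nnbound_le nf => [|x]; [exact: measurableT_comp|rewrite normr_ge0 hf].
have ih : mu.-integrable setT (EFin \o h).
  apply/integrableP; split; first exact/measurable_EFinP.
  by apply: le_lt_trans nA _; rewrite ltry.
split => //; rewrite -lee_fin EFin_normr_Rintegral//.
by apply: le_trans nA; apply: le_abse_integral => //; case/integrableP: ih.
Qed.

Lemma integrable_scale (f : T -> R) k : mu.-integrable setT (EFin \o f) ->
  mu.-integrable setT (EFin \o (fun x => k * f x)).
Proof.
move=> fi; have -> : EFin \o (fun x => k * f x) = (fun x => k%:E * (f x)%:E)%E.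
  by apply/funext => x /=; rewrite EFinM.
by apply: integrableZl.
Qed.

Lemma integrable_bigsum (D : set T) (I : Type) (s : seq I) (f : I -> T -> R) :
  measurable D -> (forall i, mu.-integrable D (EFin \o f i)) ->
  mu.-integrable D (EFin \o (fun x => \sum_(i <- s) f i x)).
Proof.
move=> mD intf.
have -> : EFin \o (fun x => \sum_(i <- s) f i x) =
    fun x => (\sum_(i <- s) (f i x)%:E)%E.
  by apply/funext => x /=; rewrite sumEFin.
by apply: integrable_sum => // i _; exact: intf.
Qed.

Lemma Rintegral_sum (D : set T) (I : Type) (s : seq I) (f : I -> T -> R) :
  measurable D -> (forall i, mu.-integrable D (EFin \o f i)) ->
  \int[mu]_(x in D) (\sum_(i <- s) f i x) = \sum_(i <- s) \int[mu]_(x in D) f i x.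
Proof.
move=> mD intf; elim: s => [|i s IH].
  by under eq_Rintegral do rewrite big_nil; rewrite Rintegral_cst// mul0r big_nil.
under eq_Rintegral do rewrite big_cons.
rewrite RintegralD//; first by rewrite big_cons IH.
exact: integrable_bigsum.
Qed.

End Bounds.

Lemma nnbound_prod (R : realType) (a b : R -> R) (A B : R) :
  nnbound (@lebesgue_measure R) a A -> nnbound (@lebesgue_measure R) b B ->
  nnbound ((@lebesgue_measure R) \x (@lebesgue_measure R))%E
    (fun z => a z.1 * b z.2) (A * B).
Proof.
move=> [ma a0 aA] [mb b0 bB]; split.
- apply: measurable_funM; first exact: (measurableT_comp ma measurable_fst).
  exact: (measurableT_comp mb measurable_snd).
- by move=> x; rewrite mulr_ge0.
- under eq_integral do rewrite EFinM.
  rewrite (@ge0_integral_prod R (EFin \o a) (EFin \o b)) //=; last 2 first.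
  + exact/measurable_EFinP.
  + exact/measurable_EFinP.
  by rewrite EFinM lee_pmul// integral_ge0// => x _; rewrite lee_fin.
Qed.

(** * Integrals of the Fejer kernel over a period *)

Section FejerIntegral.
Variable R : realType.
Local Open Scope classical_set_scope.
Local Notation mu := (@lebesgue_measure R).
Implicit Types (a b t c x : R) (M L : nat).

Lemma integrable_itv_continuous (f : R -> R) a b : continuous f ->
  mu.-integrable `[a, b[ (EFin \o f).
Proof.
move=> cf; have i : mu.-integrable `[a, b] (EFin \o f).
  apply: continuous_compact_integrable; first exact: segment_compact.
  exact: continuous_subspaceT.
by apply: integrableS i => //; apply: subset_itvl; rewrite bnd_simp.
Qed.

Lemma continuous_affine t c : continuous (fun x => t - x / c).
Proof.
move=> x; apply: cvgB; first exact: cvg_cst.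
exact: mulrr_continuous.
Qed.

Lemma Rintegral_itv_FTC (f F : R -> R) a b : a < b -> continuous f ->
  (forall x, is_derive x 1 F (f x)) ->
  \int[mu]_(x in `[a, b[) f x = F b - F a.
Proof.
move=> ab cf dF; rewrite Rintegral_itv_bndo_bndc; last first.
  exact: integrable_itv_continuous.
have cF : continuous F.
  by move=> x; apply: differentiable_continuous; apply/derivable1_diffP/ex_derive.
rewrite /Rintegral (@continuous_FTC2 _ f F) //.
- exact: continuous_subspaceT.
- split => //.
  + by apply: cvg_at_right_filter; exact: cF.
  + by apply: cvg_at_left_filter; exact: cF.
- by move=> x _; rewrite derive1E (@derive_val _ _ _ _ _ _ _ (dF x)).
Qed.

Lemma Rintegral_cos_period (k : int) t c a : 0 < c ->
  \int[mu]_(x in `[a, a + 2 * pi * c[) cos (k%:~R * (t - x / c)) =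
  (k == 0)%:R * (2 * pi * c).
Proof.
move=> c0; have [->|k0] := eqVneq k 0.
  have -> : (fun x => cos (0%:~R * (t - x / c))) = fun x => 1 :> R.
    by apply/funext => x; rewrite mul0r cos0.
  rewrite (@Rintegral_itv_FTC _ id).
  - by rewrite addrAC subrr add0r mul1r.
  - by rewrite ltrDl !mulr_gt0// pi_gt0.
  - exact: cst_continuous.
have k0' : (k%:~R : R) != 0 by rewrite intr_eq0.
pose G x := - (c / k%:~R) * sin (k%:~R * (t - x / c)).
have dG x : is_derive x 1 G (cos (k%:~R * (t - x / c))).
  have -> : cos (k%:~R * (t - x / c)) =
      - (c / k%:~R) *: (cos (k%:~R * (t - x / c)) * (k%:~R *: (0 - c^-1 *: 1))).
    rewrite /GRing.scale /=; field.
    by rewrite k0' gt_eqF.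
  apply: is_deriveZ; apply: is_derive1_comp.
  apply: is_deriveZ; apply: is_deriveB.
  have -> : (fun x => x / c) = c^-1 \*: id.
    by apply/funext => y /=; rewrite /GRing.scale /= mulrC.
  exact: is_deriveZ.
have cc : continuous (fun x => cos (k%:~R * (t - x / c))).
  move=> x; apply: (@continuous_comp _ _ _ (fun x => k%:~R * (t - x / c)) cos).
    apply: (@continuous_comp _ _ _ (fun x => t - x / c) ( *%R k%:~R)).
      exact: continuous_affine.
    exact: mulrl_continuous.
  exact: continuous_cos.
have ac : a < a + 2 * pi * c by rewrite ltrDl !mulr_gt0// pi_gt0.
rewrite (Rintegral_itv_FTC ac cc dG) mulr0n mul0r /G.
have -> : k%:~R * (t - (a + 2 * pi * c) / c) =
   k%:~R * (t - a / c) + (- k)%:~R * (2 * pi) :> R.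
  by rewrite mulrNz; field; rewrite gt_eqF.
by rewrite sin_intD subrr.
Qed.

(** Only the [M] terms with [k = l] have nonzero mean, and the factor 1/M cancels their number. *)
Lemma integral_fejer_period M t c a : 0 < c -> (0 < M)%N ->
  (\int[mu]_(x in `[a, (a + 2 * pi * c)%R[) (fejer M (t - x / c))%:E
    = (2 * pi * c)%:E)%E.
Proof.
move=> c0 M0.
have cf : continuous (fun x => fejer M (t - x / c)).
  move=> x; apply: (@continuous_comp _ _ _ (fun x => t - x / c) (fejer M)).
    exact: continuous_affine.
  exact: continuous_fejer.
have fi := @integrable_itv_continuous _ a (a + 2 * pi * c) cf.
rewrite -[LHS]fineK; last exact: integrable_fin_num.
rewrite -/(Rintegral _ _ _); congr EFin.
have ic (k l : nat) : mu.-integrable `[a, (a + 2 * pi * c)%R[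
    (EFin \o (fun x => cos ((k%:R - l%:R) * (t - x / c)))).
  apply: integrable_itv_continuous => x.
  apply: (@continuous_comp _ _ _ (fun x => (k%:R - l%:R) * (t - x / c)) cos).
    apply: (@continuous_comp _ _ _ (fun x => t - x / c) ( *%R (k%:R - l%:R))).
      exact: continuous_affine.
    exact: mulrl_continuous.
  exact: continuous_cos.
have isum (k : nat) : mu.-integrable `[a, (a + 2 * pi * c)%R[
    (EFin \o (fun x => \sum_(l < M) cos ((k%:R - l%:R) * (t - x / c)))).
  by apply: integrable_bigsum => // l; exact: ic.
rewrite /fejer RintegralZl//; last by apply: integrable_bigsum => // k; exact: isum.
rewrite Rintegral_sum//.
under eq_bigr => k _.
  rewrite Rintegral_sum//.
  under eq_bigr => l _.
    have -> : k%:R - l%:R = ((k : int) - (l : int))%:~R :> R by rewrite intrB.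
    rewrite Rintegral_cos_period// subr_eq0 eqz_nat.
  over.
  rewrite (bigD1 k)//= eqxx mul1r big1 ?addr0; last first.
    by move=> l lk; rewrite -val_eqE /= eq_sym in lk; rewrite (negbTE lk) mul0r.
over.
rewrite sumr_const card_ord -(mulr_natl (2 * pi * c) M) mulrA mulVf ?mul1r// pnatr_eq0.
by rewrite -lt0n.
Qed.

End FejerIntegral.

(** * Poisson summation *)

Section Windows.
Variable R : realType.
Local Open Scope classical_set_scope.
Local Notation mu := (@lebesgue_measure R).
Implicit Types (a b t c x : R) (M L : nat).

(* The indicator of [a, b[, as a difference so that adjacent windows telescope. *)
Definition win a b x : R := (a <= x)%R%:R - (b <= x)%R%:R.

Lemma winE a b x : a <= b -> win a b x = (a <= x < b)%R%:R.
Proof.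
rewrite /win => ab; case: (leP a x) => ax; case: (leP b x) => bx /=.
- by rewrite subrr.
- by rewrite subr0.
- by have := le_lt_trans (le_trans ab bx) ax; rewrite ltxx.
- by rewrite subrr.
Qed.

Lemma win01 a b x : a <= b -> 0 <= win a b x <= 1.
Proof. by move=> ab; rewrite winE// ler0n lern1 leq_b1. Qed.

Lemma measurable_win a b : measurable_fun setT (win a b).
Proof.
have m e : measurable_fun setT (fun x : R => (e <= x)%R%:R : R).
  have -> : (fun x : R => (e <= x)%R%:R : R) = \1_`[e, +oo[.
    by apply/funext => x; rewrite indicE mem_setE in_itv /= andbT.
  exact: measurable_indic.
by apply: measurable_funB.
Qed.

Lemma integral_win (f : R -> R) a b : a <= b ->
  (\int[mu]_x (win a b x * f x)%:E = \int[mu]_(x in `[a, b[) (f x)%:E)%E.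
Proof.
move=> ab; rewrite [RHS]integral_mkcond; apply: eq_integral => x _.
rewrite patchE winE// mem_setE in_itv /=.
by case: (_ && _); rewrite ?mul1r ?mul0r.
Qed.

Variables (t c : R).
Hypothesis c1 : 1 <= c.
Let c0 : 0 < c. Proof. exact: lt_le_trans ltr01 c1. Qed.

(* The nodes are the peaks of [x |-> fejer M (t - x / c)]; the cells are the
   periods centred at them. *)
Definition cell (k : int) : R := c * (t + (2 * k%:~R - 1) * pi).
Definition node (k : int) : R := c * (t + 2 * pi * k%:~R).
Definition kern M x : R := fejer M (t - x / c).
(** An integrable weight centred at [c * t], the node of the zeroth cell, so that its size on a cell
    is controlled by the number of the cell. *)
Definition decay x : R := (1 + (x - c * t) ^+ 2)^-1.
Let P : R := 2 * pi * c.

Let P0 : 0 < P. Proof. by rewrite !mulr_gt0// pi_gt0. Qed.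

Lemma cellS k : cell (k + 1) = cell k + P.
Proof. by rewrite /cell /P intrD; ring. Qed.

Lemma cell_le k : cell k <= cell (k + 1).
Proof. by rewrite cellS lerDl ltW. Qed.

Lemma kern_ge0 M x : 0 <= kern M x.
Proof. exact: fejer_ge0. Qed.

Lemma continuous_kern M : continuous (kern M).
Proof.
move=> x; apply: (@continuous_comp _ _ _ (fun x => t - x / c) (fejer M)).
  exact: continuous_affine.
exact: continuous_fejer.
Qed.

Lemma measurable_kern M : measurable_fun setT (kern M).
Proof. by apply: continuous_measurable_fun; exact: continuous_kern. Qed.

Lemma integral_win_kern M k : (0 < M)%N ->
  (\int[mu]_x (win (cell k) (cell (k + 1)) x * kern M x)%:E = P%:E)%E.
Proof.
move=> M0; rewrite integral_win; last exact: cell_le.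
by rewrite cellS integral_fejer_period.
Qed.

Lemma nnbound_win_kern M k : (0 < M)%N ->
  nnbound mu (fun x => win (cell k) (cell (k + 1)) x * kern M x) P.
Proof.
move=> M0; split.
- by apply: measurable_funM; [exact: measurable_win|exact: measurable_kern].
- move=> x; rewrite mulr_ge0 ?kern_ge0//.
  by have /andP[] := win01 x (cell_le k).
- by rewrite integral_win_kern.
Qed.

Lemma nnbound_win k : nnbound mu (win (cell k) (cell (k + 1))) P.
Proof.
have := @nnbound_win_kern 1 k isT; congr nnbound.
by apply/funext => x; rewrite /kern fejer1 mulr1.
Qed.

(** The factor [2 - 2 * cos] vanishes at the node and flattens the peak of the kernel
    ([fejer_cos_le]). The mass O(1/M) says that the kernel concentrates at the node of its cell. *)
Lemma nnbound_win_kern_cos M k : (0 < M)%N ->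
  nnbound mu (fun x => win (cell k) (cell (k + 1)) x * kern M x * (2 - 2 * cos (t - x / c)))
    (4 / M%:R * P).
Proof.
move=> M0; have q0 : 0 <= 4 / M%:R :> R by rewrite mulr_ge0// invr_ge0.
apply: nnbound_le (nnboundZ q0 (nnbound_win k)).
- apply: measurable_funM.
    by apply: measurable_funM; [exact: measurable_win|exact: measurable_kern].
  apply: measurable_funB => //; apply: measurable_funM => //.
  apply: continuous_measurable_fun => x.
  apply: (@continuous_comp _ _ _ (fun x => t - x / c) cos).
    exact: continuous_affine.
  exact: continuous_cos.
- move=> x; have /andP[w0 w1] := win01 x (cell_le k).
  have h0 : 0 <= 2 - 2 * cos (t - x / c) by have := cos_le1 (t - x / c); lra.
  apply/andP; split; first exact: (mulr_ge0 (mulr_ge0 w0 (kern_ge0 _ _)) h0).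
  by rewrite -mulrA mulrC ler_wpM2r// fejer_cos_le.
Qed.

Lemma measurable_decay : measurable_fun setT decay.
Proof.
apply: continuous_measurable_fun => x; apply: cvgV.
  by rewrite gt_eqF// ltr_wpDr ?sqr_ge0.
apply: cvgD; first exact: cvg_cst.
have cs : continuous (fun y : R => y - c * t).
  by move=> y; apply: cvgB; [exact: cvg_id|exact: cvg_cst].
by apply: cvgM; exact: cs.
Qed.

Lemma decay_gt0 x : 0 < decay x.
Proof. by rewrite invr_gt0 ltr_wpDr ?sqr_ge0. Qed.

Lemma decay_le1 x : decay x <= 1.
Proof. by rewrite invf_le1 ?ltr_wpDr ?sqr_ge0// lerDl sqr_ge0. Qed.

(** 1/(1 + (2L+1)^2) is at most 1/((L+1)(L+2)); as a difference of reciprocals this telescopes over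
    successive cells. *)
Lemma decay_far (L : nat) x : (2 * L%:R + 1) <= `|x - c * t| ->
  decay x <= L.+1%:R^-1 - L.+2%:R^-1.
Proof.
move=> far.
have L0 : 0 <= L%:R :> R by exact: ler0n.
have e1 : L.+1%:R = L%:R + 1 :> R by rewrite natr1.
have e2 : L.+2%:R = L%:R + 2 :> R by rewrite -addn2 natrD.
rewrite {}e1 {}e2; move: (L%:R : R) L0 far => l l0 far.
have -> : (l + 1)^-1 - (l + 2)^-1 = ((l + 1) * (l + 2))^-1.
  field.
  by apply/andP; split; apply: lt0r_neq0; lra.
have h : (2 * l + 1) ^+ 2 <= (x - c * t) ^+ 2.
  rewrite -[leRHS]real_normK ?num_real//.
  by apply: lerXn2r; rewrite ?nnegrE//; lra.
rewrite /decay lef_pV2 ?posrE; [nra|nra|nra].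
Qed.

Definition range (L : nat) := win (cell (- L%:Z)) (cell (L%:Z + 1)).

Lemma rangeS L x : range L.+1 x = range L x
  + win (cell (- L.+1%:Z)) (cell (- L.+1%:Z + 1)) x + win (cell L.+1%:Z) (cell (L.+1%:Z + 1)) x.
Proof.
rewrite /range /win.
have -> : (- L.+1%:Z + 1 = - L%:Z) by lia.
have -> : (L%:Z + 1 = L.+1%:Z) by lia.
ring.
Qed.

Lemma range_sum L x : range L x =
  \sum_(i < L.*2.+1) win (cell (i%:Z - L%:Z)) (cell (i%:Z - L%:Z + 1)) x.
Proof.
rewrite /range /win.
pose h (n : nat) : R := (cell (n%:Z - L%:Z) <= x)%R%:R.
have e0 : - L%:Z = 0%:Z - L%:Z by lia.
have e1 : L%:Z + 1 = L.*2.+1%:Z - L%:Z by lia.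
rewrite [in LHS]e0 [in LHS]e1.
rewrite -/(h 0%N) -/(h L.*2.+1).
transitivity (\sum_(i < L.*2.+1) (h i - h i.+1)).
  rewrite -(big_mkord xpredT (fun i => h i - h i.+1)).
  under eq_bigr do rewrite -opprB.
  by rewrite sumrN telescope_sumr// opprB.
apply: eq_bigr => i _; rewrite /h.
by have -> : i.+1%:Z - L%:Z = i%:Z - L%:Z + 1 by lia.
Qed.

Lemma cell_monoS L : cell (- L%:Z) <= cell (L%:Z + 1).
Proof.
rewrite /cell ler_pM2l// lerD2l ler_pM2r ?pi_gt0//.
have : 0 <= L%:~R :> R by rewrite ler0z.
by rewrite mulrNz intrD; lra.
Qed.

Lemma range01 L x : 0 <= range L x <= 1.
Proof. exact: win01 (cell_monoS L). Qed.

Lemma range_far L x : range L x = 0 -> 2 * L%:R + 1 <= `|x - c * t|.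
Proof.
move=> r0; have : ~~ (cell (- L%:Z) <= x < cell (L%:Z + 1)).
  apply/negP => h; move: r0; rewrite /range winE ?cell_monoS// h => /eqP.
  by rewrite oner_eq0.
have L0 : 0 <= L%:R :> R by exact: ler0n.
have pc : 1 <= pi * c by rewrite mulr_ege1 ?(le_trans _ (pi_ge2 R)) ?ler1n.
have key : 2 * L%:R + 1 <= (pi * c) * (2 * L%:R + 1) by rewrite ler_peMl//; lra.
have lo : cell (- L%:Z) - c * t = - ((pi * c) * (2 * L%:R + 1)).
  by rewrite /cell mulrNz -pmulrn; ring.
have hi : cell (L%:Z + 1) - c * t = (pi * c) * (2 * L%:R + 1).
  by rewrite /cell intrD -pmulrn; ring.
rewrite negb_and -ltNge -leNgt => /orP[h|h].
  by rewrite ler0_norm; lra.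
by rewrite ger0_norm; lra.
Qed.

Lemma range_near x : exists L0, forall L, (L0 <= L)%N -> range L x = 1.
Proof.
exists (Num.bound (`|x - c * t|)) => L hL.
apply: contraTeq (range01 L x) => r1; apply/negP => _.
have [r0|] := eqVneq (range L x) 0; last first.
  move: r1; rewrite /range winE ?cell_monoS//.
  by case: (_ && _); rewrite /= ?eqxx.
have := range_far r0; have := archi_boundP (normr_ge0 (x - c * t)).
have : (Num.bound `|x - c * t|)%:R <= L%:R :> R by rewrite ler_nat.
by have : 0 <= L%:R :> R; [exact: ler0n|lra].
Qed.

(** Passing from [n] to [n.+1] adds the two cells numbered plus and minus [(L + n).+1]. Each has
    kernel mass [P] and a weight bounded by [decay_far], so the bounds telescope. *)
Lemma nnbound_far_part M L n : (0 < M)%N ->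
  nnbound mu (fun x => (range (L + n) x - range L x) * (decay x * kern M x))
    (2 * P * (L.+1%:R^-1 - (L + n).+1%:R^-1)).
Proof.
move=> M0; elim: n => [|n IH].
  rewrite addn0 subrr mulr0; split => //.
  - have -> : (fun x => (range L x - range L x) * (decay x * kern M x)) = fun=> 0.
      by apply/funext => x; rewrite subrr mul0r.
    exact: measurable_cst.
  - by move=> x; rewrite subrr mul0r.
  - by under eq_integral do rewrite subrr mul0r; rewrite integral0.
have far k : (k = - (L + n).+1%:Z \/ k = (L + n).+1%:Z) ->
    nnbound mu (fun x => win (cell k) (cell (k + 1)) x * (decay x * kern M x))
      (((L + n).+1%:R^-1 - (L + n).+2%:R^-1) * P).
  move=> hk.
  have d0 : 0 <= (L + n).+1%:R^-1 - (L + n).+2%:R^-1 :> R.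
    by rewrite subr_ge0 lef_pV2 ?posrE ?ltr0Sn// ler_nat.
  apply: nnbound_le (nnboundZ d0 (nnbound_win_kern k M0)).
    apply: measurable_funM; first exact: measurable_win.
    by apply: measurable_funM; [exact: measurable_decay|exact: measurable_kern].
  move=> x; have /andP[w0 w1] := win01 x (cell_le k).
  have k0 := kern_ge0 M x; have dc0 := ltW (decay_gt0 x).
  apply/andP; split; first by rewrite mulr_ge0// mulr_ge0.
  rewrite mulrCA.
  have [->|wn0] := eqVneq (win (cell k) (cell (k + 1)) x) 0.
    by rewrite !mul0r !mulr0.
  apply: ler_wpM2r; first exact: mulr_ge0.
  apply: (decay_far (L := L + n)).
  apply: range_far; move: (rangeS (L + n) x); move: (range01 (L + n).+1 x).
  have w1' : win (cell k) (cell (k + 1)) x = 1.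
    by move: wn0; rewrite winE ?cell_le//; case: (_ && _); rewrite //= eqxx.
  have := range01 (L + n) x.
  have := win01 x (cell_le (- (L + n).+1%:Z)).
  have := win01 x (cell_le (L + n).+1%:Z).
  by case: hk => <-; rewrite w1'; lra.
have := nnboundD IH (nnboundD (far _ (or_introl erefl)) (far _ (or_intror erefl))).
congr nnbound; first by apply/funext => x; rewrite addnS rangeS; ring.
by rewrite addnS; ring.
Qed.

Lemma measurable_range L : measurable_fun setT (range L).
Proof. exact: measurable_win. Qed.

(** Monotone convergence in [nnbound_far_part]. The bound is free of [M], which lets the order of
    the kernel go to infinity before [L]. *)
Lemma nnbound_far M L : (0 < M)%N ->
  nnbound mu (fun x => (1 - range L x) * (decay x * kern M x)) (2 * P / L.+1%:R).
Proof.
move=> M0; pose f n x := (range (L + n) x - range L x) * (decay x * kern M x).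
have mdk : measurable_fun setT (fun x => decay x * kern M x).
  by apply: measurable_funM; [exact: measurable_decay|exact: measurable_kern].
have dk0 x : 0 <= decay x * kern M x by rewrite mulr_ge0 ?kern_ge0// ltW// decay_gt0.
have mf : measurable_fun setT (fun x => (1 - range L x) * (decay x * kern M x)).
  by apply: measurable_funM => //; apply: measurable_funB => //; exact: measurable_range.
have f0 x : 0 <= (1 - range L x) * (decay x * kern M x).
  by rewrite mulr_ge0// subr_ge0; case/andP: (range01 L x).
split => //.
have fcvg x : (f n x)%:E @[n --> \oo] --> ((1 - range L x) * (decay x * kern M x))%:E.
  have [N hN] := range_near x; apply: cvg_near_cst; exists N => // n /= Nn.
  by rewrite /f hN// (leq_trans Nn)// leq_addl.
have fge0 n x : 0 <= f n x by case: (nnbound_far_part L n M0) => _ /(_ x).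
have mfn n : measurable_fun setT (EFin \o f n).
  by apply/measurable_EFinP; case: (nnbound_far_part L n M0).
have fmono x m n : (m <= n)%N -> f m x <= f n x.
  move=> mn; rewrite /f ler_wpM2r// lerD2r.
  rewrite -(subnKC mn); elim: (n - m)%N => [|k IH]; first by rewrite addn0.
  rewrite !addnS rangeS (le_trans IH)// -addrA lerDl addnA addr_ge0//.
    by case/andP: (win01 x (cell_le (- (L + m + k).+1%:Z))).
  by case/andP: (win01 x (cell_le (L + m + k).+1%:Z)).
have -> : (\int[mu]_x ((1 - range L x) * (decay x * kern M x))%:E =
    \int[mu]_x limn (fun n => (f n x)%:E))%E.
  by apply: eq_integral => x _; apply/esym/cvg_lim => //; exact: fcvg.
rewrite monotone_convergence//; last 2 first.
- by move=> n x _; rewrite lee_fin.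
- by move=> x _ m n mn; rewrite lee_fin fmono.
apply: lime_le.
  apply: ereal_nondecreasing_is_cvgn => m n mn; apply: ge0_le_integral => //.
  - by move=> x _; rewrite lee_fin.
  - exact: mfn.
  - exact: mfn.
  - by move=> x _; rewrite lee_fin fmono.
apply: nearW => n; case: (nnbound_far_part L n M0) => _ _ fn.
apply: (le_trans fn).
rewrite lee_fin ler_wpM2l//; first by rewrite mulr_ge0// ltW.
by rewrite gerBl invr_ge0.
Qed.

Lemma nnbound_decay_kern M : (0 < M)%N ->
  nnbound mu (fun x => decay x * kern M x) (3 * P).
Proof.
move=> M0; have := nnboundD (nnbound_far 0 M0) (nnbound_win_kern 0 M0).
(* [2 * P] bounds everything outside the central cell, and [P] the central cell, where the weight is
   at most 1. *)
rewrite divr1 (_ : 2 * P + P = 3 * P); last by ring.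
apply: nnbound_le.
  by apply: measurable_funM; [exact: measurable_decay|exact: measurable_kern].
move=> x; have k0 := kern_ge0 M x; have dc0 := ltW (decay_gt0 x).
apply/andP; split; first by rewrite mulr_ge0.
have -> : win (cell 0) (cell (0 + 1)) x = range 0 x by rewrite /range oppr0.
have /andP[r0 r1] := range01 0 x.
have h : 0 <= range 0 x * kern M x * (1 - decay x).
  by apply: mulr_ge0; [exact: mulr_ge0|rewrite subr_ge0 decay_le1].
by rewrite -subr_ge0 (le_trans h)// le_eqVlt; apply/orP; left; apply/eqP; ring.
Qed.

End Windows.

Section Poisson.
Variable R : realType.
Local Open Scope classical_set_scope.
Local Notation mu2 := ((@lebesgue_measure R) \x (@lebesgue_measure R))%E.
Local Notation RR := (measurableTypeR R * measurableTypeR R)%type.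

(** Inside a cell, [|x - node| / c] is at most [pi], a range on which the cosine decreases: the
    distance to the node bounds the versine from below. *)
Lemma cos_node_far (t c d x : R) (k : int) : 1 <= c -> 0 < d <= c ->
  cell t c k <= x < cell t c (k + 1) -> d <= `|x - node t c k| ->
  2 - 2 * cos (d / c) <= 2 - 2 * cos (t - x / c).
Proof.
move=> c1 /andP[d0 dc] /andP[kx xk] dx; have c0 : 0 < c by lra.
have -> : cos (t - x / c) = cos (`|x - node t c k| / c).
  have -> : `|x - node t c k| / c = `|(x - node t c k) / c|.
    by rewrite normrM [X in _ = _ * X]gtr0_norm// invr_gt0.
  rewrite cos_norm -[RHS]cosN -[LHS](cos_intD k) /node; congr cos.
  by field; rewrite gt_eqF.
rewrite lerD2l lerN2 ler_pM2l// leNgt ltr_cos; first last.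
- rewrite in_itv /= divr_ge0 ?(ltW c0) ?(ltW d0)//= ler_pdivrMr//.
  by have := pi_ge2 R; nra.
- rewrite in_itv /= divr_ge0 ?(ltW c0)//= ler_pdivrMr// ler_norml.
  by move: kx xk; rewrite /cell /node intrD => kx xk; apply/andP; split; lra.
by rewrite -leNgt ler_pM2r// invr_gt0.
Qed.

Variables (g : R -> R -> R) (t u c K : R).
Hypothesis c1 : 1 <= c.
Hypothesis gc : continuous (fun z : R * R => g z.1 z.2).
Hypothesis gK : forall x y, `|g x y| <= K * (decay t c x * decay u c y).

Let P : R := 2 * pi * c.
Let c0 : 0 < c. Proof. exact: lt_le_trans ltr01 c1. Qed.
Let P0 : 0 < P. Proof. by rewrite !mulr_gt0// pi_gt0. Qed.

Let K0 : 0 <= K.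
Proof.
have := le_trans (normr_ge0 _) (gK 0 0).
by rewrite pmulr_lge0// mulr_gt0 ?decay_gt0.
Qed.

Let gleK x y : `|g x y| <= K.
Proof.
apply: le_trans (gK x y) _; rewrite ler_piMr//.
by rewrite mulr_ile1// ?decay_le1// ltW// decay_gt0.
Qed.

Let mg : measurable_fun [set: RR] (fun z : RR => g z.1 z.2).
Proof. by apply: (@continuous_measurable_plane R (fun z : R * R => g z.1 z.2)). Qed.

Let mfst (f : R -> R) : measurable_fun setT f ->
  measurable_fun [set: RR] (fun z : RR => f z.1).
Proof. by move=> mf; exact: (measurableT_comp mf measurable_fst). Qed.

Let msnd (f : R -> R) : measurable_fun setT f ->
  measurable_fun [set: RR] (fun z : RR => f z.2).
Proof. by move=> mf; exact: (measurableT_comp mf measurable_snd). Qed.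

Definition cellkern t M k (x : R) := win (cell t c k) (cell t c (k + 1)) x * kern t c M x.

Let cellkern_ge0 s M k x : 0 <= cellkern s M k x.
Proof.
apply: mulr_ge0; last exact: kern_ge0.
by case/andP: (win01 x (cell_le s c1 k)).
Qed.

Let bb0 M k l x y : 0 <= cellkern t M k x * cellkern u M l y.
Proof. by apply: mulr_ge0. Qed.

Let kk0 M x y : 0 <= kern t c M x * kern u c M y.
Proof. by apply: mulr_ge0; exact: kern_ge0. Qed.

Let mcellkern s M k : measurable_fun setT (cellkern s M k).
Proof. by apply: measurable_funM; [exact: measurable_win|exact: measurable_kern]. Qed.

Lemma integral_cellkern M k l : (0 < M)%N ->
  \int[mu2]_z (cellkern t M k z.1 * cellkern u M l z.2) = P * P.
Proof.
move=> M0; rewrite /Rintegral.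
under eq_integral do rewrite EFinM.
rewrite (@ge0_integral_prod R (EFin \o cellkern t M k) (EFin \o cellkern u M l)) //=.
- by rewrite !integral_win_kern.
- by apply/measurable_EFinP; exact: mcellkern.
- by apply/measurable_EFinP; exact: mcellkern.
- by move=> x; rewrite lee_fin.
- by move=> x; rewrite lee_fin.
Qed.

(** Pointwise form of the approximate-identity argument. Near the node, continuity costs [e];
    elsewhere in the cell one of the two versines is at least some [s0 > 0], so the coefficient
    [2 * K / s0] pays for the trivial bound [2 * K]. The kernels can be integrated against this
    majorant. *)
Lemma cell_modulus k l (e : R) : 0 < e -> exists2 C, 0 <= C & forall x y,
  cell t c k <= x < cell t c (k + 1) -> cell u c l <= y < cell u c (l + 1) ->
  `|g x y - g (node t c k) (node u c l)| <=
     e + C * (2 - 2 * cos (t - x / c)) + C * (2 - 2 * cos (u - y / c)).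
Proof.
move=> e0; set a := node t c k; set b := node u c l.
have /cvgrPdist_le /(_ _ e0) := @gc (a, b).
move=> /nbhs_ballP[d /= d0 dg].
(* The cap at [c] keeps [d' / c] within the interval where the cosine decreases, as [cos_node_far]
   requires. *)
pose d' := Num.min (d / 2) c.
have d'0 : 0 < d' by rewrite lt_min c0 andbT divr_gt0.
have d'c : d' <= c by rewrite ge_min lexx orbT.
have d'd : d' < d by rewrite gt_min; apply/orP; left; lra.
pose s0 := 2 - 2 * cos (d' / c).
have s00 : 0 < s0.
  have : cos (d' / c) < cos 0.
    rewrite ltr_cos ?in_itv /= ?divr_gt0// ?lexx ?pi_ge0//.
    rewrite ltW ?divr_gt0//= ler_pdivrMr//.
    by have := pi_ge2 R; nra.
  by rewrite cos0 /s0; lra.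
have C0 : 0 <= 2 * K / s0 by rewrite divr_ge0 ?mulr_ge0// ltW.
exists (2 * K / s0) => // x y xk yl.
have sx : 0 <= 2 - 2 * cos (t - x / c) by have := cos_le1 (t - x / c); lra.
have sy : 0 <= 2 - 2 * cos (u - y / c) by have := cos_le1 (u - y / c); lra.
have Csx := mulr_ge0 C0 sx; have Csy := mulr_ge0 C0 sy.
have big s : s0 <= s -> `|g x y - g a b| <= 2 * K / s0 * s.
  move=> hs; apply: (@le_trans _ _ (2 * K)).
    rewrite (le_trans (ler_normB _ _))//.
    by have := gleK x y; have := gleK a b; lra.
  by rewrite -mulrA ler_peMr ?mulr_ge0// ler_pdivlMl// mulr1.
case: (ltP `|x - a| d') => hx; last first.
  have := big _ (cos_node_far c1 (introT andP (conj d'0 d'c)) xk hx).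
  by lra.
case: (ltP `|y - b| d') => hy; last first.
  have := big _ (cos_node_far c1 (introT andP (conj d'0 d'c)) yl hy).
  by lra.
have /(_ _) := dg (x, y); rewrite /= distrC => h.
apply: (@le_trans _ _ e); last by lra.
apply: h; split; rewrite /ball /= distrC; apply: lt_trans d'd => //.
Qed.

Lemma integrable_cellkern M k l : (0 < M)%N ->
  mu2.-integrable setT (EFin \o (fun z => g z.1 z.2 * (cellkern t M k z.1 * cellkern u M l z.2))).
Proof.
move=> M0.
have nb := nnboundZ K0 (nnbound_prod (nnbound_win_kern t c1 k M0) (nnbound_win_kern u c1 l M0)).
apply: (proj1 (nnbound_dominated _ _ nb)).
  apply: measurable_funM => //; apply: measurable_funM; [exact: mfst|exact: msnd].
by move=> z; rewrite normrM (ger0_norm (bb0 _ _ _ _ _)); apply: ler_wpM2r.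
Qed.

(** Integrating the three terms of [cell_modulus] against the two kernels leaves [e / 2] from
    continuity and twice [4 * C * (P * P) / n.+1] from the versines. *)
Lemma box_cvg k l :
  \int[mu2]_z (g z.1 z.2 * (cellkern t n.+1 k z.1 * cellkern u n.+1 l z.2))
    @[n --> \oo] --> g (node t c k) (node u c l) * (P * P).
Proof.
apply/cvgrPdist_le => e e0.
have PP : 0 < P * P by apply: mulr_gt0.
have e20 : 0 < e / (2 * (P * P)) by apply: divr_gt0 => //; apply: mulr_gt0.
have [C C0 hC] := cell_modulus k l e20.
have D0 : 0 <= 8 * C * (P * P) by apply: mulr_ge0; [exact: mulr_ge0|exact: ltW].
near=> n.
have n0 : (0 < n.+1)%N by [].
have := nnboundD (nnboundD
  (nnboundZ (ltW e20) (nnbound_prod (nnbound_win_kern t c1 k n0) (nnbound_win_kern u c1 l n0)))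
  (nnboundZ C0 (nnbound_prod (nnbound_win_kern_cos t c1 k n0) (nnbound_win_kern u c1 l n0))))
  (nnboundZ C0 (nnbound_prod (nnbound_win_kern t c1 k n0) (nnbound_win_kern_cos u c1 l n0))).
move=> /nnbound_dominated dom.
have [||_ hle] := dom (fun z => (g z.1 z.2 - g (node t c k) (node u c l)) *
   (cellkern t n.+1 k z.1 * cellkern u n.+1 l z.2)).
- apply: measurable_funM; first exact: measurable_funB.
  by apply: measurable_funM; [exact: mfst|exact: msnd].
- move=> z; rewrite normrM [X in _ * X](ger0_norm (bb0 _ _ _ _ _)).
  rewrite /cellkern (winE _ (cell_le t c1 k)) (winE _ (cell_le u c1 l)).
  case: (boolP (cell t c k <= z.1 < _)) => hz1; last by rewrite !(mul0r, mulr0) !addr0.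
  case: (boolP (cell u c l <= z.2 < _)) => hz2; last by rewrite !(mul0r, mulr0) !addr0.
  rewrite !mul1r; have /= := hC _ _ hz1 hz2.
  have := mulr_ge0 (kern_ge0 t c n.+1 z.1) (kern_ge0 u c n.+1 z.2).
  move: (kern t c n.+1 z.1) (kern u c n.+1 z.2) => k1 k2 k120.
  move=> /(ler_wpM2r k120) /le_trans; apply.
  by rewrite le_eqVlt; apply/orP; left; apply/eqP; ring.
rewrite distrC -(integral_cellkern k l n0).
rewrite -[X in _ - X]RintegralZl//; last first.
  apply: (proj1 (nnbound_dominated _ _ (nnbound_prod (nnbound_win_kern t c1 k n0) (nnbound_win_kern u c1 l n0)))).
    by apply: measurable_funM; [exact: mfst|exact: msnd].
  by move=> z; rewrite (ger0_norm (bb0 _ _ _ _ _)).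
rewrite -RintegralB//; last 2 first.
- exact: integrable_cellkern.
- have := @nnboundZ _ _ _ _ _ _ `|g (node t c k) (node u c l)| (normr_ge0 _) (nnbound_prod (nnbound_win_kern t c1 k n0) (nnbound_win_kern u c1 l n0)).
  move=> nb; apply: (proj1 (nnbound_dominated _ _ nb)).
    apply: measurable_funM => //.
    by apply: measurable_funM; [exact: mfst|exact: msnd].
  by move=> z; rewrite normrM (ger0_norm (bb0 _ _ _ _ _)).
under eq_Rintegral do rewrite -mulrBl.
apply: le_trans hle _.
have hn : 8 * C * (P * P) / n.+1%:R <= e / 2.
  rewrite ler_pdivrMr ?ltr0n// -ler_pdivrMl ?divr_gt0//.
  rewrite (le_trans (ltW (archi_boundP _)))//; last first.
    by rewrite ler_nat; near: n; exists (Num.bound ((e / 2)^-1 * (8 * C * (P * P)))) => // m /= /leqW.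
  by rewrite mulr_ge0// invr_ge0 divr_ge0// ltW.
have e1 : e / (2 * (P * P)) * (P * P) = e / 2.
  by field; rewrite gt_eqF.
rewrite -/P e1.
have -> : e / 2 + C * (4 / n.+1%:R * P * P) + C * (P * (4 / n.+1%:R * P)) =
  e / 2 + 8 * C * (P * P) / n.+1%:R.
  by field; rewrite gt_eqF// ltr0n.
by rewrite [leRHS]splitr lerD2l.
Unshelve. all: by end_near. Qed.

Lemma integrable_kern M : (0 < M)%N ->
  mu2.-integrable setT (EFin \o (fun z => g z.1 z.2 * (kern t c M z.1 * kern u c M z.2))).
Proof.
move=> M0.
have nb := nnboundZ K0 (nnbound_prod (nnbound_decay_kern t c1 M0) (nnbound_decay_kern u c1 M0)).
apply: (proj1 (nnbound_dominated _ _ nb)).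
  apply: measurable_funM => //.
  by apply: measurable_funM; [apply: mfst|apply: msnd]; exact: measurable_kern.
move=> z; rewrite normrM [X in _ * X](ger0_norm (kk0 _ _ _)).
rewrite [leRHS](_ : _ = K * (decay t c z.1 * decay u c z.2) * (kern t c M z.1 * kern u c M z.2)).
  by apply: ler_wpM2r.
by ring.
Qed.

(** Outside the square of cells one coordinate is far: 1 - r1 r2 is at most (1 - r1) + (1 - r2).
    Each part has mass at most 2P/(L+1) in the far coordinate times 3P in the other, whence 12. The
    bound does not involve [M]. *)
Lemma poisson_tail M L : (0 < M)%N ->
  `|\int[mu2]_z (g z.1 z.2 * (kern t c M z.1 * kern u c M z.2))
    - \sum_(i < L.*2.+1) \sum_(j < L.*2.+1) \int[mu2]_z
      (g z.1 z.2 * (cellkern t M (i%:Z - L%:Z) z.1 * cellkern u M (j%:Z - L%:Z) z.2))|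
  <= 12 * K * (P * P) / L.+1%:R.
Proof.
move=> M0.
under [X in _ - X]eq_bigr => i _.
  rewrite -Rintegral_sum//; last by move=> j; exact: integrable_cellkern.
  over.
rewrite -Rintegral_sum//; last first.
  by move=> i; apply: integrable_bigsum => // j; exact: integrable_cellkern.
rewrite -RintegralB//; last 2 first.
- exact: integrable_kern.
- apply: integrable_bigsum => // i; apply: integrable_bigsum => // j.
  exact: integrable_cellkern.
have nb := nnboundZ K0 (nnboundD
  (nnbound_prod (nnbound_far t c1 L M0) (nnbound_decay_kern u c1 M0))
  (nnbound_prod (nnbound_decay_kern t c1 M0) (nnbound_far u c1 L M0))).
have -> : 12 * K * (P * P) / L.+1%:R = K * (2 * P / L.+1%:R * (3 * P) + 3 * P * (2 * P / L.+1%:R)).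
  by field; rewrite gt_eqF// ltr0n.
apply: (proj2 (nnbound_dominated _ _ nb)).
  apply: measurable_funB.
    apply: measurable_funM => //.
    by apply: measurable_funM; [apply: mfst|apply: msnd]; exact: measurable_kern.
  apply: measurable_sum => i; apply: measurable_sum => j; apply: measurable_funM => //.
  by apply: measurable_funM; [exact: mfst|exact: msnd].
move=> z; set ga := g z.1 z.2.
have -> : \sum_(i < L.*2.+1) \sum_(j < L.*2.+1)
     ga * (cellkern t M (i%:Z - L%:Z) z.1 * cellkern u M (j%:Z - L%:Z) z.2) =
   ga * (kern t c M z.1 * kern u c M z.2) * (range t c L z.1 * range u c L z.2).
  rewrite (range_sum t c1) (range_sum u c1) mulrC big_distrlr /= mulr_suml.
  apply: eq_bigr => i _; rewrite mulr_suml; apply: eq_bigr => j _.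
  by rewrite /cellkern; ring.
have := range01 t c1 L z.1; have := range01 u c1 L z.2.
have := kern_ge0 t c M z.1; have := kern_ge0 u c M z.2.
have := gK z.1 z.2; rewrite -/ga.
have := decay_gt0 t c z.1; have := decay_gt0 u c z.2.
move: (range t c L z.1) (range u c L z.2) (kern t c M z.1) (kern u c M z.2) (decay t c z.1) (decay u c z.2) => r1 r2 k1 k2 d1 d2.
move=> d20 d10 gd k20 k10 /andP[r20 r21] /andP[r10 r11].
have -> : ga * (k1 * k2) - ga * (k1 * k2) * (r1 * r2) = ga * ((k1 * k2) * (1 - r1 * r2)) by ring.
have rr : 0 <= 1 - r1 * r2 by rewrite subr_ge0 mulr_ile1.
rewrite normrM [X in _ * X]ger0_norm; last by rewrite !mulr_ge0.
apply: (@le_trans _ _ (K * (d1 * d2) * (k1 * k2 * (1 - r1 * r2)))).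
  by rewrite ler_wpM2r// !mulr_ge0.
have -> : K * ((1 - r1) * (d1 * k1) * (d2 * k2) + d1 * k1 * ((1 - r2) * (d2 * k2))) =
  K * (d1 * d2) * (k1 * k2 * (1 - r1 + (1 - r2))) by ring.
apply: ler_wpM2l; first by rewrite !mulr_ge0// ltW.
apply: ler_wpM2l; first by rewrite !mulr_ge0.
by nra.
Qed.

(** For fixed [L] the order of the kernel goes to infinity: by [box_cvg] each box becomes one term
    of [psum], and the tail bound persists. Only then does [L] grow. The value [G] is left open and
    is supplied by band limitation. *)
Lemma poisson_psum (G : R) :
  \int[mu2]_z (g z.1 z.2 * (kern t c n.+1 z.1 * kern u c n.+1 z.2)) @[n --> \oo] --> G ->
  psum g c t u @ \oo --> G / (P * P).
Proof.
move=> AG.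
have PP : 0 < P * P by rewrite mulr_gt0.
have bound L : `|G - psum g c t u L * (P * P)| <= 12 * K * (P * P) / L.+1%:R.
  have cvgd : (`|\int[mu2]_z (g z.1 z.2 * (kern t c n.+1 z.1 * kern u c n.+1 z.2))
    - \sum_(i < L.*2.+1) \sum_(j < L.*2.+1) \int[mu2]_z
      (g z.1 z.2 * (cellkern t n.+1 (i%:Z - L%:Z) z.1 * cellkern u n.+1 (j%:Z - L%:Z) z.2))|)
      @[n --> \oo] --> `|G - psum g c t u L * (P * P)|.
    apply: cvg_norm; apply: cvgB => //.
    rewrite /psum mulr_suml; apply: cvg_bigsum => i.
    rewrite mulr_suml; apply: cvg_bigsum => j.
    exact: box_cvg.
  by apply: (cvgr_to_le cvgd); apply: nearW => n; exact: poisson_tail.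
apply/cvgrPdist_le => e e0; near=> L.
rewrite -[leLHS]mulr1 -(@divff _ (P * P)) ?gt_eqF// mulrA ler_pdivrMr//.
rewrite -[X in _ * X]gtr0_norm// -normrM mulrBl divfK ?gt_eqF//.
apply: (le_trans (bound L)).
rewrite ler_pdivrMr ?ltr0n//.
rewrite [leRHS]mulrAC; apply: ler_wpM2r; first exact: ltW.
rewrite -ler_pdivrMl//.
rewrite (le_trans (ltW (archi_boundP _)))//.
  by rewrite mulr_ge0// ?mulr_ge0// invr_ge0 ltW.
by rewrite ler_nat; near: L; exists (Num.bound (e^-1 * (12 * K))) => // m /= /leqW.
Unshelve. all: by end_near. Qed.

End Poisson.

(** * Sums over differences of indices *)

Section SymmetricSums.
Variable V : zmodType.
Implicit Types (phi : int -> V) (M N : nat).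

Lemma symmetric_sum phi N :
  \sum_(i < N.*2.+1) phi (i%:Z - N%:Z) =
  phi 0 + \sum_(m < N) (phi m.+1%:Z + phi (- m.+1%:Z)).
Proof.
elim: N => [|N IH]; first by rewrite big_ord1 big_ord0 [RHS]addr0.
rewrite [in RHS]big_ord_recr /= addrA -IH.
rewrite doubleS big_ord_recl big_ord_recr /=.
rewrite (_ : (0%N : int) - N.+1%:Z = - N.+1%:Z); last by lia.
rewrite (_ : (bump 0 N.*2.+1)%:Z - N.+1%:Z = N.+1%:Z); last by rewrite /bump leq0n add1n; lia.
rewrite addrCA [phi (- _) + _]addrC; congr (_ + _).
by apply: eq_bigr => i _; congr phi; rewrite /bump leq0n add1n; lia.
Qed.

Lemma difference_sum phi M :
  \sum_(k < M) \sum_(l < M) phi (k%:Z - l%:Z) =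
  phi 0 *+ M + \sum_(m < M) (phi m.+1%:Z + phi (- m.+1%:Z)) *+ (M - m.+1).
Proof.
elim: M => [|M IH]; first by rewrite !big_ord0 addr0.
rewrite big_ord_recr /=; under eq_bigr do rewrite big_ord_recr /=.
rewrite big_split /= IH big_ord_recr /= subrr.
have -> : \sum_(k < M) phi (k%:Z - M%:Z) = \sum_(m < M) phi (- m.+1%:Z).
  rewrite (reindex_inj rev_ord_inj) /=; apply: eq_bigr => i _; congr phi.
  by have := ltn_ord i; lia.
have -> : \sum_(l < M) phi (M%:Z - l%:Z) = \sum_(m < M) phi m.+1%:Z.
  rewrite (reindex_inj rev_ord_inj) /=; apply: eq_bigr => i _; congr phi.
  by have := ltn_ord i; lia.
rewrite [in RHS]big_ord_recr /= subnn mulr0n addr0.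
have -> : \sum_(m < M) (phi m.+1%:Z + phi (- m.+1%:Z)) *+ (M.+1 - m.+1) =
    \sum_(m < M) (phi m.+1%:Z + phi (- m.+1%:Z)) *+ (M - m.+1)
    + (\sum_(m < M) phi m.+1%:Z + \sum_(m < M) phi (- m.+1%:Z)).
  rewrite -!big_split /=; apply: eq_bigr => i _.
  by rewrite -mulrSr; congr (_ *+ _); have := ltn_ord i; lia.
rewrite mulrSr.
set a := phi 0 *+ M; set b := \sum_(_ < _) _; set x := \sum_(_ < _) phi (- _).
set y := \sum_(_ < _) phi _; set z := phi 0.
by rewrite -!addrA; congr (_ + _); rewrite [RHS]addrCA; congr (_ + _);
  rewrite addrA addrC [x + y]addrC.
Qed.

(** A difference m occurs M - |m| times. Truncated subtraction makes that weight 0 for |m| >= M, so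
    [M] and [N] may come in either order. *)
Lemma difference_sum_sym phi M N :
  (forall m : int, (N < `|m|)%N -> (`|m| < M)%N -> phi m = 0) ->
  \sum_(k < M) \sum_(l < M) phi (k%:Z - l%:Z) =
  \sum_(i < N.*2.+1) phi (i%:Z - N%:Z) *+ (M - `|i%:Z - N%:Z|).
Proof.
move=> phi0; rewrite difference_sum.
rewrite (symmetric_sum (fun m => phi m *+ (M - `|m|))) /= subn0; congr (_ + _).
pose f m := (phi m.+1%:Z + phi (- m.+1%:Z)) *+ (M - m.+1).
transitivity (\sum_(0 <= m < N) f m); last first.
  rewrite big_mkord; apply: eq_bigr => i _.
  by rewrite /f mulrnDl.
rewrite -(big_mkord xpredT f).
have [MN|NM] := leqP M N.
  have tail : \sum_(M <= i < N) f i = 0.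
    rewrite big_nat_cond big1// => i /andP[/andP[Mi _] _].
    by rewrite /f (eqP (_ : (M - i.+1)%N == 0%N)) ?mulr0n// subn_eq0 ltnW.
  by rewrite [RHS](big_cat_nat (leq0n M) MN)/= tail addr0.
have tail : \sum_(N <= i < M) f i = 0.
  rewrite big_nat_cond big1// => i /andP[/andP[Ni iM] _].
  rewrite /f; case: (ltnP i.+1 M) => [iM'|]; last first.
    by rewrite -subn_eq0 => /eqP ->.
  by rewrite !phi0 ?addr0 ?mul0rn ?abszN//=; lia.
by rewrite [LHS](big_cat_nat (leq0n N) (ltnW NM))/= tail addr0.
Qed.

End SymmetricSums.

(** * Poisson summation for band-limited functions *)

Section TrigSums.
Variable R : realType.
Local Open Scope classical_set_scope.
Local Notation mu2 := ((@lebesgue_measure R) \x (@lebesgue_measure R))%E.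
Local Notation RR := (measurableTypeR R * measurableTypeR R)%type.

Lemma cvg_fejer_weight (m : nat) : ((n.+1 - m)%N%:R / n.+1%:R : R) @[n --> \oo] --> (1 : R).
Proof.
have h : (1 - m%:R / n.+1%:R : R) @[n --> \oo] --> (1 : R).
  rewrite -[X in _ --> X]subr0; apply: cvgB; first exact: cvg_cst.
  rewrite -[X in _ --> X](mulr0 m%:R); apply: cvgM; first exact: cvg_cst.
  exact: cvg_harmonic.
apply: cvg_trans h; apply: near_eq_cvg; exists m => // n /= mn.
rewrite natrB; last exact: leqW.
by field; rewrite gt_eqF// ltr0n.
Qed.

(** The missing products of sines cancel between opposite frequencies. *)
Lemma cos_cos_symmetric_sum (N : nat) (a b : R) :
  \sum_(i < N.*2.+1) \sum_(j < N.*2.+1) cos ((i%:Z - N%:Z)%:~R * a) * cos ((j%:Z - N%:Z)%:~R * b)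
  = \sum_(i < N.*2.+1) \sum_(j < N.*2.+1) cos ((i%:Z - N%:Z)%:~R * a + (j%:Z - N%:Z)%:~R * b).
Proof.
under [RHS]eq_bigr do under eq_bigr do rewrite cosD.
under [RHS]eq_bigr do rewrite sumrB -[X in _ - X]mulr_sumr.
rewrite sumrB -mulr_suml.
rewrite (symmetric_sum (fun m => sin (m%:~R * a))) /= mul0r sin0 add0r.
rewrite [X in _ - X * _]big1 ?mul0r ?subr0// => i _.
by rewrite mulrNz mulNr sinN subrr.
Qed.

Variables (g : R -> R -> R) (K : R).
Hypothesis gc : continuous (fun z : R * R => g z.1 z.2).
Hypothesis gK : forall x y, `|g x y| <= K * (decay 0 1 x * decay 0 1 y).

Lemma integrable_plane : mu2.-integrable setT (EFin \o (fun z => g z.1 z.2)).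
Proof.
have := integrable_kern (lexx 1) gc gK (ltn0Sn 0).
by congr (integrable _ _ (_ \o _)); apply/funext => z; rewrite /kern !fejer1 !mulr1.
Qed.

Lemma integrable_plane_bounded (h : R * R -> R) : continuous h ->
  (forall z, `|h z| <= 1) ->
  mu2.-integrable setT (EFin \o (fun z => g z.1 z.2 * h z)).
Proof.
move=> hc h1; apply: le_integrable integrable_plane => //.
  apply/measurable_EFinP; apply: measurable_funM.
    exact: (@continuous_measurable_plane R (fun z : R * R => g z.1 z.2)).
  exact: (@continuous_measurable_plane R h).
by move=> z _; rewrite /= lee_fin normrM ler_piMr.
Qed.

Lemma continuous_phase (a b e : R) :
  continuous (fun z : R * R => e + (a * z.1 + b * z.2)).
Proof.
move=> z; apply: cvgD; first exact: cvg_cst.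
apply: cvgD; apply: cvgM; try exact: cvg_cst; [exact: cvg_fst|exact: cvg_snd].
Qed.

Lemma continuous_cos_phase (a b e : R) :
  continuous (fun z : R * R => cos (e + (a * z.1 + b * z.2))).
Proof.
move=> z; apply: (@continuous_comp _ _ _ (fun z : R * R => e + (a * z.1 + b * z.2)) cos).
  exact: continuous_phase.
exact: continuous_cos.
Qed.

Lemma integrable_cos (a b e : R) :
  mu2.-integrable setT (EFin \o (fun z => g z.1 z.2 * cos (e + (a * z.1 + b * z.2)))).
Proof.
apply: integrable_plane_bounded; first exact: continuous_cos_phase.
by move=> z; exact: cos_max.
Qed.

(** The phase [e] lets one definition cover both real Fourier coefficients: [e = 0] gives the cosine
    and [e = - (pi / 2)] the sine. *)
Definition coscoef (a b e : R) : R :=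
  \int[mu2]_z (g z.1 z.2 * cos (e + (a * z.1 + b * z.2))).

Lemma coscoefE a b e : coscoef a b e = cos e * coscoef a b 0 - sin e * coscoef a b (- (pi / 2)).
Proof.
rewrite /coscoef -!RintegralZl//; try exact: integrable_cos.
rewrite -RintegralB//; try by apply: integrable_scale; exact: integrable_cos.
apply: eq_Rintegral => z _.
by rewrite add0r [- (pi / 2) + _]addrC cosBpihalf cosD; ring.
Qed.

Hypothesis band : forall a b : R, 1 < `|a| + `|b| ->
  int2 (fun x y => g x y * cos (a * x + b * y)) = 0 /\
  int2 (fun x y => g x y * sin (a * x + b * y)) = 0.

Lemma coscoef_band a b e : 1 < `|a| + `|b| -> coscoef a b e = 0.
Proof.
move=> ab; rewrite coscoefE; have [c0 s0] := band ab.
have -> : coscoef a b 0 = 0.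
  by rewrite -[RHS]c0; apply: eq_Rintegral => z _; rewrite add0r.
have -> : coscoef a b (- (pi / 2)) = 0.
  by rewrite -[RHS]s0; apply: eq_Rintegral => z _; rewrite addrC cosBpihalf.
by rewrite !mulr0 subrr.
Qed.

Variables (t u : R) (N : nat).
Hypothesis N1 : (0 < N)%N.
Let c : R := N%:R.
Let c1 : 1 <= c. Proof. by rewrite ler1n. Qed.
Let c0 : 0 < c. Proof. by rewrite ltr0n. Qed.

Let prodcoef (m n : int) : R :=
  \int[mu2]_z (g z.1 z.2 * (cos (m%:~R * (t - z.1 / c)) * cos (n%:~R * (u - z.2 / c)))).

Let Int_cc (m n : int) : mu2.-integrable setT (EFin \o (fun z =>
  g z.1 z.2 * (cos (m%:~R * (t - z.1 / c)) * cos (n%:~R * (u - z.2 / c))))).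
Proof.
apply: integrable_plane_bounded; last first.
  by move=> z; rewrite normrM mulr_ile1// cos_max.
have h1 : continuous (fun z : R * R => cos (m%:~R * (t - z.1 / c))).
  have -> : (fun z : R * R => cos (m%:~R * (t - z.1 / c))) =
      fun z => cos (m%:~R * t + (- (m%:~R / c) * z.1 + 0 * z.2)).
    by apply/funext => w; congr cos; ring.
  exact: continuous_cos_phase.
have h2 : continuous (fun z : R * R => cos (n%:~R * (u - z.2 / c))).
  have -> : (fun z : R * R => cos (n%:~R * (u - z.2 / c))) =
      fun z => cos (n%:~R * u + (0 * z.1 + - (n%:~R / c) * z.2)).
    by apply/funext => w; congr cos; ring.
  exact: continuous_cos_phase.
by move=> z; apply: cvgM; [exact: h1|exact: h2].
Qed.

Let prodcoef_band m n : (N < `|m| + `|n|)%N -> prodcoef m n = 0.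
Proof.
move=> mn.
have big (n' : int) : `|n'|%N = `|n|%N -> 1 < `|- (m%:~R / c)| + `|- (n'%:~R / c)|.
  move=> n'n; rewrite !normrN !normrM !normfV [`|c|]gtr0_norm// -mulrDl.
  rewrite ltr_pdivlMr// mul1r -!intr_norm -!abszE.
  by rewrite -!pmulrn n'n -natrD ltr_nat.
have -> : prodcoef m n =
    2^-1 * (coscoef (- (m%:~R / c)) (- (n%:~R / c)) (m%:~R * t + n%:~R * u)
          + coscoef (- (m%:~R / c)) (- ((- n)%:~R / c)) (m%:~R * t - n%:~R * u)).
  rewrite -RintegralD//; try exact: integrable_cos.
  rewrite -RintegralZl//; last first.
    exact: (@integrableD _ _ _ mu2 setT measurableT _ _
      (integrable_cos (- (m%:~R / c)) (- (n%:~R / c)) (m%:~R * t + n%:~R * u))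
      (integrable_cos (- (m%:~R / c)) (- ((- n)%:~R / c)) (m%:~R * t - n%:~R * u))).
  apply: eq_Rintegral => z _.
  set A := m%:~R * (t - z.1 / c); set B := n%:~R * (u - z.2 / c).
  have -> : m%:~R * t + n%:~R * u + (- (m%:~R / c) * z.1 + - (n%:~R / c) * z.2) = A + B.
    by rewrite /A /B; ring.
  have -> : m%:~R * t - n%:~R * u + (- (m%:~R / c) * z.1 + - ((- n)%:~R / c) * z.2) = A - B.
    by rewrite /A /B mulrNz; ring.
  by rewrite cosD cosB; field.
by rewrite !coscoef_band ?addr0 ?mulr0//; apply: big; rewrite ?abszN.
Qed.

(** Against a product of Fejer kernels, a band-limited [g] leaves finitely many frequencies, each
    with weights tending to 1; this evaluates the limit that [poisson_psum] asks for. *)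
Lemma psum_cvg : psum g c t u @ \oo -->
  (2 * pi * c * (2 * pi * c))^-1 * \sum_(i < N.*2.+1) \sum_(j < N.*2.+1)
    coscoef (- ((i%:Z - N%:Z)%:~R / c)) (- ((j%:Z - N%:Z)%:~R / c))
      ((i%:Z - N%:Z)%:~R * t + (j%:Z - N%:Z)%:~R * u).
Proof.
(* The decay of [g] is centred at 0, while the Poisson estimates want it at [c * t] and [c * u]; the
   change of centre costs a constant depending on t and u, harmless because both are fixed. *)
have recenter (s x : R) : decay 0 1 x <= 2 * (1 + (c * s) ^+ 2) * decay s c x.
  rewrite /decay mul1r subr0 ler_pdivlMr ?ltr_wpDr ?sqr_ge0//.
  rewrite mulrC ler_pdivrMr ?ltr_wpDr ?sqr_ge0//.
  by have := sqr_ge0 (x + c * s); have := sqr_ge0 (x * (c * s)); nra.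
have K0 : 0 <= K.
  have := le_trans (normr_ge0 _) (gK 0 0).
  by rewrite pmulr_lge0// mulr_gt0 ?decay_gt0.
have gK' x y : `|g x y| <= K * (2 * (1 + (c * t) ^+ 2)) * (2 * (1 + (c * u) ^+ 2))
     * (decay t c x * decay u c y).
  apply: (le_trans (gK x y)); rewrite -!mulrA; apply: ler_wpM2l => //.
  rewrite [leRHS](_ : _ = (2 * (1 + (c * t) ^+ 2) * decay t c x) * (2 * (1 + (c * u) ^+ 2) * decay u c y)); last by ring.
  by apply: ler_pM; rewrite ?recenter// ltW// decay_gt0.
rewrite mulrC; apply: (poisson_psum c1 gc gK').
have -> : (fun n => \int[mu2]_z (g z.1 z.2 * (kern t c n.+1 z.1 * kern u c n.+1 z.2))) =
  fun n => \sum_(i < N.*2.+1) \sum_(j < N.*2.+1) prodcoef (i%:Z - N%:Z) (j%:Z - N%:Z) *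
     ((n.+1 - `|i%:Z - N%:Z|)%N%:R / n.+1%:R) * ((n.+1 - `|j%:Z - N%:Z|)%N%:R / n.+1%:R).
  apply/funext => n.
  have M0 : n.+1%:R != 0 :> R by rewrite pnatr_eq0.
  (* By [prodcoef_band] the sums over differences collapse onto a square of frequencies independent
     of [n], with the Fejer weights as multiplicities. *)
  have reindex : \sum_(k < n.+1) \sum_(l < n.+1) \sum_(k' < n.+1) \sum_(l' < n.+1)
        prodcoef (k%:Z - l%:Z) (k'%:Z - l'%:Z) =
      \sum_(i < N.*2.+1) \sum_(j < N.*2.+1) prodcoef (i%:Z - N%:Z) (j%:Z - N%:Z)
        *+ (n.+1 - `|j%:Z - N%:Z|) *+ (n.+1 - `|i%:Z - N%:Z|).
    rewrite (@difference_sum_sym _ (fun m => \sum_(k' < n.+1) \sum_(l' < n.+1)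
      prodcoef m (k'%:Z - l'%:Z)) n.+1 N); last first.
      move=> m Nm _; rewrite big1// => k _; rewrite big1// => l _.
      by rewrite prodcoef_band// ltn_addr.
    apply: eq_bigr => i _.
    rewrite (@difference_sum_sym _ (prodcoef (i%:Z - N%:Z)) n.+1 N); last first.
      by move=> m Nm _; rewrite prodcoef_band// ltn_addl.
    by rewrite sumrMnl.
  transitivity (n.+1%:R^-1 * n.+1%:R^-1 * \sum_(k < n.+1) \sum_(l < n.+1)
      \sum_(k' < n.+1) \sum_(l' < n.+1) prodcoef (k%:Z - l%:Z) (k'%:Z - l'%:Z)); last first.
    rewrite reindex mulr_sumr; apply: eq_bigr => i _.
    rewrite mulr_sumr; apply: eq_bigr => j _.
    by rewrite -[in LHS]mulr_natr -[in LHS]mulr_natr; field.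
  have Isum (s : seq 'I_n.+1) (f : 'I_n.+1 -> RR -> R) :
      (forall i, mu2.-integrable setT (EFin \o f i)) ->
      \sum_(i <- s) \int[mu2]_z f i z = \int[mu2]_z \sum_(i <- s) f i z.
    by move=> fi; rewrite Rintegral_sum.
  have i1 k l k' : mu2.-integrable setT (EFin \o (fun z => \sum_(l' < n.+1)
      (g z.1 z.2 * (cos ((k%:Z - l%:Z)%:~R * (t - z.1 / c)) *
        cos ((k'%:Z - l'%:Z)%:~R * (u - z.2 / c)))))).
    by apply: integrable_bigsum => // l'; exact: Int_cc.
  have i2 k l : mu2.-integrable setT (EFin \o (fun z => \sum_(k' < n.+1) \sum_(l' < n.+1)
      (g z.1 z.2 * (cos ((k%:Z - l%:Z)%:~R * (t - z.1 / c)) *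
        cos ((k'%:Z - l'%:Z)%:~R * (u - z.2 / c)))))).
    by apply: integrable_bigsum => // k'; exact: i1.
  have i3 k : mu2.-integrable setT (EFin \o (fun z => \sum_(l < n.+1) \sum_(k' < n.+1) \sum_(l' < n.+1)
      (g z.1 z.2 * (cos ((k%:Z - l%:Z)%:~R * (t - z.1 / c)) *
        cos ((k'%:Z - l'%:Z)%:~R * (u - z.2 / c)))))).
    by apply: integrable_bigsum => // l; exact: i2.
  have -> : \sum_(k < n.+1) \sum_(l < n.+1) \sum_(k' < n.+1) \sum_(l' < n.+1)
        prodcoef (k%:Z - l%:Z) (k'%:Z - l'%:Z) =
    \int[mu2]_z \sum_(k < n.+1) \sum_(l < n.+1) \sum_(k' < n.+1) \sum_(l' < n.+1)
      (g z.1 z.2 * (cos ((k%:Z - l%:Z)%:~R * (t - z.1 / c)) *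
        cos ((k'%:Z - l'%:Z)%:~R * (u - z.2 / c)))).
    rewrite -Isum//; apply: eq_bigr => k _.
    rewrite -Isum//; apply: eq_bigr => l _.
    rewrite -Isum//; apply: eq_bigr => k' _.
    by rewrite -Isum.
  rewrite -RintegralZl//; last by apply: integrable_bigsum => // k; exact: i3.
  apply: eq_Rintegral => z _; rewrite /kern /fejer.
  rewrite mulrACA [LHS]mulrCA; congr (_ * _).
  rewrite mulr_suml mulr_sumr; apply: eq_bigr => k _.
  rewrite mulr_suml mulr_sumr; apply: eq_bigr => l _.
  rewrite !mulr_sumr; apply: eq_bigr => k' _.
  rewrite !mulr_sumr; apply: eq_bigr => l' _.
  by rewrite !intrB -!pmulrn.
(* The claim has the cosine of a sum, the Fejer means a product of cosines; under the integral the
   two agree by [cos_cos_symmetric_sum]. *)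
have -> : \sum_(i < N.*2.+1) \sum_(j < N.*2.+1)
    coscoef (- ((i%:Z - N%:Z)%:~R / c)) (- ((j%:Z - N%:Z)%:~R / c))
      ((i%:Z - N%:Z)%:~R * t + (j%:Z - N%:Z)%:~R * u) =
    \sum_(i < N.*2.+1) \sum_(j < N.*2.+1) prodcoef (i%:Z - N%:Z) (j%:Z - N%:Z) * 1 * 1.
  transitivity (\int[mu2]_z \sum_(i < N.*2.+1) \sum_(j < N.*2.+1)
     (g z.1 z.2 * cos ((i%:Z - N%:Z)%:~R * t + (j%:Z - N%:Z)%:~R * u +
     (- ((i%:Z - N%:Z)%:~R / c) * z.1 + - ((j%:Z - N%:Z)%:~R / c) * z.2)))).
    rewrite Rintegral_sum//; last first.
      by move=> i; apply: integrable_bigsum => // j; exact: integrable_cos.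
    apply: eq_bigr => i _; rewrite Rintegral_sum// => j; exact: integrable_cos.
  transitivity (\int[mu2]_z \sum_(i < N.*2.+1) \sum_(j < N.*2.+1)
     (g z.1 z.2 * (cos ((i%:Z - N%:Z)%:~R * (t - z.1 / c)) *
        cos ((j%:Z - N%:Z)%:~R * (u - z.2 / c))))).
    apply: eq_Rintegral => z _.
    have := cos_cos_symmetric_sum N (t - z.1 / c) (u - z.2 / c).
    move=> /(congr1 (fun x => g z.1 z.2 * x)) /esym.
    rewrite !mulr_sumr => e; apply: etrans (etrans e _).
      apply: eq_bigr => i _; rewrite mulr_sumr; apply: eq_bigr => j _.
      by congr (_ * cos _); ring.
    by apply: eq_bigr => i _; rewrite mulr_sumr.
  rewrite Rintegral_sum//; last first.
    by move=> i; apply: integrable_bigsum => // j; exact: Int_cc.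
  apply: eq_bigr => i _; rewrite Rintegral_sum//.
  by apply: eq_bigr => j _; rewrite !mulr1.
apply: cvg_bigsum => i; apply: cvg_bigsum => j.
apply: cvgM; last exact: cvg_fejer_weight.
by apply: cvgM; [exact: cvg_cst|exact: cvg_fejer_weight].
Qed.

End TrigSums.

(** * From the Fejer kernel to the squared sinc *)

Section MainTerm.
Variable R : realType.
Local Open Scope classical_set_scope.
Local Notation mu2 := ((@lebesgue_measure R) \x (@lebesgue_measure R))%E.
Local Notation RR := (measurableTypeR R * measurableTypeR R)%type.

Lemma fejer_le M (x : R) : fejer M x <= M%:R.
Proof.
have [->|M0] := posnP M; first by rewrite /fejer big_ord0 mulr0.
rewrite /fejer ler_pdivrMl ?ltr0n//.
have -> : M%:R * M%:R = \sum_(k < M) \sum_(l < M) 1 :> R.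
  by under eq_bigr do rewrite sumr_const card_ord; rewrite sumr_const card_ord mulr_natr.
by apply: ler_sum => k _; apply: ler_sum => l _; exact: cos_le1.
Qed.

Lemma cvg_sinc (s : R) : sinc (s / n.+1%:R) @[n --> \oo] --> (1 : R).
Proof.
have [->|s0] := eqVneq s 0.
  by under eq_fun do rewrite mul0r /sinc eqxx; exact: cvg_cst.
have h : (h^-1 *: (sin (h *: (1 : R) + 0) - sin 0)) @[h --> (0 : R)^'] --> (1 : R).
  have [d e] := is_derive_sin (0 : R); rewrite cos0 in e.
  rewrite -[X in _ --> X]e; exact: d.
have sn : (s / n.+1%:R) @[n --> \oo] --> (0 : R).
  rewrite -[X in _ --> X](mulr0 s); apply: cvgM; first exact: cvg_cst.
  exact: cvg_harmonic.
have sn0 n : s / n.+1%:R != 0 by rewrite mulf_neq0// invr_neq0// pnatr_eq0.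
have [/(_ h) H _] := cvgr_dnbhsP (fun h : R => h^-1 *: (sin (h *: (1 : R) + 0) - sin 0)) 0 1.
have := H (fun n => s / n.+1%:R) (conj sn0 sn).
apply: cvg_trans; apply: near_eq_cvg; apply: nearW => n.
by rewrite /sinc (negbTE (sn0 n)) /GRing.scale /= mulr1 addr0 sin0 subr0 mulrC.
Qed.

Lemma versin_half (y : R) : 2 - 2 * cos y = 4 * sin (y / 2) ^+ 2.
Proof.
have -> : cos y = cos ((y / 2) *+ 2) by congr cos; rewrite -mulr_natr divfK.
by rewrite cos_mulr2n sin2cos2; ring.
Qed.

(** By [fejer_geometric] and the half-angle formula, the normalised kernel at s/n equals sinc(s/2)^2
    / sinc(s/(2n))^2 once the denominator is nonzero. *)
Lemma cvg_fejer_sinc (s : R) :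
  n.+1%:R^-1 * fejer n.+1 (s / n.+1%:R) @[n --> \oo] --> sinc (s / 2) ^+ 2.
Proof.
have [->|s0] := eqVneq s 0.
  rewrite mul0r [X in X ^+ 2]/sinc eqxx expr1n.
  have -> : (fun n => n.+1%:R^-1 * fejer n.+1 (0 / n.+1%:R)) = fun=> 1 : R.
    apply/funext => n; rewrite mul0r /fejer.
    under eq_bigr do under eq_bigr do rewrite mulr0 cos0.
    under eq_bigr do rewrite sumr_const card_ord; rewrite sumr_const card_ord.
    by rewrite -(mulr_natr n.+1%:R n.+1) mulKf ?mulVf// pnatr_eq0.
  exact: cvg_cst.
have s20 : s / 2 != 0 by rewrite mulf_neq0.
have h := cvg_sinc (s / 2).
have h2 : (sinc (s / 2) ^+ 2 / sinc (s / 2 / n.+1%:R) ^+ 2) @[n --> \oo] --> sinc (s / 2) ^+ 2.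
  rewrite -[X in _ --> X]mulr1; apply: cvgM; first exact: cvg_cst.
  rewrite -[X in _ --> X]invr1; apply: cvgV; first exact: oner_neq0.
  suff : (sinc (s / 2 / n.+1%:R) * sinc (s / 2 / n.+1%:R)) @[n --> \oo] --> (1 * 1 : R).
    by rewrite mulr1.
  exact: cvgM.
apply: cvg_trans h2; apply: near_eq_cvg.
(* The denominator tends to 1, hence is eventually nonzero and may be divided by. *)
have /cvgrPdist_lt /(_ 1 ltr01) := h.
apply: filterS => n hn.
have sc0 : sinc (s / 2 / n.+1%:R) != 0.
  by apply: contraTneq hn => ->; rewrite subr0 normr1 ltxx.
have M0 : n.+1%:R != 0 :> R by rewrite pnatr_eq0.
have y0 : s / 2 / n.+1%:R != 0 by rewrite mulf_neq0// invr_neq0.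
have := fejer_geometric n.+1 (s / n.+1%:R).
rewrite [n.+1%:R * _]mulrC divfK// !versin_half.
have -> : s / n.+1%:R / 2 = s / 2 / n.+1%:R by field.
move: sc0; rewrite /sinc (negbTE s20) (negbTE y0).
move=> sc0 e.
have sn0 : sin (s / 2 / n.+1%:R) != 0 by apply: contraNneq sc0 => ->; rewrite mul0r.
have -> : fejer n.+1 (s / n.+1%:R) = 4 * sin (s / 2) ^+ 2 / n.+1%:R / (4 * sin (s / 2 / n.+1%:R) ^+ 2).
  by rewrite -e mulfK// mulf_neq0// expf_neq0.
by field; rewrite s0 sn0 addrC natr1 M0.
Qed.

Variables (g : R -> R -> R) (K : R).
Hypothesis gc : continuous (fun z : R * R => g z.1 z.2).
Hypothesis gK : forall x y, `|g x y| <= K * (decay 0 1 x * decay 0 1 y).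

(** [fejer_le] bounds the normalised kernel by 1, so |g| dominates. Integrability of the limit is
    kept because the main term is later split into two integrals. *)
Lemma cvg_fejer_diagonal :
  \int[mu2]_z (g z.1 z.2 * (n.+1%:R^-1 * fejer n.+1 ((z.1 - z.2) / n.+1%:R))) @[n --> \oo]
    --> \int[mu2]_z (g z.1 z.2 * sinc ((z.1 - z.2) / 2) ^+ 2) /\
  mu2.-integrable setT (EFin \o (fun z => g z.1 z.2 * sinc ((z.1 - z.2) / 2) ^+ 2)).
Proof.
have gi := integrable_plane gc gK.
have cf n : continuous (fun z : R * R => n.+1%:R^-1 * fejer n.+1 ((z.1 - z.2) / n.+1%:R)).
  move=> z; apply: cvgM; first exact: cvg_cst.
  apply: (@continuous_comp _ _ _ (fun z : R * R => (z.1 - z.2) / n.+1%:R) (fejer n.+1)).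
    apply: cvgM; last exact: cvg_cst.
    by apply: cvgB; [exact: cvg_fst|exact: cvg_snd].
  exact: continuous_fejer.
have f1 n (z : R * R) : `|n.+1%:R^-1 * fejer n.+1 ((z.1 - z.2) / n.+1%:R)| <= 1.
  rewrite ger0_norm; last by apply: mulr_ge0; rewrite ?invr_ge0// fejer_ge0.
  by rewrite ler_pdivrMl ?ltr0n// mulr1 fejer_le.
have fi n := integrable_plane_bounded gc gK (cf n) (f1 n).
have pw (z : RR) : (g z.1 z.2 * (n.+1%:R^-1 * fejer n.+1 ((z.1 - z.2) / n.+1%:R))) @[n --> \oo]
    --> g z.1 z.2 * sinc ((z.1 - z.2) / 2) ^+ 2.
  by apply: cvgM; [exact: cvg_cst|exact: cvg_fejer_sinc].
have mlim : measurable_fun [set: RR] (fun z : RR => g z.1 z.2 * sinc ((z.1 - z.2) / 2) ^+ 2).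
  apply: (@measurable_fun_cvg _ _ _ _ (fun n (z : RR) => g z.1 z.2 * (n.+1%:R^-1 * fejer n.+1 ((z.1 - z.2) / n.+1%:R)))) => //.
  by move=> n; have /integrableP[/measurable_EFinP] := fi n.
have [] := @dominated_convergence _ _ _ mu2 setT measurableT
  (fun n => EFin \o (fun z => g z.1 z.2 * (n.+1%:R^-1 * fejer n.+1 ((z.1 - z.2) / n.+1%:R))))
  (EFin \o (fun z => g z.1 z.2 * sinc ((z.1 - z.2) / 2) ^+ 2))
  (EFin \o (fun z => `|g z.1 z.2|)).
- by move=> n; have /integrableP[] := fi n.
- exact/measurable_EFinP.
- by apply: aeW => z _ /=; apply: cvg_EFin; [exact: nearW|exact: pw].
- exact: (integrable_norm gi).
- by apply: aeW => z n _ /=; rewrite lee_fin normrM ler_piMr.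
move=> li _ lc; split => //.
have lf := integrable_fin_num measurableT li.
apply: fine_cvg; rewrite fineK//.
Qed.

End MainTerm.

(** * Traces and Frobenius orbits *)

Section AbsoluteTrace.
Variables (p s : nat) (K : finFieldType).
Hypothesis p_pr : prime p.
Hypothesis cardK : #|K| = (p ^ s)%N.

Lemma pcharK : p \in [pchar K].
Proof. exact: (card_finPcharP cardK). Qed.

Lemma exprD_ppow (x y : K) i : (x + y) ^+ (p ^ i) = x ^+ (p ^ i) + y ^+ (p ^ i).
Proof.
apply: exprDn_pchar; rewrite pnatX; apply/orP; left.
by rewrite pnatE// pcharK.
Qed.

Lemma expr_card_ppow (x : K) : x ^+ (p ^ s) = x.
Proof. by rewrite -cardK expf_card. Qed.

Lemma abstrE (x : K) : abstr p x = \sum_(i < s) x ^+ (p ^ i).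
Proof. by rewrite /abstr cardK pfactorK. Qed.

Lemma abstrD (x y : K) : abstr p (x + y) = abstr p x + abstr p y.
Proof. by rewrite !abstrE -big_split; apply: eq_bigr => i _; exact: exprD_ppow. Qed.

Lemma sum_frobenius_shift (x : K) :
  \sum_(i < s) x ^+ (p ^ i.+1) = \sum_(i < s) x ^+ (p ^ i).
Proof.
case: s expr_card_ppow => [|r] xs; first by rewrite !big_ord0.
rewrite big_ord_recr [RHS]big_ord_recl /= xs expn0 expr1 addrC.
by congr (_ + _); apply: eq_bigr.
Qed.

Lemma abstr_frobenius (x : K) : abstr p (x ^+ p) = abstr p x.
Proof.
rewrite !abstrE -[RHS]sum_frobenius_shift; apply: eq_bigr => i _.
by rewrite -exprM -expnS.
Qed.

Lemma abstr_fixed (x : K) : abstr p x ^+ p = abstr p x.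
Proof.
rewrite !abstrE -[RHS]sum_frobenius_shift.
have addp : {morph (fun y : K => y ^+ p) : a b / a + b}.
  by move=> a b; have := exprD_ppow a b 1; rewrite expn1.
have zp : (0 : K) ^+ p = 0 by rewrite expr0n gtn_eqF ?prime_gt0.
rewrite (big_morph _ addp zp).
by apply: eq_bigr => i _; rewrite -exprM -expnSr.
Qed.

Lemma ltn_Fp (a : 'F_p) : (a < p)%N.
Proof. exact: leq_trans (ltn_ord a) (eq_leq (Fp_cast p_pr)). Qed.

Definition Fp_emb (a : 'F_p) : K := (a : nat)%:R.

Lemma Fp_embD a b : Fp_emb (a + b) = Fp_emb a + Fp_emb b.
Proof.
rewrite /Fp_emb -natrD -[RHS](GRing.natr_mod_pchar pcharK).
by congr (_%:R); exact: (congr1 (modn _) (Fp_cast p_pr)).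
Qed.

Lemma Fp_emb_inj : injective Fp_emb.
Proof.
move=> a b ab; apply/eqP; rewrite -subr_eq0; apply/eqP.
have {ab} : Fp_emb (a - b) = 0.
  have := Fp_embD (a - b) b; rewrite subrK ab => /esym/eqP.
  by rewrite -[X in _ == X]add0r => /eqP /addIr.
move=> /eqP; rewrite -(dvdn_pcharf pcharK) /dvdn => /eqP h.
by apply: val_inj => /=; move: h; rewrite modn_small// ltn_Fp.
Qed.

(** Otherwise ['X^p - 'X] would have [y] as a root besides the [p] elements of the prime field. *)
Lemma Fp_emb_fixed (y : K) : y ^+ p = y -> exists a, Fp_emb a = y.
Proof.
move=> yp; case: (pickP (fun a => Fp_emb a == y)) => [a /eqP <-|no]; first by exists a.
pose P : {poly K} := 'X^p - 'X.
have sP : size P = p.+1.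
  by rewrite size_polyDl size_polyXn// size_polyN size_polyX ltnS prime_gt1.
have P0 : P != 0 by rewrite -size_poly_eq0 sP.
pose rs := y :: [seq Fp_emb a | a <- enum 'F_p].
have srs : size rs = p.+1 by rewrite /= size_map -cardE card_Fp.
have rootP : all (root P) rs.
  apply/andP; split; first by rewrite /root !hornerE yp subrr.
  apply/allP => z /mapP[a _ ->]; rewrite /root !hornerE subr_eq0 /Fp_emb -natrX.
  rewrite -(GRing.natr_mod_pchar pcharK) -[X in _ == X](GRing.natr_mod_pchar pcharK).
  by rewrite fermat_little.
have urs : uniq rs.
  rewrite /rs cons_uniq map_inj_uniq ?enum_uniq ?andbT; last exact: Fp_emb_inj.
  by apply/negP => /mapP[a _ ya]; have := no a; rewrite ya eqxx.
by have := max_poly_roots P0 rootP urs; rewrite srs sP ltnn.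
Qed.

(** The trace is fixed by Frobenius, hence lies in the prime field: the search in [trFp] succeeds
    and its default 0 is never returned. *)
Lemma trFpE (x : K) : Fp_emb (trFp p x) = abstr p x.
Proof.
have [a ax] := Fp_emb_fixed (abstr_fixed x).
rewrite /trFp; case: pickP => [k /eqP kx|no] /=.
  by rewrite -kx /Fp_emb val_Fp_nat// (GRing.natr_mod_pchar pcharK).
by have := no (Ordinal (ltn_Fp a)); rewrite /= -ax eqxx.
Qed.

Lemma trFpD (x y : K) : trFp p (x + y) = trFp p x + trFp p y.
Proof. by apply: Fp_emb_inj; rewrite Fp_embD !trFpE abstrD. Qed.

Lemma trFp0 : trFp p (0 : K) = 0.
Proof. by apply: (addrI (trFp p (0 : K))); rewrite -trFpD !addr0. Qed.

Lemma trFp_frobenius (x : K) : trFp p (x ^+ p) = trFp p x.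
Proof. by apply: Fp_emb_inj; rewrite !trFpE abstr_frobenius. Qed.

Lemma trFp_frobeniusX (x : K) i : trFp p (x ^+ (p ^ i)) = trFp p x.
Proof. by elim: i => [|i IH]; rewrite ?expr1// expnSr exprM trFp_frobenius. Qed.

Lemma card_fixed_le k (k0 : (0 < k)%N) : (#|[set x : K | x ^+ (p ^ k) == x]| <= p ^ k)%N.
Proof.
have pk1 : (1 < p ^ k)%N by rewrite -(expn0 p) ltn_exp2l// prime_gt1.
pose P : {poly K} := 'X^(p ^ k) - 'X.
have sP : size P = (p ^ k).+1.
  by rewrite size_polyDl size_polyXn// size_polyN size_polyX ltnS.
have P0 : P != 0 by rewrite -size_poly_eq0 sP.
rewrite cardE -ltnS -sP; apply: max_poly_roots; rewrite ?enum_uniq//.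
by apply/allP => x; rewrite mem_enum inE /root !hornerE subr_eq0.
Qed.

(* On the subfield fixed by the [k]-th Frobenius power the trace is [s / k]
   times a nonzero additive polynomial of degree [p ^ k.-1]. *)
Lemma trace_vanishing_dvdn k (W : {set K}) : (0 < k)%N -> (k %| s)%N ->
  (p ^ k <= #|W|)%N ->
  (forall y, y \in W -> y ^+ (p ^ k) = y) ->
  (forall y, y \in W -> trFp p y = 0) -> (p %| s %/ k)%N.
Proof.
move=> k0 ks cW fixW trW; rewrite (dvdn_pcharf pcharK).
apply: contraT => nz.
pose P : {poly K} := \sum_(i < k) 'X^(p ^ i).
have sP : size P = (p ^ k.-1).+1.
  rewrite /P -(prednK k0) big_ord_recr /= addrC size_polyDl size_polyXn//.
  rewrite ltnS; apply: (leq_trans (size_sum _ _ _)).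
  apply/bigmax_leqP => i _; rewrite size_polyXn.
  by rewrite ltn_exp2l// prime_gt1.
have P0 : P != 0 by rewrite -size_poly_eq0 sP.
have abstrW y : y \in W -> root P y.
  move=> yW; have : abstr p y = 0 by rewrite -trFpE trW.
  rewrite abstrE /root /P horner_sum => e.
  under eq_bigr do rewrite hornerXn.
  have key m : \sum_(i < m * k) y ^+ (p ^ i) = m%:R * \sum_(i < k) y ^+ (p ^ i).
    rewrite mulr_natl; elim: m => [|m IH]; first by rewrite mul0n big_ord0.
    rewrite mulrSr -IH mulSn addnC big_split_ord /=; congr (_ + _).
    apply: eq_bigr => i _; rewrite expnD exprM; congr (_ ^+ _).
    elim: m {IH} => [|m IH]; first by rewrite mul0n expr1.
    by rewrite mulSn expnD exprM fixW.
  have := key (s %/ k)%N; rewrite divnK// e => /esym/eqP.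
  by rewrite mulf_eq0 (negbTE nz).
have : (#|W| <= p ^ k.-1)%N.
  rewrite -ltnS -sP cardE; apply: max_poly_roots; rewrite ?enum_uniq//.
  by apply/allP => y; rewrite mem_enum; exact: abstrW.
move=> /(leq_trans cW); rewrite leq_exp2l ?prime_gt1// => hk.
by move: hk; rewrite -{1}(prednK k0) ltnn.
Qed.

End AbsoluteTrace.

Section PolyOf.
Variables (F : finFieldType) (d : nat).
Implicit Types a b : {ffun 'I_d.+1 -> F}.

Lemma coef_poly_of a (i : 'I_d.+1) : (poly_of a)`_i = a i.
Proof. by rewrite coef_poly ltn_ord inord_val. Qed.

Lemma size_poly_of a : (size (poly_of a) <= d.+1)%N.
Proof. exact: size_poly. Qed.

Lemma poly_ofD a b : poly_of (a + b) = poly_of a + poly_of b.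
Proof.
apply/polyP => i; rewrite coefD !coef_poly; case: ifP => _; last by rewrite addr0.
by rewrite ffunE.
Qed.

Lemma poly_of_inj : injective (@poly_of F d).
Proof.
by move=> a b ab; apply/ffunP => i; rewrite -!coef_poly_of ab.
Qed.

End PolyOf.

Section Frobenius.
Variables (p n r : nat) (F K : finFieldType) (iota : {rmorphism F -> K}).
Hypotheses (p_pr : prime p) (n0 : (0 < n)%N) (r0 : (0 < r)%N).
Hypotheses (cardF : #|F| = (p ^ n)%N) (cardK : #|K| = (#|F| ^ r)%N).
Implicit Types (h : {poly F}) (x y : K).

Let cardK' : #|K| = (p ^ (n * r))%N.
Proof. by rewrite cardK cardF expnM. Qed.

Local Notation "h ^i" := (map_poly iota h) (at level 2, format "h ^i").

Definition frob x := x ^+ #|F|.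

Lemma iter_frob k x : iter k frob x = x ^+ (#|F| ^ k).
Proof.
elim: k => [|k IH]; first by rewrite expr1.
by rewrite iterS IH /frob -exprM -expnSr.
Qed.

Lemma frobD x y : frob (x + y) = frob x + frob y.
Proof. by rewrite /frob cardF; exact: (exprD_ppow p_pr cardK'). Qed.

Lemma frob0 : frob 0 = 0.
Proof. by apply: (addrI (frob 0)); rewrite -frobD !addr0. Qed.

Lemma iter_frob_card x : iter r frob x = x.
Proof. by rewrite iter_frob -cardK expf_card. Qed.

Lemma frob_inj : injective frob.
Proof.
have e x : iter r.-1 frob (frob x) = x.
  by rewrite -iterSr prednK// iter_frob_card.
by move=> x y xy; rewrite -[x]e xy e.
Qed.

Lemma frob_horner h x : h^i.[frob x] = frob h^i.[x].
Proof.
rewrite !horner_coef (big_morph frob frobD frob0); apply: eq_bigr => i _.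
rewrite /frob exprMn -!exprM mulnC coef_map /=; congr (_ * _).
by rewrite -rmorphXn expf_card.
Qed.

Lemma iter_frob_horner k h x : h^i.[iter k frob x] = iter k frob h^i.[x].
Proof. by elim: k => //= k IH; rewrite frob_horner IH. Qed.

(** The degree of [x] over [F], obtained as the size of its Frobenius orbit. *)
Definition period x := fingraph.order frob x.

Lemma period_gt0 x : (0 < period x)%N.
Proof. exact: order_gt0. Qed.

Lemma iter_period x : iter (period x) frob x = x.
Proof. exact: iter_order frob_inj x. Qed.

Lemma period_dvdn k x : iter k frob x = x -> (period x %| k)%N.
Proof.
move=> kx; rewrite /dvdn; apply/eqP.
have lt : (k %% period x < period x)%N by rewrite ltn_mod period_gt0.
rewrite -(findex_iter lt).
have mult m : iter (m * period x) frob x = x.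
  by elim: m => //= m IH; rewrite mulSn iterD IH iter_period.
have -> : iter (k %% period x) frob x = x.
  by rewrite -[RHS]kx {2}(divn_eq k (period x)) addnC iterD mult.
exact: findex0.
Qed.

Lemma period_dvdn_deg x : (period x %| r)%N.
Proof. by apply: period_dvdn; exact: iter_frob_card. Qed.

Lemma period_le x : (period x <= r)%N.
Proof. by apply: dvdn_leq => //; exact: period_dvdn_deg. Qed.

Lemma horner_period h x : h^i.[x] ^+ (p ^ (n * period x)) = h^i.[x].
Proof.
by rewrite expnM -cardF -iter_frob -iter_frob_horner iter_period.
Qed.

Lemma root_orbit h x : root h^i x -> all (root h^i) (fingraph.orbit frob x).
Proof.
move=> /eqP hx; apply/allP => y; rewrite -fconnect_orbit => /iter_findex <-.
rewrite /root iter_frob_horner hx; apply/eqP.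
by elim: (findex _ _ _) => //= k ->; exact: frob0.
Qed.

Lemma period_lt_size h x : h != 0 -> root h^i x -> (period x < size h)%N.
Proof.
move=> h0 hx; rewrite -(size_map_poly iota) /period -size_orbit.
by apply: max_poly_roots; rewrite ?map_poly_eq0 ?orbit_uniq// root_orbit.
Qed.

(* Pigeonhole: the [#|F| ^ (e + 1)] polynomials of degree at most [e = period x]
   take at most [#|F| ^ e] values at [x]. *)
Lemma minpoly_exists x : exists mu : {poly F},
  [/\ mu \is monic, size mu = (period x).+1 & forall h, root h^i x = (mu %| h)%R].
Proof.
pose e := period x.
pose ev (a : {ffun 'I_e.+1 -> F}) := (poly_of a)^i.[x].
have [h [h0 sh hx]] : exists h, [/\ h != 0, (size h <= e.+1)%N & root h^i x].
  have : ~~ injectiveb ev.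
    apply/negP => /injectiveP inj.
    have ne0 : (0 < n * e)%N by rewrite muln_gt0 n0 period_gt0.
    have := card_fixed_le K p_pr ne0.
    rewrite leqNgt => /negP; apply.
    apply: (@leq_trans #|[set ev a | a in [set: {ffun 'I_e.+1 -> F}]]|); last first.
      apply/subset_leq_card/fintype.subsetP => y /imsetP[a _ ->].
      by rewrite inE horner_period.
    rewrite card_imset// cardsT card_ffun card_ord cardF -expnM ltn_exp2l ?prime_gt1//.
    by rewrite ltn_mul2l n0 /=.
  move=> /injectivePn[a [b ab evab]]; exists (poly_of a - poly_of b); split.
  - by rewrite subr_eq0; apply: contra_neq ab => /poly_of_inj.
  - by rewrite (leq_trans (size_polyD _ _))// geq_max size_polyN !size_poly_of.
  - by rewrite rmorphB /root hornerD hornerN subr_eq0; apply/eqP.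
have sh' : size h = e.+1 by apply/eqP; rewrite eqn_leq sh period_lt_size.
have l0 : lead_coef h != 0 by rewrite lead_coef_eq0.
exists ((lead_coef h)^-1 *: h); split.
- by rewrite monicE lead_coefZ mulVf.
- by rewrite size_scale ?invr_eq0.
- move=> f; rewrite dvdpZl ?invr_eq0//; apply/idP/idP => [fx|/dvdpP[g ->]]; last first.
    by rewrite rmorphM rootM hx orbT.
  apply: contraT => nd; have m0 : f %% h != 0 by rewrite -/(dvdp h f) nd.
  have rm : root (f %% h)^i x.
    move: fx; rewrite {1}(divp_eq f h) rmorphD rmorphM /root hornerD hornerM.
    by rewrite (eqP hx) mulr0 add0r.
  by have := period_lt_size m0 rm; rewrite ltnNge -ltnS -sh' ltn_modp h0.
Qed.

Definition minp x : {poly F} := projT1 (cid (minpoly_exists x)).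

Lemma minp_monic x : minp x \is monic.
Proof. by rewrite /minp; case: cid => mu []. Qed.

Lemma size_minp x : size (minp x) = (period x).+1.
Proof. by rewrite /minp; case: cid => mu []. Qed.

Lemma root_minp h x : root h^i x = (minp x %| h)%R.
Proof. by rewrite /minp; case: cid => mu []. Qed.

Lemma minp_neq0 x : minp x != 0.
Proof. exact/monic_neq0/minp_monic. Qed.

Lemma root_minp_self x : root (minp x)^i x.
Proof. by rewrite root_minp dvdpp. Qed.

Lemma minp_orbit x y : y \in fingraph.orbit frob x -> minp y = minp x.
Proof.
rewrite -fconnect_orbit => /iter_findex <-; set k := findex _ _ _.
have re h : root h^i (iter k frob x) = root h^i x.
  apply/idP/idP => [|/root_orbit /allP]; last first.
    by apply; rewrite -fconnect_orbit fconnect_iter.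
  rewrite /root iter_frob_horner; elim: k => //= k IH.
  by move=> /eqP e; apply: IH; apply/eqP/frob_inj; rewrite e frob0.
apply/eqP; rewrite -eqp_monic ?minp_monic//; apply/andP; split.
  by rewrite -root_minp re root_minp_self.
by rewrite -root_minp -re root_minp_self.
Qed.

(** A further root outside the orbit would give [minp x] more roots than its degree. *)
Lemma minp_eq_orbit x y : minp y = minp x -> y \in fingraph.orbit frob x.
Proof.
move=> mxy; apply: contraT => ny.
have : (size (y :: fingraph.orbit frob x) < size (minp x)^i)%N.
  apply: max_poly_roots; rewrite ?map_poly_eq0 ?minp_neq0//=.
    by rewrite -{1}mxy root_minp_self root_orbit ?root_minp_self.
  by rewrite ny orbit_uniq.
by rewrite size_map_poly size_minp /= size_orbit ltnn.
Qed.

Lemma card_minp_eq x : #|[set y | minp y == minp x]| = period x.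
Proof.
rewrite /period -size_orbit -(card_uniqP (orbit_uniq frob x)) -sum1_card -[RHS]sum1_card.
apply: eq_bigl => y; rewrite inE; apply/eqP/idP => [|/minp_orbit//].
exact: minp_eq_orbit.
Qed.

Lemma card_root_minp h : h != 0 -> (#|[set y | root h^i y]| <= (size h).-1)%N.
Proof.
move=> h0; rewrite -ltnS prednK ?size_poly_gt0// cardE -(size_map_poly iota).
apply: max_poly_roots; rewrite ?map_poly_eq0 ?enum_uniq//.
by apply/allP => y; rewrite mem_enum inE.
Qed.

Definition evtr x h : 'F_p := trFp p h^i.[x].

Lemma evtrD x h1 h2 : evtr x (h1 + h2) = evtr x h1 + evtr x h2.
Proof. by rewrite /evtr rmorphD hornerD (trFpD p_pr cardK'). Qed.

(** The left monomial takes at [x] the p-th power of the value of the right one, and traces are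
    Frobenius invariant. This replaces shifts at exponents divisible by [p], which [Fd] forbids. *)
Lemma evtr_monomial x (b : F) j :
  evtr x ((b ^+ p) *: 'X^(p * j)) = evtr x (b *: 'X^j).
Proof.
rewrite /evtr !map_polyZ !map_polyXn !hornerZ !hornerXn rmorphXn mulnC exprM -exprMn.
exact: (trFp_frobenius p_pr cardK').
Qed.

Lemma evtr_minp x y h : minp y = minp x -> evtr y h = evtr x h.
Proof.
move=> /minp_eq_orbit; rewrite -fconnect_orbit => /iter_findex <-.
rewrite /evtr iter_frob_horner iter_frob cardF -expnM.
exact: (trFp_frobeniusX p_pr cardK').
Qed.

(** The points at which traces of values can vanish identically: on the subfield generated by [x],
    the trace from [K] is [r %/ period x] times the trace of that subfield. *)
Definition degenerate x := (x == 0) || (p %| r %/ period x)%N.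

(** As x Q(x) is nonzero, the polynomials ['X * Q * h] take q^(period x) distinct values at [x],
    which fill the subfield it generates; [trace_vanishing_dvdn] applies. In use, [Q] is 1 or the
    minimal polynomial of a second point. *)
Lemma degenerate_evtr x (Q : {poly F}) : x != 0 -> ~~ root Q^i x ->
  (forall h, (size h <= period x)%N -> evtr x ('X * Q * h) = 0) -> degenerate x.
Proof.
move=> x0 Qx trh; rewrite /degenerate (negbTE x0) /=.
have [e pe] : exists e, period x = e.+1 by exists (period x).-1; rewrite prednK ?period_gt0.
pose ev (a : {ffun 'I_e.+1 -> F}) := ('X * Q * poly_of a)^i.[x].
have evinj : injective ev.
  move=> a b; rewrite /ev !rmorphM /= map_polyX !hornerM hornerX => /mulfI.
  rewrite mulf_neq0// => /(_ isT) ab; apply: poly_of_inj; apply/eqP.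
  rewrite -subr_eq0; apply: contraT => ne.
  have rt : root (poly_of a - poly_of b)^i x.
    by rewrite rmorphB /root hornerD hornerN ab subrr.
  have := period_lt_size ne rt; rewrite pe ltnNge => /negP[].
  by rewrite (leq_trans (size_polyD _ _))// geq_max size_polyN !size_poly_of.
have := @trace_vanishing_dvdn p (n * r) K p_pr cardK' (n * period x)
   [set ev a | a in [set: {ffun 'I_e.+1 -> F}]].
rewrite divnMl//; apply.
- by rewrite muln_gt0 n0 period_gt0.
- by rewrite dvdn_pmul2l// period_dvdn_deg.
- by rewrite card_imset// cardsT card_ffun card_ord -pe cardF -expnM.
- by move=> y /imsetP[a _ ->]; exact: horner_period.
- by move=> y /imsetP[a _ ->]; apply: trh; rewrite pe size_poly_of.
Qed.

Lemma card_iter_fixed_le k : (0 < k)%N ->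
  (#|[set x | iter k frob x == x]| <= #|F| ^ k)%N.
Proof.
move=> k0; have nk0 : (0 < n * k)%N by rewrite muln_gt0 n0.
have := card_fixed_le K p_pr nk0; rewrite expnM -cardF; congr (_ <= _)%N.
by apply: eq_card => x; rewrite !inE iter_frob.
Qed.

Lemma iter_frob_dvdn k x : (period x %| k)%N -> iter k frob x = x.
Proof.
move=> /dvdnP[m ->]; elim: m => //= m IH.
by rewrite mulSn iterD IH iter_period.
Qed.

(** If [p] divides [r %/ period x], then [period x] divides [r %/ p], so [x] is fixed by that
    Frobenius power; moreover [p >= 3]. If [p] does not divide [r], only 0 remains. *)
Lemma card_degenerate : (2 < p)%N -> (#|[set x | degenerate x]| <= #|F| ^ (r %/ 3))%N.
Proof.
move=> p2; have q0 : (0 < #|F|)%N by rewrite cardF expn_gt0 prime_gt0.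
have [pr|npr] := boolP (p %| r)%N; last first.
  rewrite (leq_trans _ (_ : 1 <= _)%N) ?expn_gt0 ?q0// -(cards1 (0 : K)).
  apply/subset_leq_card/fintype.subsetP => x; rewrite !inE => /orP[//|pd].
  by move: npr; rewrite -(divnK (period_dvdn_deg x)) dvdn_mulr.
have rp0 : (0 < r %/ p)%N by rewrite divn_gt0 ?prime_gt0// dvdn_leq.
apply: (@leq_trans (#|F| ^ (r %/ p))); last first.
  by rewrite leq_pexp2l// leq_div2l.
apply: leq_trans (card_iter_fixed_le rp0).
apply/subset_leq_card/fintype.subsetP => x; rewrite !inE => /orP[/eqP ->|pd].
  by rewrite iter_frob expr0n expn_eq0 gtn_eqF.
apply/eqP/iter_frob_dvdn; apply/dvdnP; exists (r %/ period x %/ p)%N.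
by apply/eqP; rewrite -(eqn_pmul2r (prime_gt0 p_pr)) divnK// mulnAC divnK// divnK// period_dvdn_deg.
Qed.

(** A proper divisor of [r] is at most [r %/ 2]; the sizes of the fixed sets form a geometric
    progression of ratio at least 2, whose sum is at most twice its last term. *)
Lemma card_short_period : (1 < r)%N -> (#|[set x | (period x < r)%N]| <= 2 * #|F| ^ (r %/ 2))%N.
Proof.
move=> r1; have q2 : (1 < #|F|)%N by rewrite cardF -(exp1n n) ltn_exp2r ?prime_gt1.
have sum_le k : (\sum_(i < k) #|F| ^ i.+1 <= 2 * #|F| ^ k)%N.
  elim: k => [|k IH]; first by rewrite big_ord0.
  rewrite big_ord_recr /= (leq_trans (leq_add IH (leqnn _)))//.
  have : (2 * #|F| ^ k <= #|F| ^ k.+1)%N by rewrite expnS leq_mul2r q2 orbT.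
  by move: (#|F| ^ k)%N (#|F| ^ k.+1)%N => u v; lia.
apply: leq_trans (sum_le (r %/ 2)%N).
apply: (@leq_trans (\sum_(i < r %/ 2) #|[set x : K | iter i.+1 frob x == x]|)); last first.
  by apply: leq_sum => i _; exact: card_iter_fixed_le.
apply: (@leq_trans #|\bigcup_(i < r %/ 2) [set x : K | iter i.+1 frob x == x]|); last first.
  elim/big_ind2: _ => [|a A b B hA hB|//]; first by rewrite cards0.
  by rewrite (leq_trans (leq_card_setU A B))// leq_add.
apply/subset_leq_card/fintype.subsetP => x; rewrite inE => lt.
have le2 : ((period x).-1 < r %/ 2)%N.
  rewrite prednK ?period_gt0// leq_divRL//.
  have /dvdnP[[|[|k]] rk] := period_dvdn_deg x.
  - by move: r0; rewrite rk mul0n.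
  - by move: lt; rewrite [X in (_ < X)%N]rk mul1n ltnn.
  - by rewrite [X in (_ <= X)%N]rk mulnC leq_mul2r orbC.
apply/bigcupP; exists (Ordinal le2) => //; rewrite inE; apply/eqP.
by rewrite -[RHS](iter_period x) -[in RHS](prednK (period_gt0 x)).
Qed.

End Frobenius.

(** * Averages of character sums *)

Section AdditiveCharacter.
Variables (R : realType) (p : nat) (psi : 'F_p -> R[i]).
Hypotheses (p_pr : prime p) (psiA : add_char psi) (psi_nt : exists x, psi x != 1).

Lemma psiD x y : psi (x + y) = psi x * psi y.
Proof. by case: psiA. Qed.

Lemma psi0 : psi 0 = 1.
Proof.
have [_ nz] := psiA; apply: (mulfI (nz 0)).
by rewrite -psiD addr0 mulr1.
Qed.

Lemma psiMn x k : psi (x *+ k) = psi x ^+ k.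
Proof. by elim: k => [|k IH]; rewrite ?mulr0n ?psi0// mulrS psiD IH exprS. Qed.

Lemma psi_norm x : `|psi x| = 1.
Proof.
have e : psi x ^+ p = 1.
  by rewrite -psiMn -mulr_natl pchar_Fp_0 // mul0r psi0.
apply/eqP; rewrite -(@pexpr_eq1 _ _ p) ?prime_gt0//.
by rewrite -normrX e normr1.
Qed.

Lemma psi_conj x : (psi x)^* = psi (- x).
Proof.
have [_ nz] := psiA; apply: (mulfI (nz x)).
by rewrite -psiD subrr psi0 -normCK psi_norm expr1n.
Qed.

(** A nonzero [x] generates the additive group of F_p, so [psi x = 1] would make [psi] trivial. *)
Lemma psi_eq1 x : psi x = 1 -> x = 0.
Proof.
move=> px; apply: contraPeq px => x0 px; have [y /eqP] := psi_nt; apply.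
rewrite -[y](divfK x0) -[y / x]natr_Zp mulr_natl psiMn px expr1n //.
Qed.

Section Orthogonality.
Variables (F : finFieldType) (n d : nat) (Lam : {poly F} -> 'F_p).
Hypotheses (n0 : (0 < n)%N) (cardF : #|F| = (p ^ n)%N).
Hypothesis LamD : forall h1 h2, Lam (h1 + h2) = Lam h1 + Lam h2.
Hypothesis LamFrob : forall b j, Lam ((b ^+ p) *: 'X^(p * j)) = Lam (b *: 'X^j).

Let Lam0 : Lam 0 = 0.
Proof. by apply: (addrI (Lam 0)); rewrite -LamD !addr0. Qed.

Lemma Fd_shift (e : {ffun 'I_d.+1 -> F}) : e ord_max = 0 ->
  (forall i : 'I_d.+1, (p %| i)%N -> e i = 0) ->
  \sum_(a in Fd F p d) psi (Lam (poly_of a)) =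
  psi (Lam (poly_of e)) * \sum_(a in Fd F p d) psi (Lam (poly_of a)).
Proof.
move=> em ei; rewrite [LHS](reindex_inj (addIr e)) /= mulr_sumr.
apply: eq_big => a; last by move=> _; rewrite poly_ofD LamD psiD mulrC.
rewrite !inE ffunE em addr0; congr (_ && _); apply: eq_forallb => i.
by case: (boolP (p %| i)%N) => //= pi; rewrite ffunE ei// addr0.
Qed.

(** A shift by a monomial of exponent prime to [p] and strictly between 0 and [d] multiplies the sum
    by a value of [psi], which must be 1. Exponents divisible by [p] descend through [LamFrob], by
    strong induction. Exponent [d] is out of reach because the leading coefficient must stay
    nonzero. *)
Lemma Fd_orthogonality : \sum_(a in Fd F p d) psi (Lam (poly_of a)) != 0 ->
  forall h : {poly F}, h`_0 = 0 -> (size h <= d)%N -> Lam h = 0.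
Proof.
move=> nz.
have mono (i : nat) (c : F) : (0 < i < d)%N -> Lam (c *: 'X^i) = 0.
  elim/ltn_ind: i c => i IH c /andP[i0 id].
  have [/dvdnP[j ij]|npi] := boolP (p %| i)%N.
    (* Every element of the finite field [F] is a p-th power, so [LamFrob] reaches any
       coefficient. *)
    have -> : c = (c ^+ (p ^ n.-1)) ^+ p.
      by rewrite -exprM -expnSr prednK// -cardF expf_card.
    rewrite ij mulnC LamFrob; apply: IH.
      by rewrite ij -{1}[j]muln1 ltn_pmul2l ?prime_gt1//; move: i0; rewrite ij muln_gt0 => /andP[].
    move: i0; rewrite ij muln_gt0 => /andP[-> _] /=.
    by apply: leq_ltn_trans id; rewrite ij leq_pmulr// prime_gt0.
  have id' : (i < d.+1)%N by apply: ltnW.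
  pose e := [ffun j : 'I_d.+1 => if j == Ordinal id' then c else 0].
  have pe : poly_of e = c *: 'X^i.
    apply/polyP => k; rewrite coef_poly coefZ coefXn.
    case: (ltnP k d.+1) => kd; last first.
      by rewrite gtn_eqF ?mulr0// (leq_trans id').
    rewrite ffunE -val_eqE /= inordK//; case: eqP => _; by rewrite ?mulr1 ?mulr0.
  rewrite -pe; apply: psi_eq1; apply: (mulIf nz); rewrite mul1r.
  rewrite -Fd_shift//.
    by rewrite ffunE -val_eqE /= gtn_eqF.
  by move=> k pk; rewrite ffunE; case: eqP => // ki; move: npi; rewrite -(congr1 val ki : val k = i) pk.
move=> h h0 sh; rewrite -[h]coefK poly_def (big_morph Lam LamD Lam0).
apply: big1 => i _; have [i0|i0] := posnP i; first by rewrite i0 h0 scale0r Lam0.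
by rewrite mono// i0 (leq_trans (ltn_ord i)).
Qed.

End Orthogonality.

Lemma norm_sum_psi (I : finType) (A : {set I}) (f : I -> 'F_p) :
  `|\sum_(a in A) psi (f a)| <= #|A|%:R.
Proof.
apply: le_trans (ler_norm_sum _ _ _) _.
under eq_bigr do rewrite psi_norm.
by rewrite sumr_const.
Qed.

Section Averages.
Variables (F : finFieldType) (n d : nat).
Hypotheses (p2 : (2 < p)%N) (n0 : (0 < n)%N) (cardF : #|F| = (p ^ n)%N).
Local Notation q := #|F|.

Lemma sum_psi_bound (K : finType) (P : {pred K}) (G : K -> R[i]) (A : nat) :
  (#|[set x | P x]| <= A)%N ->
  (forall x, `|G x| <= #|Fd F p d|%:R) -> (forall x, ~~ P x -> G x = 0) ->
  `|\sum_x G x| <= #|Fd F p d|%:R * A%:R.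
Proof.
move=> PA G1 G0; apply: le_trans (ler_norm_sum _ _ _) _.
rewrite (bigID P) /= [X in _ + X]big1 ?addr0; last by move=> x /G0 ->; rewrite normr0.
apply: (@le_trans _ _ (\sum_(x | P x) #|Fd F p d|%:R)); first exact: ler_sum.
by rewrite sumr_const -[X in X <= _]mulr_natr ler_wpM2l// ler_nat -cardsE.
Qed.

Section Single.
Variables (r : nat) (K : finFieldType) (iota : {rmorphism F -> K}).
Hypotheses (r0 : (0 < r)%N) (cardK : #|K| = (q ^ r)%N).

Lemma single_average (s : 'F_p) : s != 0 -> (r < d)%N ->
  `|\sum_(a in Fd F p d) \sum_x psi (s * evtr p iota x (poly_of a))|
  <= #|Fd F p d|%:R * (q ^ (r %/ 3))%:R.
Proof.
move=> s0 rd; rewrite exchange_big /=.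
apply: (@sum_psi_bound K (fun x : K => degenerate p r F x)) => [|x|x].
- exact: (card_degenerate p_pr n0 r0 cardF cardK p2).
- exact: norm_sum_psi.
apply: contraNeq => nz.
have [->|x0] := eqVneq x 0; first by rewrite /degenerate eqxx.
apply: (degenerate_evtr p_pr n0 r0 cardF cardK (iota := iota) (Q := 1)) => //.
  by rewrite rmorph1 root1.
move=> h sh; apply: (mulfI s0); rewrite mulr0.
apply: (@Fd_orthogonality F n d (fun h => s * evtr p iota x h)) => //.
- by move=> h1 h2; rewrite (evtrD iota p_pr cardF cardK) mulrDr.
- by move=> b j; rewrite (evtr_monomial iota p_pr cardF cardK).
- by rewrite mulr1 coefXM.
- rewrite mulr1 (leq_trans (size_polyMleq _ _))// size_polyX /=.
  rewrite (leq_ltn_trans sh)// (leq_ltn_trans _ rd)//.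
  exact: (period_le r0 cardK).
Qed.

End Single.
Section Pair.
Variables (r1 r2 : nat) (K1 K2 : finFieldType).
Variables (i1 : {rmorphism F -> K1}) (i2 : {rmorphism F -> K2}).
Hypotheses (r10 : (0 < r1)%N) (cardK1 : #|K1| = (q ^ r1)%N).
Hypotheses (r20 : (0 < r2)%N) (cardK2 : #|K2| = (q ^ r2)%N).
Hypothesis rd : (r1 + r2 < d)%N.
Local Notation mp1 := (minp i1 p_pr n0 r10 cardF cardK1).
Local Notation mp2 := (minp i2 p_pr n0 r20 cardF cardK2).

(** The two points lie in different extensions, so conjugacy is expressed by their minimal
    polynomials over [F]. Here one divides the other; equality follows by locating [y] among the
    roots of the two factors. *)
Lemma root_minp_pair x y : root (map_poly i1 (mp2 y)) x -> mp1 x = mp2 y.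
Proof.
rewrite (root_minp i1 p_pr n0 r10 cardF cardK1) => /dvdpP[g e].
have rt := root_minp_self i2 p_pr n0 r20 cardF cardK2 y.
rewrite e rmorphM rootM in rt.
(* If [y] were a root of the cofactor [g], its minimal polynomial would divide a polynomial of
   smaller degree. *)
case/orP: rt; rewrite (root_minp i2 p_pr n0 r20 cardF cardK2) => dv.
  have g0 : g != 0.
    by apply: contraTneq (minp_neq0 i2 p_pr n0 r20 cardF cardK2 y) => g0; rewrite e g0 mul0r eqxx.
  have := dvdp_leq g0 dv; rewrite {1}e size_mul//; last exact: minp_neq0.
  by rewrite size_minp addnS /= -[X in (_ <= X)%N]addn0 leq_add2l leqNgt period_gt0.
apply/eqP; rewrite -(eqp_monic (minp_monic i1 p_pr n0 r10 cardF cardK1 x)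
  (minp_monic i2 p_pr n0 r20 cardF cardK2 y)).
apply/andP; split => //.
by apply/dvdpP; exists g.
Qed.

Let Lam (s1 s2 : 'F_p) x y (h : {poly F}) := s1 * evtr p i1 x h + s2 * evtr p i2 y h.

Lemma pair_orthogonality s1 s2 x y :
  \sum_(a in Fd F p d) psi (Lam s1 s2 x y (poly_of a)) != 0 ->
  forall h : {poly F}, h`_0 = 0 -> (size h <= d)%N -> Lam s1 s2 x y h = 0.
Proof.
move=> nz; apply: (@Fd_orthogonality F n d (Lam s1 s2 x y)) => //.
- move=> h1 h2; rewrite /Lam (evtrD i1 p_pr cardF cardK1) (evtrD i2 p_pr cardF cardK2).
  by rewrite !mulrDr addrACA.
- by move=> b j; rewrite /Lam (evtr_monomial i1 p_pr cardF cardK1) (evtr_monomial i2 p_pr cardF cardK2).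
Qed.

Let size_XMh (Q h : {poly F}) k : (size Q <= k.+1)%N -> (size h + k < d)%N ->
  (size ('X * Q * h)%R <= d)%N.
Proof.
move=> sQ sh; have [->|h0] := eqVneq h 0; first by rewrite mulr0 size_poly0.
have [->|Q0] := eqVneq Q 0; first by rewrite mulr0 mul0r size_poly0.
have -> : 'X * Q * h = Q * h * 'X by rewrite -mulrA mulrC.
rewrite size_mulX ?mulf_neq0// size_mul//.
have : (0 < size h)%N by rewrite size_poly_gt0.
by move: (size Q) (size h) sQ sh => u v; lia.
Qed.

Let coef0_XMh (Q h : {poly F}) : ('X * Q * h)`_0 = 0.
Proof. by rewrite -mulrA coefXM. Qed.

(** Multiples of [mp2 y] silence the second point, and [mp2 y] does not vanish at [x], so the trace
    condition falls on [x] alone. The multiples stay below degree [d] because the two periods add up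
    to at most [r1 + r2]. *)
Lemma pair_not_conjugate s1 s2 x y : s1 != 0 -> s2 != 0 -> mp1 x != mp2 y ->
  \sum_(a in Fd F p d) psi (Lam s1 s2 x y (poly_of a)) != 0 -> degenerate p r1 F x.
Proof.
move=> s10 s20 xy /pair_orthogonality ort.
have [->|x0] := eqVneq x 0; first by rewrite /degenerate eqxx.
apply: (degenerate_evtr p_pr n0 r10 cardF cardK1 (iota := i1) (Q := mp2 y)) => //.
  by apply: contra xy => /root_minp_pair ->.
move=> h sh; apply: (mulfI s10); rewrite mulr0.
have := ort ('X * mp2 y * h) (coef0_XMh _ _); rewrite /Lam.
have -> : evtr p i2 y ('X * mp2 y * h) = 0.
  rewrite /evtr !rmorphM /= !hornerM (eqP (root_minp_self i2 p_pr n0 r20 cardF cardK2 y)).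
  by rewrite mulr0 mul0r (@trFp0 p (n * r2) K2)// cardK2 cardF expnM.
rewrite mulr0 addr0 => -> //; apply: (@size_XMh _ _ (period F y)).
  by rewrite size_minp.
apply: leq_ltn_trans rd; apply: leq_add.
  exact: leq_trans sh (period_le r10 cardK1 x).
exact: (period_le r20 cardK2 y).
Qed.

End Pair.

(** Besides pairs of degenerate points, only conjugate pairs survive. Their common period divides
    the gcd g of the degrees, so there are at most q^g choices of [x] and at most g conjugates [y]
    for each. *)
Lemma pair_average_diff (r1 r2 : nat) (K1 K2 : finFieldType)
    (i1 : {rmorphism F -> K1}) (i2 : {rmorphism F -> K2}) (s1 s2 : 'F_p) :
  (0 < r1)%N -> (0 < r2)%N -> r1 != r2 -> (r1 + r2 < d)%N ->
  #|K1| = (q ^ r1)%N -> #|K2| = (q ^ r2)%N -> s1 != 0 -> s2 != 0 ->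
  `|\sum_(a in Fd F p d) \sum_x \sum_y
     psi (s1 * evtr p i1 x (poly_of a) + s2 * evtr p i2 y (poly_of a))|
  <= #|Fd F p d|%:R *
     (q ^ (r1 %/ 3) * q ^ (r2 %/ 3) + gcdn r1 r2 * q ^ (gcdn r1 r2))%:R.
Proof.
move=> r10 r20 r12 rd cK1 cK2 s10 s20.
pose mp1 := minp i1 p_pr n0 r10 cardF cK1.
pose mp2 := minp i2 p_pr n0 r20 cardF cK2.
pose Z := finset.setX [set x : K1 | degenerate p r1 F x] [set y : K2 | degenerate p r2 F y].
pose C := [set z : K1 * K2 | mp1 z.1 == mp2 z.2].
have -> : \sum_(a in Fd F p d) \sum_x \sum_y
     psi (s1 * evtr p i1 x (poly_of a) + s2 * evtr p i2 y (poly_of a)) =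
   \sum_(z : K1 * K2) \sum_(a in Fd F p d)
     psi (s1 * evtr p i1 z.1 (poly_of a) + s2 * evtr p i2 z.2 (poly_of a)).
  rewrite [RHS]exchange_big /=; apply: eq_bigr => a _.
  by rewrite pair_bigA.
apply: (@sum_psi_bound (K1 * K2)%type (fun z => z \in Z :|: C)) => [|z|z].
- rewrite (_ : finset _ = Z :|: C); last by apply/finset.setP => z; rewrite !inE.
  rewrite (leq_trans (leq_card_setU _ _))// leq_add//.
    rewrite finset.cardsX leq_mul//.
      exact: (card_degenerate p_pr n0 r10 cardF cK1 p2).
    exact: (card_degenerate p_pr n0 r20 cardF cK2 p2).
  set g := gcdn r1 r2.
  have g0 : (0 < g)%N by rewrite gcdn_gt0 r10.
  pose X := [set x : K1 | iter g (@frob F K1) x == x].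
  have CX : C \subset \bigcup_(x in X) finset.setX [set x] [set y : K2 | root (map_poly i2 (mp1 x)) y].
    apply/fintype.subsetP => -[x y]; rewrite inE /= => /eqP xy.
    apply/finset.bigcupP; exists x; last first.
      by rewrite !inE eqxx /= xy; exact: root_minp_self.
    rewrite inE; apply/eqP; apply: (iter_frob_dvdn r10 cK1).
    rewrite dvdn_gcd (period_dvdn_deg r10 cK1) /=.
    have -> : period F x = period F y.
      apply: succn_inj; rewrite -(size_minp i1 p_pr n0 r10 cardF cK1).
      by rewrite -/(mp1 x) xy size_minp.
    exact: (period_dvdn_deg r20 cK2).
  apply: (leq_trans (subset_leq_card CX)).
  apply: (@leq_trans (\sum_(x in X) g)).
    apply: (@leq_trans (\sum_(x in X) #|finset.setX [set x] [set y : K2 | root (map_poly i2 (mp1 x)) y]|)).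
      elim/big_ind2: _ => [|a A b B hA hB|//]; first by rewrite cards0.
      by rewrite (leq_trans (leq_card_setU A B))// leq_add.
    apply: leq_sum => x; rewrite inE => /eqP xg.
    rewrite finset.cardsX cards1 mul1n.
    apply: leq_trans (card_root_minp _ _) _; first exact: minp_neq0.
    rewrite size_minp /=; apply: dvdn_leq => //.
    exact: (period_dvdn r10 cK1).
  rewrite sum_nat_const mulnC leq_mul2l.
  by rewrite (card_iter_fixed_le K1 p_pr n0 cardF g0) orbT.
- exact: norm_sum_psi.
- rewrite !inE negb_or => /andP[nZ nC]; apply/eqP; apply: contraNT nZ => nz.
  apply/andP; split.
    exact: (pair_not_conjugate (r20 := r20) (cardK2 := cK2) rd s10 s20 nC nz).
  (* The same argument with the two points exchanged makes the second one degenerate. *)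
  have rd' : (r2 + r1 < d)%N by rewrite addnC.
  apply: (pair_not_conjugate (i1 := i2) (i2 := i1) (r10 := r20) (r20 := r10) (cardK1 := cK2) (cardK2 := cK1) rd' s20 s10 (y := z.1)).
    by rewrite eq_sym.
  by under eq_bigr do rewrite addrC.
Qed.

Section SameDegree.
Variables (r : nat) (K : finFieldType) (iota : {rmorphism F -> K}).
Hypotheses (r0 : (0 < r)%N) (rd : (r + r < d)%N) (cardK : #|K| = (q ^ r)%N).
Local Notation mp := (minp iota p_pr n0 r0 cardF cardK).

Let Z := [set z : K * K | degenerate p r F z.1 && degenerate p r F z.2].

Let cardZ : (#|Z| <= q ^ (r %/ 3) * q ^ (r %/ 3))%N.
Proof.
have -> : Z = finset.setX [set x : K | degenerate p r F x] [set y : K | degenerate p r F y].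
  by apply/finset.setP => z; rewrite !inE.
by rewrite finset.cardsX leq_mul// (card_degenerate p_pr n0 r0 cardF cardK p2).
Qed.

Let not_conjugate s1 s2 (z : K * K) : s1 != 0 -> s2 != 0 -> mp z.1 != mp z.2 -> z \notin Z ->
  \sum_(a in Fd F p d)
     psi (s1 * evtr p iota z.1 (poly_of a) + s2 * evtr p iota z.2 (poly_of a)) = 0.
Proof.
move=> s10 s20 nC nZ; apply/eqP; apply: contraNT nZ => nz; rewrite inE; apply/andP; split.
  exact: (pair_not_conjugate (r20 := r0) (cardK2 := cardK) rd s10 s20 nC nz).
apply: (pair_not_conjugate (i1 := iota) (i2 := iota) (r10 := r0) (r20 := r0) (cardK1 := cardK) (cardK2 := cardK) rd s20 s10 (y := z.1)).
  by rewrite eq_sym.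
by under eq_bigr do rewrite addrC.
Qed.

Let pairE s1 s2 : \sum_(a in Fd F p d) \sum_x \sum_y
     psi (s1 * evtr p iota x (poly_of a) + s2 * evtr p iota y (poly_of a)) =
   \sum_(z : K * K) \sum_(a in Fd F p d)
     psi (s1 * evtr p iota z.1 (poly_of a) + s2 * evtr p iota z.2 (poly_of a)).
Proof.
rewrite [RHS]exchange_big /=; apply: eq_bigr => a _.
by rewrite pair_bigA.
Qed.

(** Conjugate points define the same trace functional, so on such a pair the exponent is [s1 + s2]
    times it; a nonzero factor forces both points to be degenerate. *)
Lemma pair_average_same s1 s2 : s1 != 0 -> s2 != 0 -> s1 + s2 != 0 ->
  `|\sum_(a in Fd F p d) \sum_x \sum_y
     psi (s1 * evtr p iota x (poly_of a) + s2 * evtr p iota y (poly_of a))|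
  <= #|Fd F p d|%:R * (q ^ (r %/ 3) * q ^ (r %/ 3))%:R.
Proof.
move=> s10 s20 s120; rewrite pairE.
apply: (@sum_psi_bound (K * K)%type (fun z => z \in Z)) => [|z|z].
- by rewrite (_ : finset _ = Z)//; apply/finset.setP => z; rewrite !inE.
- exact: norm_sum_psi.
- move=> nZ; have [C|nC] := eqVneq (mp z.1) (mp z.2); last exact: not_conjugate.
  apply/eqP; apply: contraNT nZ => nz.
  have ort := pair_orthogonality cardK cardK nz.
  have tr0 (h : {poly F}) : h`_0 = 0 -> (size h <= d)%N -> evtr p iota z.1 h = 0.
    move=> h0 sh; have := ort h h0 sh.
    rewrite (evtr_minp (p_pr := p_pr) (n0 := n0) (r0 := r0) (cardF := cardF) (cardK := cardK) h (esym C)).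
    by rewrite -mulrDl => /eqP; rewrite mulf_eq0 (negbTE s120) => /eqP.
  have deg w : (forall h : {poly F}, h`_0 = 0 -> (size h <= d)%N -> evtr p iota w h = 0) -> degenerate p r F w.
    move=> trw; have [->|w0] := eqVneq w 0; first by rewrite /degenerate eqxx.
    apply: (degenerate_evtr p_pr n0 r0 cardF cardK (iota := iota) (Q := 1)) => //.
      by rewrite rmorph1 root1.
    move=> h sh; apply: trw; first by rewrite mulr1 coefXM.
    rewrite mulr1 (leq_trans (size_polyMleq _ _))// size_polyX /=.
    rewrite (leq_ltn_trans sh)// (leq_ltn_trans _ rd)// (leq_trans _ (leq_addr _ _))//.
    exact: (period_le r0 cardK).
  rewrite inE !deg// => h h0 sh.
  rewrite -(evtr_minp (p_pr := p_pr) (n0 := n0) (r0 := r0) (cardF := cardF) (cardK := cardK) h C).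
  exact: tr0.
Qed.

(** With opposite signs every conjugate pair contributes the full count of [Fd]. The number of such
    pairs is the sum of the periods, short of [r * q ^ r] only through points of period below
    [r]. *)
Lemma pair_average_diagonal s : s != 0 ->
  `|\sum_(a in Fd F p d) \sum_x \sum_y
     psi (s * evtr p iota x (poly_of a) - s * evtr p iota y (poly_of a))
     - #|Fd F p d|%:R * (r * q ^ r)%:R|
  <= #|Fd F p d|%:R * (q ^ (r %/ 3) * q ^ (r %/ 3) + r * (2 * q ^ (r %/ 2)))%:R.
Proof.
move=> s0; under eq_bigr do under eq_bigr do under eq_bigr do rewrite -mulNr.
rewrite pairE (bigID (fun z => mp z.1 == mp z.2)) /=.
have -> : \sum_(z : K * K | mp z.1 == mp z.2) \sum_(a in Fd F p d)
     psi (s * evtr p iota z.1 (poly_of a) + - s * evtr p iota z.2 (poly_of a)) =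
    #|Fd F p d|%:R * (\sum_(x : K) period F x)%:R.
  transitivity (\sum_(z : K * K | mp z.1 == mp z.2) (#|Fd F p d|%:R : R[i])).
    apply: eq_bigr => z /eqP C; under eq_bigr => a _.
      rewrite (evtr_minp (p_pr := p_pr) (n0 := n0) (r0 := r0) (cardF := cardF) (cardK := cardK) _ C).
      rewrite mulNr subrr psi0.
      over.
    by rewrite sumr_const.
  rewrite sumr_const -[LHS]mulr_natr; congr (_ * _%:R).
  rewrite -sum1_card -(pair_big_dep xpredT (fun x y => mp x == mp y) (fun _ _ => 1%N)) /=.
  apply: eq_bigr => x _; rewrite sum1_card -(card_minp_eq iota p_pr n0 r0 cardF cardK x) -cardsE.
  by congr #|pred_of_set _|; apply/finset.setP => y; rewrite !inE eq_sym.
rewrite addrAC -mulrBr; apply: (le_trans (ler_normD _ _)).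
rewrite [X in _ <= _ * X]natrD [leRHS]mulrDr [leLHS]addrC; apply: lerD.
  rewrite big_mkcond; apply: (@sum_psi_bound (K * K)%type (fun z => z \in Z)) => [|z|z].
  - by rewrite (_ : finset _ = Z)//; apply/finset.setP => z; rewrite !inE.
  - by case: ifP => _; [exact: norm_sum_psi|rewrite normr0].
  - by move=> nZ; case: ifP => // nC; apply: not_conjugate; rewrite ?oppr_eq0.
rewrite normrM ger0_norm// ler_wpM2l//.
have eqr : (\sum_(x : K) r = r * q ^ r)%N by rewrite sum_nat_const cardK mulnC.
have sub : (r * q ^ r - \sum_(x : K) period F x <= r * (2 * q ^ (r %/ 2)))%N.
  rewrite -eqr -sumnB; last by move=> x _; exact: (period_le r0 cardK).
  apply: (@leq_trans (\sum_(x in [set x : K | (period F x < r)%N]) r)).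
    rewrite [X in (_ <= X)%N]big_mkcond; apply: leq_sum => x _; rewrite inE.
    case: ltnP => h; first exact: leq_subr.
    by rewrite leqn0 subn_eq0.
  rewrite sum_nat_const mulnC leq_mul2l; apply/orP; right.
  case: (ltnP 1 r) => r1; first exact: (card_short_period p_pr n0 r0 cardF cardK r1).
  rewrite (_ : finset _ = finset.set0) ?cards0//; apply/finset.setP => x; rewrite !inE.
  by apply/negbTE; rewrite -leqNgt (leq_trans r1)// period_gt0.
have le : (\sum_(x : K) period F x <= r * q ^ r)%N.
  by rewrite -eqr; apply: leq_sum => x _; exact: (period_le r0 cardK).
by rewrite distrC -natrB// ger0_norm// ler_nat.
Qed.

End SameDegree.
End Averages.
End AdditiveCharacter.

(** [normalised_zeros] says something about degree [r] only through a field of that degree, so one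
    must be exhibited: the splitting field of X^(q^r) - X, shown to consist exactly of the roots. *)
Lemma finField_extension (p n r : nat) (F : finFieldType) :
  prime p -> (0 < n)%N -> (0 < r)%N -> #|F| = (p ^ n)%N ->
  exists (K : finFieldType) (iota : {rmorphism F -> K}), #|K| = (#|F| ^ r)%N.
Proof.
move=> p_pr n0 r0 cardF; have q1 : (1 < #|F|)%N by apply: finNzRing_gt1.
pose m := (#|F| ^ r)%N.
have m1 : (1 < m)%N by rewrite /m -(exp1n r) ltn_exp2r.
pose P (R : nzRingType) : {poly R} := 'X^m - 'X.
have sizeP (R : nzRingType) : size (P R) = m.+1.
  by rewrite /P size_polyDl size_polyXn// size_polyN size_polyX ltnS.
have PF0 : P F != 0 by rewrite -size_poly_eq0 sizeP.
have [L splitL] := FinSplittingFieldFor PF0.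
have mP : map_poly (in_alg L) (P F) = P L.
  by rewrite /P rmorphB /= map_polyXn map_polyX.
rewrite /= mP in splitL; have [zs Pzs defL] := splitL.
pose K : finFieldType := FinFieldExtType L.
exists K; exists (in_alg L : {rmorphism F -> L}).
have [a _ Da] := finField_galois_generator (sub1v {:L}).
rewrite /= dimv1 expn1 in Da.
have frob_iter k (x : L) : (a ^+ k)%g x = x ^+ (#|F| ^ k).
  elim: k x => [|k IH] x; first by rewrite gal_id expr1.
  by rewrite expgSr galM ?memvf// IH Da ?memvf// -exprM -expnSr.
have zsP z : (z \in zs) = (z ^+ m == z).
  by rewrite -root_prod_XsubC -(eqp_root Pzs) /root !hornerE subr_eq0.
pose E := fixedSpace (a ^+ r)%g.
(* The roots generate [L] and are fixed by the r-th power of Frobenius, so that automorphism fixes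
   all of [L] and every element is a root. *)
have defE : E = {:L}%VS.
  apply/eqP; rewrite eqEsubv subvf -defL -[E]subfield_closed agenvS//.
  rewrite subv_add sub1v; apply/span_subvP => z; rewrite zsP => /eqP zm.
  by apply/fixedSpaceP; rewrite frob_iter.
have pow (x : L) : x ^+ m = x.
  by rewrite -[RHS](fixedSpaceP (_ : x \in E)) ?frob_iter// defE memvf.
have mL : m%:R = 0 :> L.
  have pF := card_finPcharP cardF p_pr.
  have pL : p \in [pchar L] by rewrite pchar_lalg.
  by apply/eqP; rewrite -(dvdn_pcharf pL) /m cardF -expnM dvdn_exp// muln_gt0 n0.
(* The derivative of X^m - X is -1 because m is 0 in [L]; the roots are therefore simple. *)
have uzs : uniq zs.
  rewrite -separable_prod_XsubC -(eqp_separable Pzs) unlock /P.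
  rewrite derivB derivXn derivX -scaler_nat mL scale0r sub0r.
  by rewrite -[X in coprimep _ X]scaleN1r coprimepZr ?oppr_eq0 ?oner_eq0// coprimep1.
have szs : size zs = m.
  apply: succn_inj; rewrite -(size_prod_XsubC _ id).
  by rewrite -(eqp_size Pzs) sizeP.
rewrite -/m -szs; suff /eq_card -> : K =i (zs : seq K) by apply/card_uniqP.
by move=> x; rewrite [RHS]zsP pow eqxx.
Qed.

(** * Complex components, unit exponentials and power sums *)

Section Expi.
Variable R : realType.
Implicit Types (x y : R) (z : R[i]).

Lemma RecD z1 z2 : Rec (z1 + z2) = Rec z1 + Rec z2.
Proof. by case: z1 z2 => a b [c d]. Qed.

Lemma ImcD z1 z2 : Imc (z1 + z2) = Imc z1 + Imc z2.
Proof. by case: z1 z2 => a b [c d]. Qed.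

Lemma RecN z : Rec (- z) = - Rec z.
Proof. by case: z. Qed.

Lemma ImcN z : Imc (- z) = - Imc z.
Proof. by case: z. Qed.

Lemma Rec_sum (I : Type) (s : seq I) (P : pred I) (f : I -> R[i]) :
  Rec (\sum_(i <- s | P i) f i) = \sum_(i <- s | P i) Rec (f i).
Proof. exact: (big_morph (@Rec R) RecD). Qed.

Lemma Imc_sum (I : Type) (s : seq I) (P : pred I) (f : I -> R[i]) :
  Imc (\sum_(i <- s | P i) f i) = \sum_(i <- s | P i) Imc (f i).
Proof. exact: (big_morph (@Imc R) ImcD). Qed.

Lemma RecZ x z : Rec (x%:C * z) = x * Rec z.
Proof. by case: z => a b /=; rewrite mul0r subr0. Qed.

Lemma ImcZ x z : Imc (x%:C * z) = x * Imc z.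
Proof. by case: z => a b /=; rewrite mul0r addr0. Qed.

Lemma norm_RecImc z : `|z| <= (`|Rec z| + `|Imc z|)%:C.
Proof.
case: z => a b /=; rewrite normc_def lecR /=.
rewrite -[leRHS]ger0_norm ?addr_ge0// -sqrtr_sqr ler_wsqrtr//.
rewrite sqrrD !real_normK ?num_real//.
by rewrite addrAC lerDl mulrn_wge0// mulr_ge0.
Qed.

Lemma Rec_le_norm z (e : R) : `|z| <= e%:C -> `|Rec z| <= e.
Proof.
case: z => a b /=; rewrite normc_def lecR /=; apply: le_trans.
by rewrite -sqrtr_sqr ler_wsqrtr// lerDl sqr_ge0.
Qed.

Lemma Imc_le_norm z (e : R) : `|z| <= e%:C -> `|Imc z| <= e.
Proof.
case: z => a b /=; rewrite normc_def lecR /=; apply: le_trans.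
by rewrite -sqrtr_sqr ler_wsqrtr// lerDr sqr_ge0.
Qed.

Lemma expi0 : expi (0 : R) = 1.
Proof. by rewrite /expi cos0 sin0. Qed.

Lemma expiD x y : expi (x + y) = expi x * expi y.
Proof. by rewrite /expi cosD sinD; apply/eqP; rewrite eq_complex /= eqxx addrC eqxx. Qed.

Lemma expiMn x n : expi x ^+ n = expi (n%:R * x).
Proof.
elim: n => [|n IH]; first by rewrite mul0r expi0.
by rewrite exprS IH -expiD -natr1 mulrDl mul1r addrC.
Qed.

Lemma expi_conj x : (expi x)^* = expi (- x).
Proof. by rewrite /expi cosN sinN. Qed.

Lemma conjc_scale x z : (- x%:C * z)^* = - x%:C * z^*.
Proof.
by case: z => a b; apply/eqP; rewrite eq_complex /=; apply/andP; split; apply/eqP; ring.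
Qed.

Lemma expi_norm x : `|expi x| = 1.
Proof. by rewrite /expi normc_def /= cos2Dsin2 sqrtr1. Qed.

Definition tsum (ths : seq R) (k : int) : R[i] := \sum_(t <- ths) expi (k%:~R * t).

Lemma tsum0 ths : tsum ths 0 = (size ths)%:R.
Proof.
rewrite /tsum; under eq_bigr do rewrite mul0r expi0.
by rewrite big_const_seq count_predT iter_addr addr0.
Qed.

Lemma tsumN ths k : tsum ths (- k) = (tsum ths k)^*.
Proof.
rewrite /tsum rmorph_sum /=; apply: eq_bigr => t _.
by rewrite mulrNz mulNr -expi_conj.
Qed.

End Expi.

(** * Averages of power sums of the zeroes *)

Section Averages.
Variables (R : realType) (p n : nat) (F : finFieldType) (psi : 'F_p -> R[i]).
Hypotheses (p_pr : prime p) (p2 : (2 < p)%N) (n0 : (0 < n)%N) (cardF : #|F| = (p ^ n)%N).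
Hypotheses (psiA : add_char psi) (psi_nt : exists x, psi x != 1).
Variables (d : nat) (theta : {ffun 'I_d.+1 -> F} -> seq R).
Hypothesis dp : coprime d p.
Hypothesis zeros : forall a, a \in Fd F p d ->
  size (theta a) = d.-1 /\ normalised_zeros psi (poly_of a) (theta a).
Local Notation q := #|F|.

Definition avg (f : {ffun 'I_d.+1 -> F} -> R[i]) : R[i] :=
  (#|Fd F p d|%:R)^-1 * \sum_(a in Fd F p d) f a.

Let q3 : (3 <= q)%N.
Proof.
rewrite cardF; apply: (leq_trans p2); rewrite -{1}[p]expn1.
by rewrite leq_pexp2l// prime_gt0.
Qed.

Let x : R := Num.sqrt q%:R.
Let x0 : 0 < x. Proof. by rewrite sqrtr_gt0 ltr0n (leq_trans _ q3). Qed.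
Let xx : x ^+ 2 = q%:R. Proof. by rewrite sqr_sqrtr. Qed.
(* 84/100 exceeds 3 ^ (-1/6), so that [x^-1 <= rho ^+ 3] for all [q >= 3]. *)
Let rho : R := 84 / 100.

(** As x^2 = q, the quotient is x^-(b - 2a), and 3(b - 2a) >= b; each factor x^-1 is at most
    [rho ^+ 3]. *)
Lemma weight_le a b : (3 * a <= b)%N -> (q ^ a)%N%:R / x ^+ b <= rho ^+ b.
Proof.
move=> ab; have rho0 : 0 <= rho by rewrite /rho; lra.
have rho1 : rho <= 1 by rewrite /rho; lra.
have xr : 1 <= x * rho ^+ 3.
  rewrite -(@ler_pXn2r _ 2) ?nnegrE// ?mulr_ge0 ?exprn_ge0 ?(ltW x0)//.
  rewrite expr1n exprMn xx; have : 3 <= q%:R :> R by rewrite ler_nat.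
  by rewrite /rho; nra.
have ba : (b = 2 * a + (b - 2 * a))%N by rewrite subnKC//; lia.
rewrite ba exprD exprM xx natrX invfM mulrA mulfV ?mul1r; last first.
  by rewrite expf_neq0// pnatr_eq0 -lt0n (leq_trans _ q3).
apply: (@le_trans _ _ (rho ^+ (3 * (b - 2 * a)))).
  rewrite -[leLHS]mul1r ler_pdivrMr ?exprn_gt0// exprM -exprMn mulrC.
  by rewrite -[leLHS](expr1n _ (b - 2 * a)); apply: lerXn2r; rewrite ?nnegrE ?mulr_ge0 ?exprn_ge0 ?(ltW x0).
by apply: ler_wiXn2l => //; lia.
Qed.

Hypothesis Fd_gt0 : (0 < #|Fd F p d|)%N.

Let sg (k : int) : 'F_p := if (0 <= k)%R then 1 else - 1.

Let sg0 k : sg k != 0.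
Proof. by rewrite /sg; case: ifP; rewrite ?oppr_eq0 oner_eq0. Qed.

(** For negative [k] the power sum is the conjugate of the one at |k|, because the zeroes lie on the
    unit circle; conjugation negates the argument of [psi], which is the role of [sg]. *)
Lemma tsum_exponential (k : int) (K : finFieldType) (iota : {rmorphism F -> K}) a :
  k != 0 -> #|K| = (q ^ `|k|)%N -> a \in Fd F p d ->
  tsum (theta a) k = - ((x ^+ `|k|)^-1)%:C *
     \sum_y psi (sg k * evtr p iota y (poly_of a)).
Proof.
move=> k0 cK /zeros[_ nz].
have r0 : (0 < `|k|)%N by rewrite absz_gt0.
have xk : (x ^+ `|k|)%:C != 0 by rewrite (inj_eq (@complexI R)) expf_neq0// gt_eqF.
have pos : tsum (theta a) `|k|%:Z = - ((x ^+ `|k|)^-1)%:C *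
     \sum_y psi (evtr p iota y (poly_of a)).
  have := nz _ r0 K iota cK; rewrite /Ssum => ->.
  rewrite mulrNN mulr_sumr; apply: eq_bigr => t _.
  rewrite exprMn expiMn -rmorphXn mulrA -rmorphM mulVf ?mul1r//.
  by rewrite expf_neq0// gt_eqF.
rewrite /sg; case: ifP => ks.
  have {1}-> : k = `|k|%:Z by rewrite abszE ger0_norm.
  by rewrite pos; congr (_ * _); apply: eq_bigr => y _; rewrite mul1r.
have {1}-> : k = - `|k|%:Z by rewrite abszE ltr0_norm ?opprK// ltNge ks.
rewrite tsumN pos conjc_scale; congr (_ * _).
rewrite rmorph_sum; apply: eq_bigr => y _.
by rewrite mulN1r -(psi_conj p_pr psiA).
Qed.

Lemma avg_scale (f : {ffun 'I_d.+1 -> F} -> R[i]) (h : {ffun 'I_d.+1 -> F} -> R[i]) (w : R) (M k : nat) :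
  0 < w ->
  (forall a, a \in Fd F p d -> f a = (w^-1)%:C * h a) ->
  `|\sum_(a in Fd F p d) h a - #|Fd F p d|%:R * k%:R| <= #|Fd F p d|%:R * M%:R ->
  `|avg f - (k%:R / w)%:C| <= (M%:R / w)%:C.
Proof.
move=> w0 fh hM; have nz : #|Fd F p d|%:R != 0 :> R[i] by rewrite pnatr_eq0 -lt0n.
have wC0 : 0 <= (w^-1)%:C :> R[i] by rewrite lecR invr_ge0 ltW.
have -> : avg f - (k%:R / w)%:C =
    (w^-1)%:C * ((#|Fd F p d|%:R)^-1 * (\sum_(a in Fd F p d) h a - #|Fd F p d|%:R * k%:R)).
  rewrite mulrBr mulKf// mulrBr /avg (eq_bigr _ fh) -mulr_sumr mulrCA; congr (_ - _).
  by rewrite mulrC rmorphM /= rmorph_nat.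
rewrite normrM ger0_norm// [leRHS](_ : _ = (w^-1)%:C * M%:R); last first.
  by rewrite mulrC rmorphM /= rmorph_nat.
apply: ler_wpM2l => //; rewrite normrM ger0_norm ?invr_ge0 ?ler0n//.
by rewrite ler_pdivrMl ?ltr0n.
Qed.

Lemma avg_tsum (k : int) : k != 0 -> (`|k| < d)%N ->
  `|avg (fun a => tsum (theta a) k)| <= (rho ^+ `|k|)%:C.
Proof.
move=> k0 kd; have r0 : (0 < `|k|)%N by rewrite absz_gt0.
have [K [iota cK]] := finField_extension p_pr n0 r0 cardF.
have h := single_average p_pr psiA psi_nt p2 n0 cardF iota r0 cK (sg0 k) kd.
have := @avg_scale (fun a => - tsum (theta a) k) _ (x ^+ `|k|) (q ^ (`|k| %/ 3)) 0
   (exprn_gt0 _ x0) _ _.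
move=> /(_ (fun a => \sum_y psi (sg k * evtr p iota y (poly_of a)))).
rewrite mul0r subr0 mulr0 subr0 => /(_ _ h) hh.
have -> : avg (fun a => tsum (theta a) k) = - avg (fun a => - tsum (theta a) k).
  by rewrite /avg sumrN mulrN opprK.
rewrite normrN; apply: le_trans (hh _) _.
  by move=> a aF; rewrite (tsum_exponential iota k0 cK aF) mulNr opprK.
by rewrite lecR weight_le// mulnC leq_trunc_div.
Qed.

(** The cases |k| != |l|, l = -k and l = k use the three pair averages. In the bound, 1 accounts for
    degenerate pairs and the linear term for conjugates in a common subfield or points of short
    period. *)
Lemma avg_tsum_pair (k l : int) : k != 0 -> l != 0 -> (`|k| + `|l| < d)%N ->
  `|avg (fun a => tsum (theta a) k * tsum (theta a) l) - (if k + l == 0 then `|k|%:R else 0)|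
  <= ((1 + 2 * (`|k| + `|l|)%N%:R) * rho ^+ (`|k| + `|l|))%:C.
Proof.
move=> k0 l0 kld.
have r0 : (0 < `|k|)%N by rewrite absz_gt0.
have r0' : (0 < `|l|)%N by rewrite absz_gt0.
have rho0 : 0 <= rho by rewrite /rho; lra.
have w0 : 0 < x ^+ (`|k| + `|l|) by rewrite exprn_gt0.
have prodE (K K' : finFieldType) (i : {rmorphism F -> K}) (i' : {rmorphism F -> K'}) a :
    #|K| = (q ^ `|k|)%N -> #|K'| = (q ^ `|l|)%N -> a \in Fd F p d ->
    tsum (theta a) k * tsum (theta a) l = ((x ^+ (`|k| + `|l|))^-1)%:C *
      \sum_y \sum_z psi (sg k * evtr p i y (poly_of a) + sg l * evtr p i' z (poly_of a)).
  move=> cK cK' aF; rewrite (tsum_exponential i k0 cK aF).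
  rewrite (tsum_exponential i' l0 cK' aF).
  rewrite mulrACA mulrNN -rmorphM -invfM -exprD; congr (_ * _).
  rewrite big_distrlr /=; apply: eq_bigr => y _; apply: eq_bigr => z _.
  by rewrite (psiD psiA).
have [K [i cK]] := finField_extension p_pr n0 r0 cardF.
have [klE|klN] := eqVneq `|k|%N `|l|%N; last first.
  have [K' [i' cK']] := finField_extension p_pr n0 r0' cardF.
  have h := pair_average_diff p_pr psiA psi_nt p2 n0 cardF i i' r0 r0' klN kld cK cK' (sg0 k) (sg0 l).
  have -> : (k + l == 0) = false.
    by apply/negP => /eqP kl; move: klN; rewrite (_ : l = - k) ?abszN ?eqxx//; lia.
  have := avg_scale (f := fun a => tsum (theta a) k * tsum (theta a) l) (k := 0) w0
    (fun a => prodE K K' i i' a cK cK').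
  rewrite mulr0 subr0 => /(_ _ h); rewrite mul0r => /le_trans; apply.
  rewrite lecR natrD mulrDl mulrDl mul1r; apply: lerD.
    by rewrite -expnD weight_le// mulnDr leq_add// mulnC leq_trunc_div.
  rewrite natrM -mulrA; apply: ler_pM => //.
    by rewrite divr_ge0// ltW.
    rewrite -natrM ler_nat (leq_trans (dvdn_leq r0 (dvdn_gcdl _ _)))//.
    by rewrite mulSn mul1n -addnA leq_addr.
  rewrite weight_le//.
  (* With |k| = u g, |l| = v g and u != v positive, u + v is at least 3, so q^g meets the hypothesis
     3g <= |k| + |l| of [weight_le]. *)
  have /dvdnP[u ku] := dvdn_gcdl `|k| `|l|.
  have /dvdnP[v lv] := dvdn_gcdr `|k| `|l|.
  move: ku lv klN r0 r0'; move: (gcdn `|k| `|l|) => g -> -> ne u0 v0.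
  rewrite -mulnDl leq_mul2r; apply/orP; right.
  by move: u0 v0 ne; rewrite !muln_gt0; case: u v => [|[|u]] [|[|v]] //=; rewrite ?eqxx//; lia.
have cK' : #|K| = (q ^ `|l|)%N by rewrite -klE.
have kkd : (`|k| + `|k| < d)%N by rewrite {2}klE.
have [kl|kl] := eqVneq (k + l) 0.
  have sgl : sg l = - sg k.
    by rewrite /sg; case: ifP => hl; case: ifP => hk; rewrite ?opprK//; exfalso; lia.
  have h := pair_average_diagonal p_pr psiA psi_nt p2 n0 cardF i r0 kkd cK (sg0 k).
  have hh : `|\sum_(a in Fd F p d) \sum_y \sum_z
      psi (sg k * evtr p i y (poly_of a) + sg l * evtr p i z (poly_of a))
      - #|Fd F p d|%:R * (`|k| * q ^ `|k|)%N%:R|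
      <= #|Fd F p d|%:R * (q ^ (`|k| %/ 3) * q ^ (`|k| %/ 3) + `|k| * (2 * q ^ (`|k| %/ 2)))%N%:R.
    apply: le_trans h; rewrite le_eqVlt; apply/orP; left; apply/eqP; congr `|_ - _|.
    apply: eq_bigr => a _; apply: eq_bigr => y _; apply: eq_bigr => z _.
    by rewrite sgl mulNr.
  have := avg_scale (f := fun a => tsum (theta a) k * tsum (theta a) l) w0
    (fun a => prodE K K i i a cK cK') hh.
  have -> : (`|k| * q ^ `|k|)%N%:R / x ^+ (`|k| + `|l|) = `|k|%:R :> R.
    rewrite -klE addnn -mul2n exprM xx -natrX natrM mulfK// pnatr_eq0 -lt0n.
    by rewrite expn_gt0 (leq_trans _ q3).
  rewrite rmorph_nat => /le_trans; apply.
  rewrite lecR natrD mulrDl mulrDl mul1r -klE; apply: lerD.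
    by rewrite -expnD weight_le// mulnDr leq_add// mulnC leq_trunc_div.
  rewrite mulnA natrM -mulrA; apply: ler_pM => //.
  - by rewrite divr_ge0// exprn_ge0// ltW.
  - by rewrite -natrM ler_nat; lia.
  - by apply: weight_le; have := leq_trunc_div `|k| 2; lia.
have h := pair_average_same p_pr psiA psi_nt p2 n0 cardF i r0 kkd cK (sg0 k) (sg0 l).
(* Equal signs sum to plus or minus 2, nonzero because [p > 2]. *)
have ss : sg k + sg l != 0.
  have -> : sg l = sg k.
    by rewrite /sg; case: ifP => hl; case: ifP => hk //; exfalso; lia.
  rewrite -mulr2n -mulr_natr mulf_neq0//.
  by rewrite -(dvdn_pcharf (pchar_Fp p_pr)) gtnNdvd.
have := avg_scale (f := fun a => tsum (theta a) k * tsum (theta a) l) (k := 0) w0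
    (fun a => prodE K K i i a cK cK').
rewrite mulr0 subr0 => /(_ _ (h ss)); rewrite mul0r => /le_trans; apply.
rewrite lecR mulrDl mul1r -[leLHS]addr0; apply: lerD.
  by rewrite -klE -expnD weight_le// mulnDr leq_add// mulnC leq_trunc_div.
by rewrite !mulr_ge0// exprn_ge0.
Qed.

Definition pair_average (k l : int) : R[i] :=
  avg (fun a => tsum (theta a) k * tsum (theta a) l - tsum (theta a) (k + l)).

Definition pair_model (N : nat) (k l : int) : R :=
  (if (k == 0) && (l == 0) then N%:R ^+ 2 else 0)
  - (if k + l == 0 then N%:R - `|k|%:R else 0).

Lemma avgB f g : avg (fun a => f a - g a) = avg f - avg g.
Proof. by rewrite /avg sumrB mulrBr. Qed.

Lemma avgZ f (z : R[i]) : avg (fun a => z * f a) = z * avg f.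
Proof. by rewrite /avg -mulr_sumr mulrCA. Qed.

Lemma avg_cst f (z : R[i]) : (forall a, a \in Fd F p d -> f a = z) -> avg f = z.
Proof.
move=> fz; rewrite /avg (eq_bigr _ fz) sumr_const -[z *+ _]mulr_natl mulKf//.
by rewrite pnatr_eq0 -lt0n.
Qed.

Lemma avg_eq f g : (forall a, a \in Fd F p d -> f a = g a) -> avg f = avg g.
Proof. by move=> fg; rewrite /avg (eq_bigr _ fg). Qed.

(** A zero index is treated apart: its power sum is exactly [d.-1], leaving a single power sum to
    average. The factor [3 * d.-1] covers all cases. *)
Lemma pair_average_model (k l : int) : (0 < d)%N -> (`|k| + `|l| <= d.-1)%N ->
  `|pair_average k l - (pair_model d.-1 k l)%:C| <=
  (rho ^+ `|k + l| + 3 * (d.-1)%:R * rho ^+ (`|k| + `|l|))%:C.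
Proof.
move=> d0 kl.
have kld : (`|k| + `|l| < d)%N by rewrite -(prednK d0) ltnS.
have rho0 : 0 <= rho by rewrite /rho; lra.
have rk j : 0 <= rho ^+ j by exact: exprn_ge0.
have t0 : avg (fun a => tsum (theta a) 0) = (d.-1)%:R.
  by apply: avg_cst => a /zeros[sz _]; rewrite tsum0 sz.
have one_zero (j : int) : j != 0 -> (`|j| < d)%N ->
    `|(d.-1)%:R * avg (fun a => tsum (theta a) j) - avg (fun a => tsum (theta a) j)|
    <= (rho ^+ `|j| + 3 * (d.-1)%:R * rho ^+ `|j|)%:C.
  move=> j0 jd; apply: le_trans (ler_normB _ _) _.
  rewrite normrM ger0_norm// addrC rmorphD; apply: lerD; first exact: avg_tsum.
  apply: (@le_trans _ _ ((d.-1)%:R * (rho ^+ `|j|)%:C)).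
    by apply: ler_wpM2l => //; exact: avg_tsum.
  rewrite -(rmorph_nat (@real_complex R)) -rmorphM lecR.
  by rewrite -mulrA ler_peMl// ?mulr_ge0//; lra.
rewrite /pair_average /pair_model avgB.
have [k0|k0] /= := eqVneq k 0.
  have -> : avg (fun a => tsum (theta a) k * tsum (theta a) l) =
      (d.-1)%:R * avg (fun a => tsum (theta a) l).
    rewrite -avgZ; apply: avg_eq => a /zeros[sz _].
    by rewrite k0 tsum0 sz.
  rewrite k0 !add0r absz0 add0n; have [l0|l0] := eqVneq l 0.
    rewrite l0 t0 subr0 rmorphB rmorphXn /= rmorph_nat expr2 subrr normr0.
    by rewrite lecR addr_ge0// !mulr_ge0.
  rewrite subr0 subr0; apply: one_zero => //.
  by apply: leq_ltn_trans kld; rewrite leq_addl.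
have [l0|l0] := eqVneq l 0.
  have -> : avg (fun a => tsum (theta a) k * tsum (theta a) l) =
      (d.-1)%:R * avg (fun a => tsum (theta a) k).
    rewrite -avgZ; apply: avg_eq => a /zeros[sz _].
    by rewrite l0 tsum0 sz mulrC.
  rewrite l0 !addr0 absz0 addn0 (negbTE k0) subr0 subr0; apply: one_zero => //.
  by apply: leq_ltn_trans kld; rewrite leq_addr.
have pairb := avg_tsum_pair k0 l0 kld.
(* With m = |k| + |l| >= 1, the factor 1 + 2m is at most 3m, and m <= d - 1. *)
have N1 : (1 + 2 * (`|k| + `|l|)%N%:R) <= 3 * (d.-1)%:R :> R.
  have : (`|k| + `|l|)%N%:R <= (d.-1)%:R :> R by rewrite ler_nat.
  have : 1 <= (`|k| + `|l|)%N%:R :> R by rewrite ler1n addn_gt0 absz_gt0 k0.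
  by lra.
have pairb' : ((1 + 2 * (`|k| + `|l|)%N%:R) * rho ^+ (`|k| + `|l|))%:C
    <= (3 * (d.-1)%:R * rho ^+ (`|k| + `|l|))%:C :> R[i].
  by rewrite lecR ler_wpM2r.
have [kl0|kl0] := eqVneq (k + l) 0.
  rewrite kl0 t0; move: pairb; rewrite kl0 eqxx => pairb.
  have -> : avg (fun a => tsum (theta a) k * tsum (theta a) l) - (d.-1)%:R
      - (0 - ((d.-1)%:R - `|k|%:R))%:C =
     avg (fun a => tsum (theta a) k * tsum (theta a) l) - `|k|%:R.
    by rewrite sub0r rmorphN rmorphB /= !rmorph_nat opprK addrA subrK.
  apply: le_trans pairb (le_trans pairb' _).
  by rewrite lecR lerDr.
move: pairb; rewrite (negbTE kl0) subr0 !subr0 => pairb.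
apply: le_trans (ler_normB _ _) _; rewrite addrC rmorphD; apply: lerD.
  by apply: avg_tsum => //; apply: leq_ltn_trans kld; lia.
exact: le_trans pairb pairb'.
Qed.

End Averages.

(** * Spectral expansion of the pair sum *)

Section GeometricSums.
Variables (R : realType) (r : R).
Hypothesis r01 : 0 <= r < 1.

(** A bound independent of [M] and of the peak [c]. The term [r ^+ c.+1] is kept so that induction
    on [c] closes: moving the peak by one adds exactly one boundary term. *)
Lemma geometric_distance_sum (M c : nat) :
  (\sum_(j < M) r ^+ `|j%:Z - c%:Z|%N) * (1 - r) <= 1 + (r - r ^+ c.+1).
Proof.
have /andP[r0 r1] := r01.
have rX k : 0 <= r ^+ k <= 1 by rewrite exprn_ge0// exprn_ile1// ltW.
elim: c M => [|c IH] M.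
  have -> : \sum_(j < M) r ^+ `|j%:Z - 0%:Z|%N = \sum_(j < M) r ^+ j.
    by apply: eq_bigr => j _; rewrite subr0.
  rewrite mulrC -opprB mulNr -subrX1 expr1 subrr addr0 opprB lerBlDr lerDl.
  by case/andP: (rX M).
case: M => [|M].
  rewrite big_ord0 mul0r; have /andP[_ h] := rX c.+1; rewrite exprS.
  by have /andP[h0 _] := rX c.+1; nra.
have h0 : r ^+ `|((@ord0 M : 'I_M.+1) : nat)%:Z - c.+1%:Z|%N = r ^+ c.+1 by congr (_ ^+ _); rewrite /=; lia.
rewrite big_ord_recl h0 mulrDl /=.
have -> : \sum_(i < M) r ^+ `|(bump 0 i)%:Z - c.+1%:Z|%N = \sum_(i < M) r ^+ `|i%:Z - c%:Z|%N.
  by apply: eq_bigr => i _; congr (_ ^+ _); rewrite /bump leq0n add1n; lia.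
apply: (le_trans (lerD (lexx _) (IH M))).
by rewrite [r ^+ c.+2]exprS; lra.
Qed.

Lemma geometric_distance_sum_le (M c : nat) :
  \sum_(j < M) r ^+ `|j%:Z - c%:Z|%N <= 2 / (1 - r).
Proof.
have /andP[r0 r1] := r01.
rewrite ler_pdivlMr ?subr_gt0//; apply: le_trans (geometric_distance_sum _ _) _.
have h : 0 <= r ^+ c.+1 by exact: exprn_ge0.
by lra.
Qed.

End GeometricSums.

Section PairSums.
Variable R : realType.

Definition pairsum (ths : seq R) (th : R) (k l : int) : R[i] :=
  \sum_(j < size ths) \sum_(m < size ths | j != m)
    expi (k%:~R * (ths`_j - th) + l%:~R * (ths`_m - th)).

Lemma pairsumE ths th k l : pairsum ths th k l =
  expi (- ((k + l)%:~R * th)) * (tsum ths k * tsum ths l - tsum ths (k + l)).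
Proof.
have nthE (h : R -> R[i]) : \sum_(t <- ths) h t = \sum_(j < size ths) h ths`_j.
  by rewrite (big_nth 0) big_mkord.
rewrite /tsum !nthE big_distrlr /= -sumrB mulr_sumr; apply: eq_bigr => j _.
rewrite [in RHS](bigD1 j)//= -expiD -mulrDl -intrD addrAC subrr add0r mulr_sumr.
apply: eq_big => m; first by rewrite eq_sym.
by move=> _; rewrite -!expiD; congr expi; rewrite intrD; ring.
Qed.

End PairSums.

Section Expansion.
Variable R : realType.
Local Open Scope classical_set_scope.
Local Notation mu2 := ((@lebesgue_measure R) \x (@lebesgue_measure R))%E.
Variables (g : R -> R -> R) (K : R).
Hypothesis gc : continuous (fun z : R * R => g z.1 z.2).
Hypothesis gK : forall x y, `|g x y| <= K * (decay 0 1 x * decay 0 1 y).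
Hypothesis band : forall a b : R, 1 < `|a| + `|b| ->
  int2 (fun x y => g x y * cos (a * x + b * y)) = 0 /\
  int2 (fun x y => g x y * sin (a * x + b * y)) = 0.

Definition massg : R := \int[mu2]_z `|g z.1 z.2|.

Lemma coscoef_le a b e : `|coscoef g a b e| <= massg.
Proof.
have ic := integrable_cos gc gK a b e.
apply: le_trans (le_normr_Rintegral measurableT ic) _.
apply: le_Rintegral => //.
- exact: (integrable_norm ic).
- exact: (integrable_norm (integrable_plane gc gK)).
- by move=> z _; rewrite normrM ler_piMr// cos_max.
Qed.

Definition S2r (c : R) (ths : seq R) (th : R) : R :=
  \sum_(j < size ths) \sum_(k < size ths | j != k)
    limn (psum g c (ths`_j - th) (ths`_k - th)).

Variable N : nat.
Hypothesis N1 : (0 < N)%N.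
Let c : R := N%:R.
Let P : R := 2 * pi * c.

Let C (k l : int) : R := coscoef g (- (k%:~R / c)) (- (l%:~R / c)) 0.
(* The sine coefficients, as cos (u - pi / 2) = sin u. *)
Let S (k l : int) : R := coscoef g (- (k%:~R / c)) (- (l%:~R / c)) (- (pi / 2)).

(** Linear in an arbitrary coefficient array, so that pair sums, their averages and the model can
    all be compared within it. The minus sign is the one in [cos (e + w) = cos e * cos w - sin e *
    sin w]. *)
Definition spectral (A : int -> int -> R[i]) : R :=
  (P * P)^-1 * \sum_(i < N.*2.+1) \sum_(j < N.*2.+1)
    (Rec (A (i%:Z - N%:Z) (j%:Z - N%:Z)) * C (i%:Z - N%:Z) (j%:Z - N%:Z)
     - Imc (A (i%:Z - N%:Z) (j%:Z - N%:Z)) * S (i%:Z - N%:Z) (j%:Z - N%:Z)).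

Lemma S2r_spectral ths th : S2r c ths th = spectral (pairsum ths th).
Proof.
rewrite /S2r /spectral.
under eq_bigr => j _ do under eq_bigr => k _ do
  rewrite (cvg_lim (@Rhausdorff R) (psum_cvg gc gK band (t := ths`_j - th) (u := ths`_k - th) N1)).
under eq_bigr => j _ do rewrite -mulr_sumr.
rewrite -mulr_sumr; congr (_ * _).
under eq_bigr => j _ do rewrite exchange_big /=.
rewrite exchange_big /=; apply: eq_bigr => i _.
under eq_bigr => j _ do rewrite exchange_big /=.
rewrite exchange_big /=; apply: eq_bigr => i' _.
rewrite /pairsum Rec_sum Imc_sum !mulr_suml -sumrB; apply: eq_bigr => j _.
rewrite Rec_sum Imc_sum !mulr_suml -sumrB; apply: eq_bigr => k _.
by rewrite (coscoefE gc gK).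
Qed.

Let diagonal : R :=
  \int[mu2]_z (g z.1 z.2 * (N%:R^-1 * fejer N ((z.1 - z.2) / N%:R))).

(** The entry at the origin yields the integral of [g]; the antidiagonal, with weights N - |k|,
    regroups into the double sum that defines the Fejer kernel. *)
Lemma spectral_model : spectral (fun k l => (pair_model R N k l)%:C) =
  (4 * pi ^+ 2)^-1 * (\int[mu2]_z g z.1 z.2 - diagonal).
Proof.
have c0 : c != 0 by rewrite pnatr_eq0 -lt0n.
have pi0 : pi != 0 :> R by rewrite gt_eqF// pi_gt0.
have -> : (4 * pi ^+ 2)^-1 = (P * P)^-1 * (c * c).
  by rewrite /P; move: (@pi R) pi0 => w w0; field; rewrite w0 andbT.
rewrite /spectral -mulrA; congr (_ * _).
under eq_bigr do under eq_bigr do rewrite /= mul0r subr0 /pair_model mulrBl.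
under eq_bigr do rewrite sumrB.
rewrite sumrB mulrBr; congr (_ - _).
  have N2 : (N < N.*2.+1)%N by rewrite ltnS -addnn leq_addr.
  rewrite (bigD1 (Ordinal N2))//= [X in _ + X]big1 ?addr0; last first.
    move=> i iN; rewrite big1// => j _.
    rewrite ifF ?mul0r//; apply/negP => /andP[/eqP h _].
    by move: iN; rewrite -val_eqE /= => /eqP; apply; lia.
  rewrite (bigD1 (Ordinal N2))//= [X in _ + X]big1 ?addr0; last first.
    move=> i iN; rewrite ifF ?mul0r//; apply/negP => /andP[_ /eqP h].
    by move: iN; rewrite -val_eqE /= => /eqP; apply; lia.
  rewrite subrr eqxx /= expr2; congr (_ * _); rewrite /C /coscoef.
  apply: eq_Rintegral => z _.
  by rewrite mul0r oppr0 !mul0r !addr0 cos0 mulr1.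
pose phi (k : int) : R := coscoef g (k%:~R / c) (- (k%:~R / c)) 0.
have -> : diagonal = c^-1 * c^-1 * \sum_(k < N) \sum_(l < N) phi (k%:Z - l%:Z).
  rewrite /phi /coscoef.
  under [X in _ = _ * X]eq_bigr => k _.
    rewrite -Rintegral_sum//; last by move=> l; exact: (integrable_cos gc gK).
    over.
  rewrite -Rintegral_sum//; last first.
    by move=> k; apply: integrable_bigsum => // l; exact: (integrable_cos gc gK).
  rewrite -RintegralZl//; last first.
    apply: integrable_bigsum => // k; apply: integrable_bigsum => // l.
    exact: (integrable_cos gc gK).
  apply: eq_Rintegral => z _; rewrite /fejer.
  rewrite [LHS]mulrCA [X in _ * X = _]mulrCA [LHS]mulrA; congr (_ * _).
  rewrite mulr_sumr; apply: eq_bigr => k _; rewrite mulr_sumr; apply: eq_bigr => l _.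
  by congr (_ * cos _); rewrite intrB -!pmulrn; ring.
rewrite mulrA mulrACA mulfV// mul1r mul1r.
rewrite (@difference_sum_sym _ phi N N); last by move=> m h1 h2; lia.
apply: eq_bigr => i _.
have hi : (i <= N.*2)%N by rewrite -ltnS.
(* Reversal sends frequency k = i - N to -k, the only partner on the antidiagonal. *)
rewrite (bigD1 (rev_ord i))//= [X in _ + X]big1 ?addr0; last first.
  move=> j ji; rewrite ifF ?mul0r//; apply/negP => /eqP h.
  by move: ji; rewrite -val_eqE /= => /eqP; apply; lia.
have e : (N.*2.+1 - i.+1)%:Z - N%:Z = - (i%:Z - N%:Z) by lia.
rewrite e subrr eqxx mulrC -[RHS]mulr_natr /phi /C; congr (_ * _).
  rewrite /coscoef; apply: eq_Rintegral => z _; congr (_ * _).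
  by rewrite -[RHS]cosN; congr cos; rewrite mulrNz; ring.
rewrite natrB//; lia.
Qed.

(** With B = 2/(1 - r), the errors in |k + l| contribute at most 3cB over the 2N + 1 rows, the
    decoupled ones 3cB^2, each against two coefficients of size at most [massg]. Division by P^2 = 4
    pi^2 c^2 leaves O(1/c). *)
Lemma spectral_error (A : int -> int -> R[i]) (r : R) : 0 <= r < 1 ->
  (forall k l : int, (`|k| + `|l| <= N)%N ->
    `|A k l - (pair_model R N k l)%:C| <= (r ^+ `|k + l| + 3 * c * r ^+ (`|k| + `|l|))%:C) ->
  `|spectral A - (4 * pi ^+ 2)^-1 * (\int[mu2]_z g z.1 z.2 - diagonal)|
   <= (4 * pi ^+ 2)^-1 * (2 * massg * (3 * (2 / (1 - r)) + 3 * (2 / (1 - r)) ^+ 2)) / c.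
Proof.
move=> r01 hA; have /andP[r0 r1] := r01.
have c0 : 0 < c by rewrite ltr0n.
have pi0 : 0 < pi :> R by exact: pi_gt0.
have P0 : 0 < P by rewrite /P mulr_gt0// mulr_gt0.
have m0 : 0 <= massg by apply: Rintegral_ge0 => z _.
set B := 2 / (1 - r).
have B0 : 0 <= B by rewrite /B divr_ge0// subr_ge0 ltW.
rewrite -spectral_model /spectral -mulrBr normrM [X in X * _]ger0_norm; last first.
  by rewrite invr_ge0 ltW// mulr_gt0.
have -> : (4 * pi ^+ 2)^-1 * (2 * massg * (3 * B + 3 * B ^+ 2)) / c =
  (P * P)^-1 * (2 * massg * (c * (3 * B) + 3 * c * B ^+ 2)).
  move: (gt_eqF pi0) (gt_eqF c0); rewrite /P; move: (@pi R) massg (B) => w m b w0 c1.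
  by field; rewrite c1 w0.
apply: ler_wpM2l; first by rewrite invr_ge0 ltW// mulr_gt0.
rewrite -sumrB; apply: le_trans (ler_norm_sum _ _ _) _.
apply: (@le_trans _ _ (\sum_(i < N.*2.+1) \sum_(j < N.*2.+1)
   2 * massg * (r ^+ `|(i%:Z - N%:Z) + (j%:Z - N%:Z)|
     + 3 * c * (r ^+ `|i%:Z - N%:Z| * r ^+ `|j%:Z - N%:Z|)))).
  apply: ler_sum => i _; rewrite -sumrB; apply: le_trans (ler_norm_sum _ _ _) _.
  apply: ler_sum => j _; set k := i%:Z - N%:Z; set l := j%:Z - N%:Z.
  have E0 : 0 <= r ^+ `|k + l| + 3 * c * (r ^+ `|k| * r ^+ `|l|).
    by rewrite addr_ge0 ?exprn_ge0// mulr_ge0 ?mulr_ge0 ?exprn_ge0// ltW.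
  (* Nothing is assumed on [A] outside the band, but there both Fourier coefficients vanish. *)
  have [kl|kl] := leqP (`|k| + `|l|) N; last first.
    have far e : coscoef g (- (k%:~R / c)) (- (l%:~R / c)) e = 0.
      apply: (coscoef_band gc gK band).
      rewrite !normrN !normrM !normfV [`|c|]gtr0_norm// -mulrDl.
      rewrite ltr_pdivlMr// mul1r -!intr_norm -!abszE.
      by rewrite -!pmulrn -natrD ltr_nat.
    rewrite /C /S !far !mulr0 !subr0 normr0.
    by rewrite !mulr_ge0.
  have h := hA k l kl; rewrite -exprD in E0 *.
  have /= hR := Rec_le_norm h; have /= hI := Imc_le_norm h.
  rewrite RecD RecN /= in hR; rewrite ImcD ImcN /= subr0 in hI.
  rewrite /= mul0r subr0 addrAC -mulrBl.
  apply: le_trans (ler_normB _ _) _; rewrite !normrM.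
  have -> (X : R) : 2 * massg * X = X * massg + X * massg by ring.
  by apply: lerD; apply: ler_pM => //; exact: coscoef_le.
under eq_bigr do rewrite -mulr_sumr.
rewrite -mulr_sumr; apply: ler_wpM2l; first by rewrite mulr_ge0.
under eq_bigr do rewrite big_split /= -mulr_sumr -mulr_sumr.
rewrite big_split /= -mulr_sumr -mulr_suml; apply: lerD.
  apply: (@le_trans _ _ (\sum_(i < N.*2.+1) B)).
    apply: ler_sum => i _.
    have hi : (i <= N.*2)%N by rewrite -ltnS.
    (* In row [i], k + l = j - (2N - i): a geometric sum with its peak at [N.*2 - i]. *)
    apply: le_trans (geometric_distance_sum_le r01 N.*2.+1 (N.*2 - i)).
    rewrite le_eqVlt; apply/orP; left; apply/eqP; apply: eq_bigr => j _.
    by congr (_ ^+ _); lia.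
  rewrite sumr_const card_ord -[leLHS]mulr_natl [leRHS]mulrA; apply: ler_wpM2r => //.
  by rewrite mulrC -natrM ler_nat; lia.
apply: ler_wpM2l; first by rewrite mulr_ge0// ltW.
rewrite expr2; apply: ler_pM; rewrite ?geometric_distance_sum_le//.
  by apply: sumr_ge0 => i _; exact: exprn_ge0.
by apply: sumr_ge0 => i _; exact: exprn_ge0.
Qed.

End Expansion.

Lemma Fd_neq0 (F : finFieldType) (p d : nat) : prime p -> coprime d p -> (0 < #|Fd F p d|)%N.
Proof.
move=> p_pr dp; apply/card_gt0P; exists [ffun i => (i == ord_max)%:R].
rewrite inE ffunE eqxx oner_eq0 /=; apply/forallP => i; apply/implyP => pi.
rewrite ffunE; have [iM|//] := eqVneq i ord_max; move: pi; rewrite iM /= => pd.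
by move: dp; rewrite coprime_sym prime_coprime// pd.
Qed.

(** * The limit of the average for a real test function *)

Section AverageLimit.
Variables (R : realType) (p n : nat) (F : finFieldType) (psi : 'F_p -> R[i]).
Hypotheses (p_pr : prime p) (p2 : (2 < p)%N) (n0 : (0 < n)%N) (cardF : #|F| = (p ^ n)%N).
Hypotheses (psiA : add_char psi) (psi_nt : exists x, psi x != 1).
Variable theta : forall d : nat, {ffun 'I_d.+1 -> F} -> seq R.
Hypothesis zeros : forall (d : nat) (a : {ffun 'I_d.+1 -> F}), coprime d p -> a \in Fd F p d ->
  size (theta a) = d.-1 /\ normalised_zeros psi (poly_of a) (theta a).
Variables (g : R -> R -> R) (K th : R).
Hypothesis gc : continuous (fun z : R * R => g z.1 z.2).
Hypothesis gK : forall x y, `|g x y| <= K * (decay 0 1 x * decay 0 1 y).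
Hypothesis band : forall a b : R, 1 < `|a| + `|b| ->
  int2 (fun x y => g x y * cos (a * x + b * y)) = 0 /\
  int2 (fun x y => g x y * sin (a * x + b * y)) = 0.

Lemma avgE (d : nat) (f : {ffun 'I_d.+1 -> F} -> R[i]) :
  avg p f = ((#|Fd F p d|%:R)^-1)%:C * \sum_(a in Fd F p d) f a.
Proof. by rewrite /avg fmorphV rmorph_nat. Qed.

Lemma spectral_avg (d N : nat) (A : {ffun 'I_d.+1 -> F} -> int -> int -> R[i]) :
  spectral g N (fun k l => avg p (fun a => A a k l)) =
  (#|Fd F p d|%:R)^-1 * \sum_(a in Fd F p d) spectral g N (A a).
Proof.
rewrite /spectral -mulr_sumr [RHS]mulrCA; congr (_ * _).
rewrite [in RHS]exchange_big /= mulr_sumr; apply: eq_bigr => i _.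
rewrite [in RHS]exchange_big /= mulr_sumr; apply: eq_bigr => j _.
rewrite avgE RecZ ImcZ Rec_sum Imc_sum -!mulrA -mulrBr; congr (_ * _).
by rewrite !mulr_suml -sumrB.
Qed.

Lemma average_S2r_spectral (d : nat) : (1 < d)%N ->
  (#|Fd F p d|%:R)^-1 * (\sum_(a in Fd F p d) S2r g (d.-1)%:R (theta a) th) =
  spectral g d.-1 (fun k l => expi (- ((k + l)%:~R * th)) * pair_average p (@theta d) k l).
Proof.
move=> d1; have N0 : (0 < d.-1)%N by rewrite -ltnS (ltn_predK d1).
under eq_bigr do rewrite (S2r_spectral gc gK band N0).
rewrite -spectral_avg; congr spectral; apply/funext => k; apply/funext => l.
by rewrite /pair_average -avgZ; congr avg; apply/funext => a; rewrite pairsumE.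
Qed.

Lemma average_S2r_error (d : nat) : (1 < d)%N -> coprime d p ->
  `|(#|Fd F p d|%:R)^-1 * (\sum_(a in Fd F p d) S2r g (d.-1)%:R (theta a) th)
    - (4 * pi ^+ 2)^-1 * (int2 g - int2 (fun x y =>
         g x y * ((d.-1)%:R^-1 * fejer d.-1 ((x - y) / (d.-1)%:R))))|
  <= (4 * pi ^+ 2)^-1 * (2 * massg g *
      (3 * (2 / (1 - 84 / 100)) + 3 * (2 / (1 - 84 / 100)) ^+ 2)) / (d.-1)%:R.
Proof.
move=> d1 dp; rewrite average_S2r_spectral//.
have N0 : (0 < d.-1)%N by rewrite -ltnS (ltn_predK d1).
apply: (spectral_error gc gK band N0); [lra|move=> k l kl].
have h := pair_average_model p_pr p2 n0 cardF psiA psi_nt dp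
  (fun a => @zeros d a dp) (Fd_neq0 F p_pr dp) (ltnW d1) kl.
apply: le_trans h; rewrite le_eqVlt; apply/orP; left; apply/eqP.
(* The phase is 1 on the line k + l = 0, and elsewhere the model vanishes and the phase has modulus
   1. Hence the limit does not depend on [th]. *)
have [kl0|kl0] := eqVneq (k + l) 0; first by rewrite kl0 mul0r oppr0 expi0 mul1r.
have e0 : pair_model R d.-1 k l = 0.
  rewrite /pair_model (negPf kl0) subr0 ifF//; apply/negP => /andP[/eqP k0 /eqP l0].
  by rewrite k0 l0 addr0 eqxx in kl0.
rewrite e0 !subr0 normrM.
by rewrite [X in X * _]expi_norm mul1r.
Qed.

Lemma average_S2r_cvg (eps : R) : 0 < eps -> exists D : nat, forall d : nat,
  (D <= d)%N -> coprime d p ->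
  `|(#|Fd F p d|%:R)^-1 * (\sum_(a in Fd F p d) S2r g (d.-1)%:R (theta a) th)
    - (4 * pi ^+ 2)^-1 * int2 (fun x y => g x y * (1 - sinc ((x - y) / 2) ^+ 2))| < eps.
Proof.
move=> e0; have [cvgF gsinc] := cvg_fejer_diagonal gc gK.
set L := (4 * pi ^+ 2)^-1.
have L0 : 0 < L by rewrite invr_gt0 mulr_gt0// exprn_gt0// pi_gt0.
set C := (2 * massg g * (3 * (2 / (1 - 84 / 100)) + 3 * (2 / (1 - 84 / 100)) ^+ 2)).
have C0 : 0 <= C.
  have h : 0 <= 2 / (1 - 84 / 100) :> R by apply: divr_ge0 => //; lra.
  apply: mulr_ge0; first by apply: mulr_ge0 => //; apply: Rintegral_ge0 => z _.
  by apply: addr_ge0; apply: mulr_ge0 => //; exact: sqr_ge0.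
have -> : int2 (fun x y => g x y * (1 - sinc ((x - y) / 2) ^+ 2)) =
    int2 g - int2 (fun x y => g x y * sinc ((x - y) / 2) ^+ 2).
  rewrite /int2 -RintegralB//; last exact: integrable_plane gc gK.
  by apply: eq_Rintegral => z _; rewrite mulrBr mulr1.
have /cvgrPdist_lt /(_ (eps / (2 * L))) := cvgF.
rewrite divr_gt0 ?mulr_gt0// => /(_ isT)[D1 _ near1].
pose D2 := Num.truncn (2 * L * C / eps).
(* [D2] brings the O(1/(d - 1)) error below [eps / 2]. The kernel limit is indexed by n with n + 1 =
   d - 1, whence the added 2. *)
exists (maxn D1 D2 + 2)%N => d Dd dp.
have d1 : (1 < d)%N by lia.
set T := _^-1 * _; have := average_S2r_error d1 dp; rewrite -/T -/L -/C.
set Fj := int2 (fun x y => g x y * (_ * fejer _ _)) => err.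
have hF : `|int2 (fun x y => g x y * sinc ((x - y) / 2) ^+ 2) - Fj| < eps / (2 * L).
  have /= := near1 d.-2; rewrite /Fj (_ : d.-2.+1 = d.-1); last by lia.
  by apply; lia.
have hC : L * C / (d.-1)%:R < eps / 2.
  have N0 : 0 < (d.-1)%:R :> R by rewrite ltr0n; lia.
  rewrite ltr_pdivrMr// -ltr_pdivrMl ?divr_gt0// invf_div.
  have -> : 2 / eps * (L * C) = 2 * L * C / eps by ring.
  apply: lt_le_trans (truncnS_gt _) _.
  by rewrite ler_nat -/D2; lia.
have -> : T - L * (int2 g - int2 (fun x y => g x y * sinc ((x - y) / 2) ^+ 2)) =
  (T - L * (int2 g - Fj)) + L * (int2 (fun x y => g x y * sinc ((x - y) / 2) ^+ 2) - Fj) by ring.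
apply: le_lt_trans (ler_normD _ _) _.
rewrite [eps]splitr; apply: ltrD; first exact: le_lt_trans err hC.
rewrite normrM gtr0_norm// -ltr_pdivlMl//.
apply: lt_le_trans hF _; rewrite le_eqVlt; apply/orP; left; apply/eqP.
by field; rewrite gt_eqF.
Qed.

End AverageLimit.

(** * Schwartz functions and the passage to complex test functions *)

Section Schwartz.
Variable R : realType.
Local Notation mu2 := ((@lebesgue_measure R) \x (@lebesgue_measure R))%E.

Lemma schwartz2_continuous (g : R -> R -> R) : schwartz2 g ->
  continuous (fun z : R * R => g z.1 z.2).
Proof. by case=> smooth _; have [] := smooth 0%N 0%N. Qed.

(** Expanding (1 + x^2)(1 + y^2) gives four monomials, each controlled by one seminorm without
    derivatives. *)
Lemma schwartz2_decay (g : R -> R -> R) : schwartz2 g ->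
  exists K, forall x y, `|g x y| <= K * (decay 0 1 x * decay 0 1 y).
Proof.
case=> _ bnd.
have [M00 h00] := bnd 0%N 0%N 0%N 0%N; have [M20 h20] := bnd 0%N 0%N 2%N 0%N.
have [M02 h02] := bnd 0%N 0%N 0%N 2%N; have [M22 h22] := bnd 0%N 0%N 2%N 2%N.
exists (M00 + M20 + M02 + M22) => x y.
rewrite /decay !mul1r !subr0 -invfM ler_pdivlMr; last first.
  by rewrite mulr_gt0// ltr_wpDr ?sqr_ge0.
have := h00 x y; have := h20 x y; have := h02 x y; have := h22 x y.
rewrite /= !expr0 !mul1r !real_normK ?num_real//.
by move: `|g x y| => G; nra.
Qed.

(** One complex equation mixes the real and imaginary parts of [V]. The support is symmetric, so the
    transform also vanishes at (-a, -b); the four real equations together separate the four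
    integrals. *)
Lemma fourier2_band (V : R -> R -> R[i]) : schwartzC V ->
  (forall eta xi : R, 1 < `|eta| + `|xi| -> fourier2 V eta xi = 0) ->
  forall a b : R, 1 < `|a| + `|b| ->
  (int2 (fun x y => Rec (V x y) * cos (a * x + b * y)) = 0 /\
   int2 (fun x y => Rec (V x y) * sin (a * x + b * y)) = 0) /\
  (int2 (fun x y => Imc (V x y) * cos (a * x + b * y)) = 0 /\
   int2 (fun x y => Imc (V x y) * sin (a * x + b * y)) = 0).
Proof.
move=> [VR VI] V0 a b ab.
have trig (g : R -> R -> R) : schwartz2 g ->
    mu2.-integrable setT (EFin \o (fun z : R * R => g z.1 z.2 * cos (a * z.1 + b * z.2))) /\
    mu2.-integrable setT (EFin \o (fun z : R * R => g z.1 z.2 * sin (a * z.1 + b * z.2))).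
  move=> sg; have gc := schwartz2_continuous sg; have [K gK] := schwartz2_decay sg; split.
    have := integrable_cos gc gK a b 0; apply: eq_integrable => // z _ /=.
    by rewrite add0r.
  have := integrable_cos gc gK a b (- (pi / 2)); apply: eq_integrable => // z _ /=.
  by rewrite addrC cosBpihalf.
have [rc rs] := trig _ VR; have [ic is_] := trig _ VI.
have vanish eta xi : 1 < `|eta| + `|xi| ->
    int2 (fun t u => Rec (V t u * expi (- (eta * t + xi * u)))) = 0 /\
    int2 (fun t u => Imc (V t u * expi (- (eta * t + xi * u)))) = 0.
  move=> /V0 /eqP; rewrite /fourier2 mulf_eq0 => /orP[|/eqP[] //].
  rewrite -(rmorph0 (@real_complex R)) (inj_eq (@complexI R)) invr_eq0 mulf_eq0.
  by rewrite expf_eq0 (gt_eqF (pi_gt0 R)) pnatr_eq0.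
have [p1 p2] := vanish _ _ ab.
have [|m1 m2] := vanish (- a) (- b); first by rewrite !normrN.
have sgn x y : - (- a * x + - b * y) = a * x + b * y by ring.
have e1 : int2 (fun t u => Rec (V t u * expi (- (a * t + b * u)))) =
    int2 (fun x y => Rec (V x y) * cos (a * x + b * y)) +
    int2 (fun x y => Imc (V x y) * sin (a * x + b * y)).
  rewrite /int2 -RintegralD//; apply: eq_Rintegral => z _.
  by case: (V z.1 z.2) => v w; rewrite /= cosN sinN mulrN opprK.
have e2 : int2 (fun t u => Imc (V t u * expi (- (a * t + b * u)))) =
    int2 (fun x y => Imc (V x y) * cos (a * x + b * y)) -
    int2 (fun x y => Rec (V x y) * sin (a * x + b * y)).
  rewrite /int2 -RintegralB//; apply: eq_Rintegral => z _.
  by case: (V z.1 z.2) => v w; rewrite /= cosN sinN; ring.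
have e3 : int2 (fun t u => Rec (V t u * expi (- (- a * t + - b * u)))) =
    int2 (fun x y => Rec (V x y) * cos (a * x + b * y)) -
    int2 (fun x y => Imc (V x y) * sin (a * x + b * y)).
  rewrite /int2 -RintegralB//; apply: eq_Rintegral => z _.
  by case: (V z.1 z.2) => v w; rewrite sgn.
have e4 : int2 (fun t u => Imc (V t u * expi (- (- a * t + - b * u)))) =
    int2 (fun x y => Imc (V x y) * cos (a * x + b * y)) +
    int2 (fun x y => Rec (V x y) * sin (a * x + b * y)).
  rewrite /int2 -RintegralD//; apply: eq_Rintegral => z _.
  by case: (V z.1 z.2) => v w; rewrite /= sgn addrC; ring.
move: p1 p2 m1 m2; rewrite e1 e2 e3 e4 {e1 e2 e3 e4}.
move: (int2 _) (int2 _) (int2 _) (int2 _) => u1 u2 u3 u4 h1 h2 h3 h4.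
by split; split; lra.
Qed.

Lemma Rec_S2 (V : R -> R -> R[i]) c ths th :
  Rec (S2 V c ths th) = S2r (fun t u => Rec (V t u)) c ths th.
Proof. by rewrite /S2 Rec_sum; apply: eq_bigr => j _; rewrite Rec_sum. Qed.

Lemma Imc_S2 (V : R -> R -> R[i]) c ths th :
  Imc (S2 V c ths th) = S2r (fun t u => Imc (V t u)) c ths th.
Proof. by rewrite /S2 Imc_sum; apply: eq_bigr => j _; rewrite Imc_sum. Qed.

Lemma Rec_mainterm (V : R -> R -> R[i]) : Rec (mainterm V) = (4 * pi ^+ 2)^-1 *
  int2 (fun x y => Rec (V x y) * (1 - sinc ((x - y) / 2) ^+ 2)).
Proof.
rewrite /mainterm RecZ; congr (_ * _); apply: eq_Rintegral => z _.
by case: (V z.1 z.2) => v w; rewrite /= mulr0 subr0.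
Qed.

Lemma Imc_mainterm (V : R -> R -> R[i]) : Imc (mainterm V) = (4 * pi ^+ 2)^-1 *
  int2 (fun x y => Imc (V x y) * (1 - sinc ((x - y) / 2) ^+ 2)).
Proof.
rewrite /mainterm ImcZ; congr (_ * _); apply: eq_Rintegral => z _.
by case: (V z.1 z.2) => v w; rewrite /= mulr0 add0r.
Qed.

End Schwartz.

Theorem theorem3 (R : realType) (p n : nat) (F : finFieldType)
  (psi : 'F_p -> R[i]) (V : R -> R -> R[i])
  (theta : forall d : nat, {ffun 'I_d.+1 -> F} -> seq R) (th : R) :
  prime p -> (2 < p)%N -> (0 < n)%N -> #|F| = (p ^ n)%N ->
  add_char psi -> (exists x, psi x != 1) ->
  schwartzC V ->
  (forall eta xi : R, 1 < `|eta| + `|xi| -> fourier2 V eta xi = 0) ->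
  (forall (d : nat) (a : {ffun 'I_d.+1 -> F}), coprime d p -> a \in Fd F p d ->
     size (theta d a) = d.-1 /\ normalised_zeros psi (poly_of a) (theta d a)) ->
  forall eps : R, 0 < eps -> exists D : nat, forall d : nat, (D <= d)%N -> coprime d p ->
    `| (#|Fd F p d|%:R)^-1 * (\sum_(a in Fd F p d) S2 V (d.-1)%:R (theta d a) th)
       - mainterm V | < eps%:C.
Proof.
move=> p_pr p2 n0 cardF psiA psi_nt VS V0 zeros eps e0.
have band := fourier2_band VS V0; have [VR VI] := VS.
have [KR decayR] := schwartz2_decay VR; have [KI decayI] := schwartz2_decay VI.
have eps2 : 0 < eps / 2 by rewrite divr_gt0.
have [D1 h1] := average_S2r_cvg p_pr p2 n0 cardF psiA psi_nt zeros th
  (schwartz2_continuous VR) decayR (fun a b ab => (band a b ab).1) eps2.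
have [D2 h2] := average_S2r_cvg p_pr p2 n0 cardF psiA psi_nt zeros th
  (schwartz2_continuous VI) decayI (fun a b ab => (band a b ab).2) eps2.
exists (maxn D1 D2) => d; rewrite geq_max => /andP[d1 d2] dp.
have := h1 d d1 dp; have := h2 d d2 dp => hI hR.
rewrite -(rmorph_nat (@real_complex R)) -fmorphV.
(* Real and imaginary parts are separate real problems, each allowed [eps / 2]. *)
apply: le_lt_trans (norm_RecImc _) _; rewrite ltcR.
rewrite RecD RecN ImcD ImcN RecZ ImcZ Rec_mainterm Imc_mainterm Rec_sum Imc_sum.
under eq_bigr do rewrite Rec_S2.
under [X in _ + `|_ * X - _|]eq_bigr do rewrite Imc_S2.
by rewrite [eps]splitr; apply: ltrD.
Qed.
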